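(* The map $C\mapsto\alpha(C)$, sending the isomorphism class of a non-semisimple monomial Hopf $K$-algebra $C$ to the isomorphism class of its induced group datum, and the map $\alpha\mapsto A(\alpha)$, sending the isomorphism class of a group datum $\alpha$ over $K$ to the isomorphism class of the Hopf algebra $A(\alpha)$, give a one-to-one correspondence between the set of isoclasses of non-semisimple monomial Hopf $K$-algebras and the set of isoclasses of group data over $K$.
   Context: $K$ is a field of characteristic $0$ containing all roots of unity; $o(\cdot)$ denotes multiplicative order. The path coalgebra $KQ^c$ of a finite quiver $Q$ has basis all paths of $Q$, with $\Delta(p)=\sum_{\beta\alpha=p}\beta\otimes\alpha$ (sum over all factorizations of $p$ into a path $\alpha$ followed by a path $\beta$, including trivial ones), and $\varepsilon(p)=1$ if $p$ has length $0$, and $0$ otherwise. A monomial coalgebra is a subcoalgebra $C$ of some $KQ^c$ ($Q$ finite) such that $C$ contains all vertices and arrows of $Q$, $C$ is contained in the span of the paths of length $\le m-1$ for some $m\ge2$, and $C$ has a basis consisting of paths. A monomial Hopf algebra is a Hopf algebra whose underlying coalgebra is (isomorphic to) a monomial coalgebra. $G(C)$ denotes the group of group-like elements of a Hopf algebra $C$. For $x,y\in G(C)$, an element $c\in C$ is $x,y$-primitive if $\Delta(c)=c\otimes x+y\otimes c$; it is non-trivial if $c\notin K(x-y)$. A group datum $\alpha=(G,g,\chi,\mu)$ over $K$ consists of: (i) a finite group $G$ with an element $g$ in its center; (ii) a one-dimensional $K$-representation $\chi$ of $G$, i.e. a homomorphism $\chi:G\to K^\times$; (iii) an element $\mu\in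 K$ such that $\mu=0$ if $o(g)=o(\chi(g))$, and such that if $\mu\neq0$ then $\chi^{o(\chi(g))}=1$. Two group data $(G,g,\chi,\mu)$ and $(G',g',\chi',\mu')$ are isomorphic if there are a group isomorphism $f:G\to G'$ and some $0\neq\delta\in K$ such that $f(g)=g'$, $\chi=\chi'f$ and $\mu=\delta^d\mu'$, where $d=o(\chi(g))$. Let $C$ be a non-semisimple monomial Hopf algebra. A group datum $(G,g,\chi,\mu)$ is an induced group datum of $C$ if $G=G(C)$ and there exists a non-trivial $1,g$-primitive element $x\in C$ such that $x^d=\mu(1-g^d)$ and $xh=\chi(h)hx$ for all $h\in G$, where $d=o(\chi(g))$. An induced group datum exists and is unique up to isomorphism; $\alpha(C)$ denotes it. For a group datum $\alpha=(G,g,\chi,\mu)$ with $d=o(\chi(g))$, $A(\alpha)$ is the associative $K$-algebra generated by $x$ and all $h\in G$ (with the multiplication relations of $G$), with relations $x^d=\mu(1-g^d)$ and $xh=\chi(h)hx$ for all $h\in G$; its Hopf structure is $\Delta(x)=g\otimes x+x\otimes1$, $\varepsilon(x)=0$, $\Delta(h)=h\otimes h$, $\varepsilon(h)=1$, $S(x)=-g^{-1}x$, $S(h)=h^{-1}$ for $h\in G$.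
   Formalization: Group data are restricted to those with χ(g) ≠ 1 (d ≥ 2): if χ(g) = 1 then x = μ(1−g), so A(α) = KG is semisimple (e.g. G trivial gives A(α) = K) and does not lie in the set of non-semisimple monomial Hopf algebras. *)

(* Defs.v *)
From HB Require Import structures.
From mathcomp Require Import all_boot all_order all_fingroup all_algebra.
From mathcomp Require Import sesquilinear generic_quotient.
From mathcomp Require Import boolp.
From mathcomp Require Import finmap monalg.

Set Implicit Arguments.
Unset Strict Implicit.
Unset Printing Implicit Defensive.

Import GRing.Theory.
Local Open Scope ring_scope.
Local Open Scope quotient_scope.

(** [tensor U V] is the quotient of the formal finite sums [\sum_i u_i (x) v_i],
    represented by lists of pairs, by the relation identifying two sums on
    which all bilinear maps agree. *)

Section Tensor.
Variables (K : fieldType) (U V : lmodType K).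

Definition bieval (W : lmodType K) (b : U -> V -> W) (s : seq (U * V)) : W :=
  \sum_(p <- s) b p.1 p.2.

Definition tensor_rel (s t : seq (U * V)) : bool :=
  `[< forall (W : lmodType K) (b : {bilinear U -> V -> W}),
        bieval b s = bieval b t >].

Lemma tensor_relP s t :
  reflect (forall (W : lmodType K) (b : {bilinear U -> V -> W}),
             bieval b s = bieval b t) (tensor_rel s t).
Proof. exact: asboolP. Qed.

Lemma tensor_rel_refl : reflexive tensor_rel.
Proof. by move=> s; apply/tensor_relP. Qed.

Lemma tensor_rel_sym : symmetric tensor_rel.
Proof. by move=> s t; apply/tensor_relP/tensor_relP => h W b; rewrite h. Qed.

Lemma tensor_rel_trans : transitive tensor_rel.
Proof.
by move=> t s u /tensor_relP h1 /tensor_relP h2; apply/tensor_relP => W b;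
  rewrite h1 h2.
Qed.

Canonical tensor_equiv :=
  EquivRel tensor_rel tensor_rel_refl tensor_rel_sym tensor_rel_trans.

Definition tensor : Type := {eq_quot tensor_rel}.

HB.instance Definition _ := Choice.on tensor.
HB.instance Definition _ := EqQuotient.on tensor.

Definition tsum (s : seq (U * V)) : tensor := \pi_tensor s.
Definition tens (u : U) (v : V) : tensor := tsum [:: (u, v)].

(* The linear map induced by [f], meaningful only for bilinear [f]; taking any
   function avoids packing the maps below (see [tlift_tensE]). *)
Definition tlift (W : lmodType K) (f : U -> V -> W) (t : tensor) : W :=
  bieval f (repr t).

Lemma tsumP s t :
  tsum s = tsum t <-> forall (W : lmodType K) (b : {bilinear U -> V -> W}),
    bieval b s = bieval b t.
Proof.
split=> [/eqmodP /tensor_relP //|h].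
by apply/eqmodP/tensor_relP.
Qed.

Lemma tsum_repr t : tsum (repr t) = t.
Proof. exact: reprK. Qed.

Lemma tlift_tsum (W : lmodType K) (b : {bilinear U -> V -> W}) s :
  tlift b (tsum s) = bieval b s.
Proof. by rewrite /tlift; move: W b; apply/tsumP; rewrite tsum_repr. Qed.

Lemma tensor_ext s t :
  (forall (W : lmodType K) (b : {bilinear U -> V -> W}),
     tlift b s = tlift b t) -> s = t.
Proof.
move=> h; rewrite -[s]tsum_repr -[t]tsum_repr; apply/tsumP => W b.
exact: h.
Qed.

Definition tscale_seq (a : K) (s : seq (U * V)) := [seq (a *: p.1, p.2) | p <- s].

Lemma bieval_cat (W : lmodType K) (b : U -> V -> W) s t :
  bieval b (s ++ t) = bieval b s + bieval b t.
Proof. by rewrite /bieval big_cat. Qed.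

Lemma bieval_scale (W : lmodType K) (b : {bilinear U -> V -> W}) a s :
  bieval b (tscale_seq a s) = a *: bieval b s.
Proof.
rewrite /bieval big_map scaler_sumr; apply: eq_bigr => p _ /=.
by rewrite linearZl_LR.
Qed.

Definition tadd (s t : tensor) : tensor := tsum (repr s ++ repr t).
Definition tzero : tensor := tsum [::].
Definition tscale (a : K) (t : tensor) : tensor := tsum (tscale_seq a (repr t)).
Definition topp (t : tensor) : tensor := tscale (-1) t.

Section Lift.
Variables (W : lmodType K) (b : {bilinear U -> V -> W}).

Lemma tlift_add s t : tlift b (tadd s t) = tlift b s + tlift b t.
Proof. by rewrite tlift_tsum bieval_cat. Qed.

Lemma tlift_scale a t : tlift b (tscale a t) = a *: tlift b t.
Proof. by rewrite tlift_tsum bieval_scale. Qed.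

Lemma tlift_zero : tlift b tzero = 0.
Proof. by rewrite tlift_tsum /bieval big_nil. Qed.

End Lift.

Definition tliftE := (tlift_add, tlift_scale, tlift_zero).

Lemma taddA : associative tadd.
Proof. by move=> s t u; apply: tensor_ext => W b; rewrite !tliftE addrA. Qed.

Lemma taddC : commutative tadd.
Proof. by move=> s t; apply: tensor_ext => W b; rewrite !tliftE addrC. Qed.

Lemma tadd0 : left_id tzero tadd.
Proof. by move=> s; apply: tensor_ext => W b; rewrite !tliftE add0r. Qed.

Lemma taddN : left_inverse tzero topp tadd.
Proof.
by move=> s; apply: tensor_ext => W b; rewrite !tliftE scaleN1r addNr.
Qed.

HB.instance Definition _ := GRing.isZmodule.Build tensor taddA taddC tadd0 taddN.

Lemma tscaleA a a' t : tscale a (tscale a' t) = tscale (a * a') t.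
Proof. by apply: tensor_ext => W b; rewrite !tliftE scalerA. Qed.

Lemma tscale1 : left_id 1 tscale.
Proof. by move=> t; apply: tensor_ext => W b; rewrite !tliftE scale1r. Qed.

Lemma tscaleDr : right_distributive tscale +%R.
Proof.
by move=> a s t; apply: tensor_ext => W b; rewrite !tliftE scalerDr.
Qed.

Lemma tscaleDl t : {morph tscale^~ t : a a' / a + a'}.
Proof.
by move=> a a'; apply: tensor_ext => W b; rewrite !tliftE scalerDl.
Qed.

HB.instance Definition _ := GRing.Zmodule_isLmodule.Build K tensor
  tscaleA tscale1 tscaleDr tscaleDl.

Lemma tlift_is_linear (W : lmodType K) (b : {bilinear U -> V -> W}) :
  linear (tlift b).
Proof.
by move=> a s t; rewrite [LHS]tlift_add [in LHS]tlift_scale.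
Qed.

Lemma tlift_tens (W : lmodType K) (b : {bilinear U -> V -> W}) u v :
  tlift b (tens u v) = b u v.
Proof. by rewrite tlift_tsum /bieval big_seq1. Qed.

Lemma tlift_tensE (W : lmodType K) (f : U -> V -> W) :
  bilinear_for *:%R *:%R f ->
  linear (tlift f) /\ forall u v, tlift f (tens u v) = f u v.
Proof.
move=> bf; pose mf := bilinear_isBilinear.Build K U V W *:%R *:%R f bf.
pose b : {bilinear U -> V -> W} := HB.pack f mf.
by split=> [|u v]; [exact: (tlift_is_linear b) | exact: (tlift_tens b)].
Qed.

Lemma tens_is_bilinear : bilinear_for *:%R *:%R tens.
Proof.
split=> [v a u u'|u a v v'] /=; apply: tensor_ext => W b;
  rewrite [RHS]tlift_add [in RHS]tlift_scale !tlift_tens.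
- by rewrite linearPl.
- by rewrite linearPr.
Qed.

HB.instance Definition _ :=
  bilinear_isBilinear.Build K U V tensor *:%R *:%R tens tens_is_bilinear.

Lemma tsumE s : tsum s = \sum_(p <- s) tens p.1 p.2.
Proof.
apply: tensor_ext => W b; rewrite tlift_tsum /bieval.
elim: s => [|p s IH]; rewrite ?big_nil ?big_cons ?tlift_zero //.
by rewrite [RHS]tlift_add tlift_tens -IH.
Qed.

End Tensor.

Notation "u '\ox' v" := (tens u v) (at level 40, left associativity).

Section TensorMaps.
Variable K : fieldType.

Definition tmap (U V U' V' : lmodType K) (f : U -> U') (g : V -> V')
    (t : tensor U V) : tensor U' V' :=
  tlift (fun u v => f u \ox g v) t.

Definition tassoc (U V W : lmodType K) (t : tensor (tensor U V) W) :
    tensor U (tensor V W) :=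
  tlift (fun (s : tensor U V) w => tlift (fun u v => u \ox (v \ox w)) s) t.

(* The product of the algebra [A (x) A]. *)
Definition tmul (A : algType K) (s t : tensor A A) : tensor A A :=
  tlift (fun a b => tlift (fun a' b' => (a * a') \ox (b * b')) t) s.

Lemma tmapE (U V U' V' : lmodType K) (f : {linear U -> U'})
    (g : {linear V -> V'}) u v :
  tmap f g (u \ox v) = f u \ox g v.
Proof.
rewrite /tmap (tlift_tensE _).2 //; split=> [w a x y|w a x y] /=.
- by rewrite linearP linearPl.
- by rewrite linearP linearPr.
Qed.

Lemma tassocE (U V W : lmodType K) (u : U) (v : V) (w : W) :
  tassoc ((u \ox v) \ox w) = u \ox (v \ox w).
Proof.
pose f w (u : U) (v : V) := u \ox (v \ox w) : tensor U (tensor V W).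
have bf w' : bilinear_for *:%R *:%R (f w').
  by split=> [y a x x'|y a x x'] /=; rewrite /f ?linearPl ?linearPr.
rewrite /tassoc (tlift_tensE _).2 ?(tlift_tensE (bf w)).2 //.
split=> [y|t] /=; first exact: (tlift_tensE (bf y)).1.
move=> a x x'; rewrite /tlift /bieval scaler_sumr -big_split /=.
by apply: eq_bigr => p _; rewrite !linearPr.
Qed.

Lemma tmulE (A : algType K) (a b a' b' : A) :
  tmul (a \ox b) (a' \ox b') = (a * a') \ox (b * b').
Proof.
pose f a b (a' b' : A) := (a * a') \ox (b * b') : tensor A A.
have bf x y : bilinear_for *:%R *:%R (f x y).
  by split=> [z k u u'|z k u u'] /=;
    rewrite /f mulrDr -scalerAr ?linearPl ?linearPr.
rewrite /tmul (tlift_tensE _).2 ?(tlift_tensE (bf a b)).2 //.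
by split=> [z k u u'|z k u u'] /=; rewrite /tlift /bieval scaler_sumr -big_split;
  apply: eq_bigr => p _ /=; rewrite mulrDl -scalerAl ?linearPl ?linearPr.
Qed.

End TensorMaps.

Record hopfAlgebra (K : fieldType) := HopfAlgebra {
  hopf_alg :> algType K;
  comul : {linear hopf_alg -> tensor hopf_alg hopf_alg};
  counit : {scalar hopf_alg};
  antipode : {linear hopf_alg -> hopf_alg};
  comulA : forall c, tassoc (tmap comul id (comul c)) = tmap id comul (comul c);
  counitl : forall c, tlift (fun a b => counit a *: b) (comul c) = c;
  counitr : forall c, tlift (fun a b => counit b *: a) (comul c) = c;
  comul1 : comul 1 = 1 \ox 1;
  comulM : forall a b, comul (a * b) = tmul (comul a) (comul b);
  counit1 : counit 1 = 1;
  counitM : forall a b, counit (a * b) = counit a * counit b;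
  antipodel : forall c, tlift (fun a b => antipode a * b) (comul c) = counit c *: 1;
  antipoder : forall c, tlift (fun a b => a * antipode b) (comul c) = counit c *: 1
}.

Arguments comul {K h}.
Arguments counit {K h}.
Arguments antipode {K h}.

Definition hopf_iso (K : fieldType) (H H' : hopfAlgebra K) : Prop :=
  exists f : {lrmorphism H -> H'},
    [/\ bijective f,
        forall c, comul (f c) = tmap f f (comul c),
        forall c, counit (f c) = counit c
      & forall c, antipode (f c) = f (antipode c)].

Definition grouplike (K : fieldType) (H : hopfAlgebra K) (c : H) : Prop :=
  comul c = c \ox c /\ counit c = 1.

Definition skew_primitive (K : fieldType) (H : hopfAlgebra K) (x y c : H) : Prop :=
  comul c = c \ox x + y \ox c.

Definition nontrivial_skew_primitive (K : fieldType) (H : hopfAlgebra K)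
    (x y c : H) : Prop :=
  skew_primitive x y c /\ ~ (exists k : K, c = k *: (x - y)).

Definition left_ideal (A : nzRingType) (I : A -> Prop) : Prop :=
  [/\ I 0, forall a b, I a -> I b -> I (a + b) & forall r a, I a -> I (r * a)].

(* The left regular module is semisimple. *)
Definition semisimple (A : nzRingType) : Prop :=
  forall I : A -> Prop, left_ideal I ->
  exists J : A -> Prop,
    [/\ left_ideal J, forall a, I a -> J a -> a = 0
      & forall a, exists b c, [/\ I b, J c & a = b + c]].

Record quiver := Quiver {
  vertex : finType;
  arrow : finType;
  src : arrow -> vertex;
  tgt : arrow -> vertex
}.

Section Paths.
Variable Q : quiver.

(* [walk v s]: the arrows in [s], listed in the order in which they are
   traversed, form a path starting at [v]; it ends at [walk_end v s]. *)
Fixpoint walk (v : vertex Q) (s : seq (arrow Q)) : bool :=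
  if s is a :: s' then (src a == v) && walk (tgt a) s' else true.

Fixpoint walk_end (v : vertex Q) (s : seq (arrow Q)) : vertex Q :=
  if s is a :: s' then walk_end (tgt a) s' else v.

Definition qpath := {p : vertex Q * seq (arrow Q) | walk p.1 p.2}.

Definition qlength (p : qpath) : nat := size (val p).2.

Lemma walk_cat v s1 s2 :
  walk v (s1 ++ s2) = walk v s1 && walk (walk_end v s1) s2.
Proof. by elim: s1 v => //= a s1 IH v; rewrite IH andbA. Qed.

Lemma walk_take v s i : walk v s -> walk v (take i s).
Proof. by rewrite -{1}(cat_take_drop i s) walk_cat => /andP[]. Qed.

Lemma walk_drop v s i : walk v s -> walk (walk_end v (take i s)) (drop i s).
Proof. by rewrite -{1}(cat_take_drop i s) walk_cat => /andP[]. Qed.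

Definition vertex_path (v : vertex Q) : qpath := exist _ (v, [::]) isT.

Lemma arrow_walk (a : arrow Q) : walk (src a) [:: a].
Proof. by rewrite /= eqxx. Qed.

Definition arrow_path (a : arrow Q) : qpath := exist _ (src a, [:: a]) (arrow_walk a).

(* The factors of [p = beta alpha] in which [alpha], followed by [beta],
   has length [i]. *)
Definition path_alpha (p : qpath) (i : nat) : qpath :=
  exist _ ((val p).1, take i (val p).2) (walk_take i (valP p)).

Definition path_beta (p : qpath) (i : nat) : qpath :=
  exist _ (walk_end (val p).1 (take i (val p).2), drop i (val p).2)
    (walk_drop i (valP p)).

Variable K : fieldType.

Definition path_space := {malg K[qpath]}.

Definition path_elt (p : qpath) : path_space := << p >>.

Definition path_comul1 (p : qpath) : tensor path_space path_space :=
  \sum_(i < (qlength p).+1)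
    path_elt (path_beta p i) \ox path_elt (path_alpha p i).

Definition path_comul (f : path_space) : tensor path_space path_space :=
  \sum_(p <- msupp f) f@_p *: path_comul1 p.

Definition path_counit (f : path_space) : K :=
  \sum_(p <- msupp f) f@_p * (qlength p == 0%N)%:R.

Lemma path_comulE p : path_comul (path_elt p) = path_comul1 p.
Proof.
by rewrite /path_comul /path_elt msuppU oner_eq0 big_seq_fset1 mcoeffUU scale1r.
Qed.

(* The span of the set [P] of paths. *)
Definition path_span (P : qpath -> Prop) (f : path_space) : Prop :=
  forall p, p \in msupp f -> P p.

Definition subcoalgebra (D : path_space -> Prop) : Prop :=
  [/\ D 0,
      forall (k : K) f f', D f -> D f' -> D (k *: f + f')
    & forall f, D f -> exists s : seq (path_space * path_space),
        (forall p, p \in s -> D p.1 /\ D p.2) /\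
        path_comul f = \sum_(p <- s) p.1 \ox p.2].

Definition monomial_coalgebra (D : path_space -> Prop) : Prop :=
  [/\ subcoalgebra D,
      forall v, D (path_elt (vertex_path v)),
      forall a, D (path_elt (arrow_path a)),
      exists2 m, (2 <= m)%N &
        forall f, D f -> path_span (fun p => qlength p <= m.-1)%N f
    & exists P : qpath -> Prop, forall f, D f <-> path_span P f].

End Paths.

Definition monomial_hopf (K : fieldType) (H : hopfAlgebra K) : Prop :=
  exists (Q : quiver) (D : path_space Q K -> Prop)
         (phi : {linear H -> path_space Q K}),
    [/\ monomial_coalgebra D,
        injective phi,
        forall f, D f <-> exists c, f = phi c,
        forall c, path_comul (phi c) = tmap phi phi (comul c)
      & forall c, path_counit (phi c) = counit c].

(* The multiplicative order of [z], or [0] if it is infinite. *)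
Definition mulord (R : nzRingType) (z : R) : nat :=
  if pselect (exists n, (0 < n)%N && (z ^+ n == 1)) is left ex
  then ex_minn ex else 0%N.

Lemma mulord_prim (R : nzRingType) (z : R) n :
  (0 < n)%N -> mulord z = n <-> n.-primitive_root z.
Proof.
rewrite /mulord; case: pselect => [ex|nex] n_gt0; last first.
  split=> [e|h]; first by rewrite -e in n_gt0.
  by case: nex; exists n; rewrite n_gt0 prim_expr_order ?eqxx.
case: ex_minnP => m /andP[m_gt0 /eqP zm1] mmin; split=> [<-|h].
  have [k zk km] := prim_order_exists m_gt0 zm1.
  have : (m <= k)%N.
    by apply: mmin; rewrite (prim_order_gt0 zk) prim_expr_order ?eqxx.
  by move=> mk; have /eqP <- : k == m by rewrite eqn_leq mk dvdn_leq.
apply/eqP; rewrite eqn_leq mmin ?n_gt0 ?prim_expr_order ?eqxx //=.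
by rewrite dvdn_leq // (prim_order_dvd h) zm1 eqxx.
Qed.

Record group_datum (K : fieldType) := GroupDatum {
  gd_group : finGroupType;
  gd_g : gd_group;
  gd_chi : gd_group -> K;
  gd_mu : K;
  gd_gC : forall h, commute gd_g h;
  gd_chi_neq0 : forall h, gd_chi h != 0;
  gd_chiM : forall h h', gd_chi (h * h')%g = gd_chi h * gd_chi h';
  gd_mu_eq0 : #[gd_g]%g = mulord (gd_chi gd_g) -> gd_mu = 0;
  gd_mu_neq0 : gd_mu != 0 -> forall h, gd_chi h ^+ mulord (gd_chi gd_g) = 1
}.

Definition gd_d (K : fieldType) (alpha : group_datum K) : nat :=
  mulord (gd_chi (gd_g alpha)).

(* If [chi g = 1] then the relation [x ^+ 1 = mu (1 - g)] eliminates [x], and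
   [A(alpha)] is the semisimple group algebra of [G]; the correspondence
   concerns the data for which [d >= 2]. *)
Definition nontrivial_datum (K : fieldType) (alpha : group_datum K) : Prop :=
  gd_chi (gd_g alpha) <> 1.

Definition datum_iso (K : fieldType) (alpha alpha' : group_datum K) : Prop :=
  exists (f : gd_group alpha -> gd_group alpha') (delta : K),
    [/\ bijective f /\ {morph f : h h' / (h * h')%g},
        f (gd_g alpha) = gd_g alpha',
        forall h, gd_chi h = gd_chi (f h),
        delta != 0
      & gd_mu alpha = delta ^+ gd_d alpha * gd_mu alpha'].

(* The defining relations of [A(alpha)], for the images [x] and [iota h] in an
   algebra [B] of the generators. *)
Definition datum_relations (K : fieldType) (alpha : group_datum K)
    (B : algType K) (x : B) (iota : gd_group alpha -> B) : Prop :=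
  [/\ iota 1%g = 1,
      {morph iota : h h' / (h * h')%g >-> h * h'},
      x ^+ gd_d alpha = gd_mu alpha *: (1 - iota (gd_g alpha) ^+ gd_d alpha)
    & forall h, x * iota h = gd_chi h *: (iota h * x)].

(* [alpha] is an induced group datum of [C]; [iota] identifies [G] with the
   group of group-like elements of [C]. *)
Definition induced_group_datum (K : fieldType) (C : hopfAlgebra K)
    (alpha : group_datum K) : Prop :=
  exists (iota : gd_group alpha -> C) (x : C),
    [/\ injective iota,
        forall c, grouplike c <-> exists h, c = iota h,
        nontrivial_skew_primitive 1 (iota (gd_g alpha)) x
      & datum_relations x iota].

(* [H] is the Hopf algebra [A(alpha)]: as an algebra it is presented (i.e. it
   is universal among algebras with elements satisfying the relations) by the
   generators [x] and [iota h]. *)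
Definition is_datum_hopf (K : fieldType) (alpha : group_datum K)
    (H : hopfAlgebra K) : Prop :=
  exists (iota : gd_group alpha -> H) (x : H),
    [/\ datum_relations x iota,
        forall (B : algType K) (y : B) (j : gd_group alpha -> B),
          datum_relations y j ->
          exists2 f : {lrmorphism H -> B},
            f x = y /\ (forall h, f (iota h) = j h)
          & forall f' : {lrmorphism H -> B},
              f' x = y -> (forall h, f' (iota h) = j h) -> f' =1 f,
        [/\ comul x = iota (gd_g alpha) \ox x + x \ox 1,
            counit x = 0
          & antipode x = - (iota (gd_g alpha)^-1%g * x)]
      & forall h, [/\ comul (iota h) = iota h \ox iota h,
            counit (iota h) = 1
          & antipode (iota h) = iota h^-1%g]].

Definition isoclass (T : Type) (P : T -> Prop) (iso : T -> T -> Prop) : Type :=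
  {c : T -> Prop | exists2 a, P a & c = (fun b => P b /\ iso a b)}.

(* [f] is the map of isomorphism classes given by a construction [F] that is
   defined up to isomorphism: [F a b] states that [b] is a result of applying
   it to [a]. *)
Definition induced_by (T T' : Type) (P : T -> Prop) (iso : T -> T -> Prop)
    (P' : T' -> Prop) (iso' : T' -> T' -> Prop) (F : T -> T' -> Prop)
    (f : isoclass P iso -> isoclass P' iso') : Prop :=
  forall c a, sval c a ->
    (exists b, F a b) /\ (forall b, F a b -> sval (f c) b).

Definition one_to_one_correspondence (T T' : Type)
    (P : T -> Prop) (iso : T -> T -> Prop)
    (P' : T' -> Prop) (iso' : T' -> T' -> Prop)
    (F : T -> T' -> Prop) (G : T' -> T -> Prop) : Prop :=
  exists (f : isoclass P iso -> isoclass P' iso')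
         (g : isoclass P' iso' -> isoclass P iso),
    [/\ induced_by F f, induced_by G g, cancel f g & cancel g f].

Definition nonsemisimple_monomial_hopf (K : fieldType) (C : hopfAlgebra K) : Prop :=
  monomial_hopf C /\ ~ semisimple C.

(* Main.v *)
From HB Require Import structures.
From mathcomp Require Import all_boot all_order all_fingroup all_algebra.
From mathcomp Require Import sesquilinear generic_quotient boolp finmap monalg.
From mathcomp Require Import ring zify cyclic.
Require Import Defs.

Set Implicit Arguments.
Unset Strict Implicit.
Unset Printing Implicit Defensive.

Import GRing.Theory.
Local Open Scope ring_scope.

(** A monomial Hopf algebra [C] is handled through its coordinates along paths:
    the coordinate functionals multiply in the same way as paths, so that the
    group-like elements of [C] are the vertices, the nontrivial skew-primitive
    elements are given by the arrows, and path length defines a multiplicative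
    filtration.

    Since [C] is finite-dimensional there is a longest path, and a comparison of
    coproducts in top degree shows that only one arrow starts where this path
    does ([maximal_path_arrow]). Translating by group-like elements, one obtains
    that a nontrivial [1, g]-primitive element exists for at most one [g] and is
    unique up to scalars and [1 - g] ([skew_primitive_unique]); if there is none
    then [C] is a group algebra, hence semisimple. By uniqueness [g] is central,
    and averaging over the group yields an eigenvector [x] for conjugation, with
    character [chi] ([eigen_skew_primitive]). With [d] the order of [chi g], the
    power [x ^+ d] is again skew-primitive, because [x (x) 1] and [g (x) x] span
    a quantum plane at a primitive [d]-th root of unity; hence it is trivial,
    which is the relation defining [mu] ([induced_exists]). The same uniqueness
    shows that another choice of [x] only rescales [mu] ([induced_unique]).

    In top degree, the product of two paths is a multiple of a path by a Gaussian
    binomial coefficient at [(chi g)^-1] ([pcoef_top_mul]). In characteristic 0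
    the coefficient [qbinom (N + d) d] is not zero, and therefore all paths have
    length less than [d] ([path_length_bound]). On the other hand [x ^+ n * h] is
    for [n < d] a nonzero multiple of the path of length [n] starting at [h], up
    to shorter paths. Thus the monomials [x ^+ n * h] form a basis of [C], and
    [C] is presented by its induced datum ([induced_is_datum_hopf]).

    Conversely, the algebra presented by a datum is constructed on the vector
    space with basis the [x ^+ n * h], by means of its regular representation.
    Its universal property provides the coproduct, the counit and the antipode
    ([is_datum_hopf_alg]). It is isomorphic, as a coalgebra, to the paths of
    length less than [d] in the quiver with vertices [h] and arrows from [h] to
    [g * h] ([datum_model]), and it is not semisimple because the counit
    vanishes on its integrals ([datum_hopf_not_semisimple]). *)

(** * Gaussian binomial coefficients at roots of unity *)

Section QBinomial.
Variables (K : fieldType) (r : K).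

Definition qint n : K := \sum_(i < n) r ^+ i.

Definition qfact n : K := \prod_(i < n) qint i.+1.

(** The Pascal rule which matches the relation [b * a = r *: (a * b)] and powers
    of [a] written on the left. *)
Fixpoint qbinom n k : K :=
  match n, k with
  | _, 0 => 1
  | 0, _.+1 => 0
  | n'.+1, k'.+1 => qbinom n' k' + r ^+ k'.+1 * qbinom n' k'.+1
  end.

Lemma qbinom0 n : qbinom n 0 = 1. Proof. by case: n. Qed.

Lemma qbinomS n k :
  qbinom n.+1 k.+1 = qbinom n k + r ^+ k.+1 * qbinom n k.+1.
Proof. by []. Qed.

Lemma qbinom_small n k : (n < k)%N -> qbinom n k = 0.
Proof.
elim: n k => [|n IH] [|k] //= nk.
by rewrite !IH ?mulr0 ?addr0 // ltnW.
Qed.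

Lemma qbinomnn n : qbinom n n = 1.
Proof. by elim: n => //= n ->; rewrite qbinom_small // mulr0 addr0. Qed.

Lemma qint_split m n : qint (m + n) = qint m + r ^+ m * qint n.
Proof.
rewrite /qint big_split_ord /= mulr_sumr; congr (_ + _).
by apply: eq_bigr => i _; rewrite exprD.
Qed.

Lemma qfactS n : qfact n.+1 = qfact n * qint n.+1.
Proof. by rewrite /qfact big_ord_recr. Qed.

Lemma qbinom_qfact n k : (k <= n)%N ->
  qfact k * qfact (n - k) * qbinom n k = qfact n.
Proof.
elim: n k => [|n IH] [|k] //= kn.
- by rewrite /qfact !big_ord0 !mulr1.
- by rewrite [qfact 0]/qfact big_ord0 subn0 mul1r mulr1.
rewrite subSS mulrDr; move: kn; rewrite ltnS leq_eqVlt => /orP[/eqP->|kn].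
  rewrite qbinomnn qbinom_small // !mulr0 addr0 subnn.
  by rewrite [qfact 0]/qfact big_ord0 !mulr1.
have e : (n - k = (n - k.+1).+1)%N by rewrite subnSK.
have IHk := IH k (ltnW kn); have := IH k.+1 kn.
rewrite e [qfact k.+1]qfactS qfactS -e => IHk1.
have -> : qfact k * qint k.+1 * (qfact (n - k.+1) * qint (n - k)) * qbinom n k =
    qint k.+1 * qfact n by rewrite -IHk e qfactS -e; ring.
have -> : qfact k * qint k.+1 * (qfact (n - k.+1) * qint (n - k)) *
    (r ^+ k.+1 * qbinom n k.+1) = r ^+ k.+1 * qint (n - k) * qfact n.
  by rewrite -IHk1; ring.
rewrite -mulrDl -qint_split mulrC [qfact n.+1]qfactS; congr (_ * qint _).
by rewrite addSn subnKC // ltnW.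
Qed.

Lemma qbinomS1 n : qbinom n.+1 n = qint n.+1.
Proof.
elim: n => [|n IH]; first by rewrite /qint big_ord1.
rewrite qbinomS IH qbinomnn mulr1 [RHS]/qint big_ord_recr /=.
by [].
Qed.

Arguments qbinom : simpl never.

Section Primitive.
Variables (d : nat) (rP : d.-primitive_root r).

Lemma qint_prim_neq0 j : (0 < j < d)%N -> qint j != 0.
Proof.
move=> /andP[j0 jd]; apply/eqP => e.
have := subrX1 r j; rewrite -/(qint j) e mulr0 => /eqP.
by rewrite subr_eq0 -(prim_order_dvd rP) gtnNdvd.
Qed.

Lemma qfact_prim_neq0 j : (j < d)%N -> qfact j != 0.
Proof.
move=> jd; apply/prodf_neq0 => i _; apply: qint_prim_neq0 => /=.
exact: leq_ltn_trans jd.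
Qed.

Lemma qint_prim : (1 < d)%N -> qint d = 0.
Proof.
move=> d1; have := subrX1 r d; rewrite -/(qint d) (prim_expr_order rP) subrr.
move=> /esym /eqP; rewrite mulf_eq0 subr_eq0 => /orP[/eqP r1|/eqP//].
by move: (prim_order_dvd rP 1); rewrite expr1 r1 eqxx dvdn1 gtn_eqF.
Qed.

Lemma qbinom_prim k : (0 < k < d)%N -> qbinom d k = 0.
Proof.
move=> /andP[k0 kd]; have := qbinom_qfact (ltnW kd).
have d0 := prim_order_gt0 rP.
have -> : qfact d = 0.
  by rewrite -(prednK d0) qfactS prednK // qint_prim ?mulr0 // (leq_ltn_trans k0).
move/eqP; rewrite !mulf_eq0 (negPf (qfact_prim_neq0 kd)).
rewrite (negPf (qfact_prim_neq0 _)) ?ltn_subLR ?(ltnW kd) //=; first by move/eqP.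
by rewrite -[X in (X < _)%N]add0n ltn_add2r.
Qed.

(** Since [(a + b) ^+ d = a ^+ d + b ^+ d] in the quantum plane, [d] steps of the
    Pascal rule amount to one step of the ordinary one. *)
Lemma qbinom_addl n k :
  qbinom (n + d) k = qbinom n k + (if (d <= k)%N then qbinom n (k - d) else 0).
Proof.
have d0 := prim_order_gt0 rP.
elim: n k => [|n IH] k.
  rewrite add0n; case: k => [|k].
    by rewrite !qbinom0 leqNgt d0 addr0.
  rewrite [qbinom 0 k.+1]/= add0r; case: ltngtP => [dk|dk|->].
  - by rewrite qbinom_small // qbinom_small // subn_gt0.
  - by rewrite qbinom_prim // dk.
  - by rewrite qbinomnn subnn.
case: k => [|k]; first by rewrite !qbinom0 leqNgt d0 addr0.
rewrite addSn !qbinomS !IH mulrDr addrACA; congr (_ + _).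
case: (ltngtP d k.+1) => [dk|dk|dk].
- rewrite -ltnS dk subSn // qbinomS -subSn //.
  rewrite -[X in _ + X * _](prim_expr_mod rP) -[in RHS](prim_expr_mod rP).
  by rewrite -{1}(subnK (ltnW dk)) modnDr.
- by rewrite leqNgt (ltn_trans _ dk) // mulr0 addr0.
- by rewrite leqNgt -dk dk ltnSn -dk add0r subnn !qbinom0 (prim_expr_order rP) mul1r.
Qed.

(** For [d <= n] this is zero in positive characteristic only, which is where the
    characteristic of the ground field enters the classification. *)
Lemma qbinom_divn n : qbinom n d = (n %/ d)%:R.
Proof.
have d0 := prim_order_gt0 rP.
rewrite {1}(divn_eq n d); elim: (n %/ d)%N => [|m IH].
  by rewrite mul0n add0n qbinom_small ?ltn_mod.
by rewrite mulSn -addnA addnC qbinom_addl leqnn subnn qbinom0 IH -natr1.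
Qed.

End Primitive.

Variable A : algType K.

Lemma expr_qcomm (a b : A) k : b * a = r *: (a * b) ->
  b * a ^+ k = r ^+ k *: (a ^+ k * b).
Proof.
move=> ba; elim: k => [|k IH]; first by rewrite !expr0 mulr1 mul1r scale1r.
rewrite exprSr mulrA IH -scalerAl -!mulrA ba -scalerAr scalerA mulrA.
by rewrite -!exprSr.
Qed.

Lemma expr_qcommr (a b : A) k : b * a = r *: (a * b) ->
  b ^+ k * a = r ^+ k *: (a * b ^+ k).
Proof.
move=> ba; elim: k => [|k IH]; first by rewrite !expr0 mulr1 mul1r scale1r.
rewrite [in LHS]exprS -mulrA IH -scalerAr mulrA ba -scalerAl scalerA -mulrA.
by rewrite -exprS -exprSr.
Qed.

Lemma exprD_qcomm (a b : A) n : b * a = r *: (a * b) ->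
  (a + b) ^+ n = \sum_(k < n.+1) qbinom n k *: (a ^+ k * b ^+ (n - k)).
Proof.
move=> ba; elim: n => [|n IH].
  by rewrite big_ord1 qbinom0 scale1r !expr0 mulr1.
rewrite exprS IH mulrDl !mulr_sumr.
rewrite [X in _ + X]big_ord_recl [in RHS]big_ord_recl !qbinom0 !subn0 !scale1r.
rewrite !expr0 !mul1r -exprS addrCA; congr (_ + _).
under eq_bigr => i _ do rewrite -scalerAr mulrA -exprS.
under [in X in _ + X]eq_bigr => i _ do
  rewrite -scalerAr mulrA (expr_qcomm _ ba) -scalerAl scalerA mulrC -mulrA -exprS.
under [in RHS]eq_bigr => i _ do rewrite lift0 qbinomS subSS scalerDl.
rewrite [in RHS]big_split /=; congr (_ + _).
rewrite [in RHS]big_ord_recr /= qbinom_small // mulr0 scale0r addr0.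
apply: eq_bigr => i _; rewrite /bump /= !add1n subnSK //.
Qed.

Lemma exprD_prim (d : nat) (a b : A) : d.-primitive_root r ->
  b * a = r *: (a * b) -> (a + b) ^+ d = a ^+ d + b ^+ d.
Proof.
move=> rP /exprD_qcomm ->; have d0 := prim_order_gt0 rP.
case: d rP d0 => // d dP _.
rewrite big_ord_recr big_ord_recl /= qbinom0 qbinomnn subn0 subnn !scale1r.
rewrite !expr0 mul1r mulr1 big1 ?addr0 1?addrC // => i _.
by rewrite (qbinom_prim dP) ?scale0r //= /bump add1n ltnS ltn_ord.
Qed.

End QBinomial.

(** * Linear maps on tensor products and the tensor product of algebras *)

Section LinearMaps.
Variables (K : fieldType) (U W : lmodType K).

Lemma lin0 (F : U -> W) : linear F -> F 0 = 0.
Proof.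
by move=> lF; have := lF (-1) 0 0; rewrite scaler0 add0r scaleN1r addNr.
Qed.

Lemma linD (F : U -> W) : linear F -> {morph F : u v / u + v}.
Proof. by move=> lF u v; have := lF 1 u v; rewrite !scale1r. Qed.

Lemma linZ (F : U -> W) : linear F -> forall a, {morph F : u / a *: u}.
Proof. by move=> lF a u; have := lF a u 0; rewrite (lin0 lF) !addr0. Qed.

Lemma linB (F : U -> W) : linear F -> {morph F : u v / u - v}.
Proof. by move=> lF u v; rewrite -!scaleN1r (linD lF) (linZ lF). Qed.

Lemma lin_sum (F : U -> W) : linear F -> forall I (s : seq I) (P : pred I) E,
  F (\sum_(i <- s | P i) E i) = \sum_(i <- s | P i) F (E i).
Proof. move=> lF I s P E; exact: (big_morph F (linD lF) (lin0 lF)). Qed.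

End LinearMaps.

Section TensorLinear.
Variables (K : fieldType) (U V W : lmodType K).

Lemma tensor_linP (F G : tensor U V -> W) : linear F -> linear G ->
  (forall u v, F (u \ox v) = G (u \ox v)) -> F =1 G.
Proof.
move=> lF lG FG t; rewrite -(tsum_repr t) tsumE.
elim: (repr t) => [|p s IH]; first by rewrite big_nil (lin0 lF) (lin0 lG).
by rewrite big_cons (linD lF) (linD lG) IH FG.
Qed.

Lemma tlift_linear (f : U -> V -> W) : bilinear_for *:%R *:%R f -> linear (tlift f).
Proof. by case/tlift_tensE. Qed.

Lemma tlift_ext (f f' : U -> V -> W) t : (forall u v, f u v = f' u v) ->
  tlift f t = tlift f' t.
Proof. by move=> e; apply: eq_bigr => p _; apply: e. Qed.

Lemma tlift_linear_param (X : lmodType K) (f : X -> U -> V -> W) t :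
  (forall u v, linear (fun x => f x u v)) -> linear (fun x => tlift (f x) t).
Proof.
move=> lf a x y; rewrite /tlift /bieval scaler_sumr -big_split /=.
by apply: eq_bigr => p _; apply: lf.
Qed.

Lemma comp_linear (F : V -> W) (G : U -> V) :
  linear F -> linear G -> linear (fun x => F (G x)).
Proof. by move=> lF lG a x y; rewrite lG lF. Qed.

End TensorLinear.

Lemma tlift_comp (K : fieldType) (U V W W' : lmodType K) (F : W -> W') (f : U -> V -> W) t :
  linear F -> F (tlift f t) = tlift (fun u v => F (f u v)) t.
Proof. by move=> lF; rewrite /tlift /bieval (lin_sum lF). Qed.

Section TMap.
Variables (K : fieldType) (U V U' V' : lmodType K).

Lemma tens_linl (v : V) : linear (fun u : U => u \ox v).
Proof. by move=> a x y; rewrite linearPl. Qed.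

Lemma tens_linr (u : U) : linear (fun v : V => u \ox v).
Proof. by move=> a x y; rewrite linearPr. Qed.

Variables (f : U -> U') (g : V -> V').
Hypotheses (lf : linear f) (lg : linear g).

Let bi : bilinear_for *:%R *:%R (fun u v => f u \ox g v).
Proof. by split=> [v|u] a x y /=; rewrite ?lf ?lg ?linearPl ?linearPr. Qed.

Lemma tmap_linear : linear (tmap f g).
Proof. exact: tlift_linear. Qed.

Lemma tmap_tens u v : tmap f g (u \ox v) = f u \ox g v.
Proof. by rewrite /tmap (tlift_tensE bi).2. Qed.

Lemma tlift_tmap (W : lmodType K) (h : U' -> V' -> W) t :
  bilinear_for *:%R *:%R h ->
  tlift h (tmap f g t) = tlift (fun u v => h (f u) (g v)) t.
Proof.
move=> bh; rewrite {1}/tmap tlift_comp; last exact: tlift_linear.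
by apply: tlift_ext => u v; rewrite (tlift_tensE bh).2.
Qed.

End TMap.

Lemma id_linear (K : fieldType) (U : lmodType K) : linear (@id U).
Proof. by []. Qed.

Section TensorProduct.
Variables (K : fieldType) (A B : algType K).

Definition tmulg (s t : tensor A B) : tensor A B :=
  tlift (fun a b => tlift (fun a' b' => (a * a') \ox (b * b')) t) s.

Let bi1 (a : A) (b : B) : bilinear_for *:%R *:%R
  (fun a' b' => (a * a') \ox (b * b') : tensor A B).
Proof.
by split=> [z k u u'|z k u u'] /=; rewrite mulrDr -scalerAr ?linearPl ?linearPr.
Qed.

Let bi2 (t : tensor A B) : bilinear_for *:%R *:%R
  (fun (a : A) (b : B) => tlift (fun a' b' => (a * a') \ox (b * b')) t : tensor A B).
Proof.
split=> [b|a]; apply: tlift_linear_param => a' b' k u u' /=;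
 by rewrite mulrDl -scalerAl ?linearPl ?linearPr.
Qed.

Lemma tmulg_linl t : linear (tmulg^~ t).
Proof. exact: tlift_linear. Qed.

Lemma tmulg_linr s : linear (tmulg s).
Proof.
apply: tlift_linear_param => a b; exact: tlift_linear.
Qed.

Lemma tmulgE a b a' b' : tmulg (a \ox b) (a' \ox b') = (a * a') \ox (b * b').
Proof. by rewrite /tmulg (tlift_tensE (bi2 _)).2 (tlift_tensE (bi1 _ _)).2. Qed.

Lemma tmulgA : associative tmulg.
Proof.
move=> s t u; move: s; apply: tensor_linP => [||a b].
- exact: tmulg_linl.
- exact: (comp_linear (tmulg_linl u) (tmulg_linl t)).
move: t; apply: tensor_linP => [||a' b'].
- exact: (comp_linear (tmulg_linr _) (tmulg_linl u)).
- exact: (comp_linear (tmulg_linl u) (tmulg_linr _)).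
move: u; apply: tensor_linP => [||a'' b''].
- exact: (comp_linear (tmulg_linr _) (tmulg_linr _)).
- exact: tmulg_linr.
by rewrite !tmulgE !mulrA.
Qed.

Lemma tmul1g : left_id (1 \ox 1) tmulg.
Proof.
apply: tensor_linP => [||a b]; [exact: tmulg_linr|by []|by rewrite tmulgE !mul1r].
Qed.

Lemma tmulg1 : right_id (1 \ox 1) tmulg.
Proof.
apply: tensor_linP => [||a b]; [exact: tmulg_linl|by []|by rewrite tmulgE !mulr1].
Qed.

Lemma tmulgDl : left_distributive tmulg +%R.
Proof. by move=> s t u; rewrite (linD (tmulg_linl u)). Qed.

Lemma tmulgDr : right_distributive tmulg +%R.
Proof. by move=> s t u; rewrite (linD (tmulg_linr s)). Qed.

Lemma tens_neq0 (f : A -> K) (g : B -> K) (u : A) (v : B) :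
  linear (f : A -> K^o) -> linear (g : B -> K^o) -> f u != 0 -> g v != 0 ->
  u \ox v != 0.
Proof.
move=> lf lg fu gv; apply/eqP => e.
pose h a b : K^o := f a * g b.
have bh : bilinear_for *:%R *:%R h.
  split=> [b|a] k x y; rewrite /h /= ?lf ?lg ?mulrDl ?mulrDr; congr (_ + _).
    exact/esym/mulrA.
  exact: mulrCA.
have := (tlift_tensE bh).2 u v; rewrite e (lin0 (tlift_linear bh)) /h => /esym /eqP.
by rewrite mulf_eq0 (negPf fu) (negPf gv).
Qed.

End TensorProduct.

(** The unit of [A (x) B] can only be separated from [0] by means of linear
    functionals; here the augmentations of [A] and [B] serve that purpose. *)
Record augmented (K : fieldType) := Augmented {
  aug_alg :> algType K;
  aug : aug_alg -> K;
  aug_linear : linear (aug : aug_alg -> K^o);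
  aug1 : aug 1 = 1
}.

Section TensorAlgebra.
Variables (K : fieldType) (A B : augmented K).

Definition tensor_alg := tensor A B.

HB.instance Definition _ := GRing.Lmodule.on tensor_alg.

Lemma tensor_alg_oner_neq0 : (1 : A) \ox (1 : B) != 0 :> tensor A B.
Proof.
by apply: (tens_neq0 (@aug_linear _ A) (@aug_linear _ B)); rewrite aug1 oner_neq0.
Qed.

HB.instance Definition _ := GRing.Zmodule_isNzRing.Build tensor_alg
  (@tmulgA _ A B) (@tmul1g _ A B) (@tmulg1 _ A B) (@tmulgDl _ A B) (@tmulgDr _ A B)
  tensor_alg_oner_neq0.

Lemma tensor_alg_scaleAl (k : K) (s t : tensor_alg) : k *: (s * t) = (k *: s) * t.
Proof. exact/esym/(linZ (@tmulg_linl _ A B t)). Qed.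

HB.instance Definition _ :=
  GRing.Lmodule_isLalgebra.Build K tensor_alg tensor_alg_scaleAl.

Lemma tensor_alg_scaleAr (k : K) (s t : tensor_alg) : k *: (s * t) = s * (k *: t).
Proof. exact/esym/(linZ (@tmulg_linr _ A B s)). Qed.

HB.instance Definition _ :=
  GRing.Lalgebra_isAlgebra.Build K tensor_alg tensor_alg_scaleAr.

Lemma tensor_algM (a a' : A) (b b' : B) :
  (a \ox b : tensor_alg) * (a' \ox b') = (a * a') \ox (b * b').
Proof. exact: tmulgE. Qed.

Lemma tensor_algX (a : A) (b : B) n :
  (a \ox b : tensor_alg) ^+ n = (a ^+ n) \ox (b ^+ n).
Proof.
by elim: n => [//|n IH]; rewrite !exprS IH tensor_algM.
Qed.

End TensorAlgebra.

Section TensorAssoc.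
Variables (K : fieldType) (U V W : lmodType K).

Lemma tassoc_linear : linear (@tassoc K U V W).
Proof.
apply: tlift_linear; split=> [w|t].
  apply: tlift_linear; split=> [v|u] a x y /=; first by rewrite linearPl.
  by rewrite linearPl linearPr.
by apply: tlift_linear_param => u v a x y; rewrite !linearPr.
Qed.

End TensorAssoc.

(** * The algebra presented by a group datum *)

Section MultiplicativeOrder.
Variables (R : nzRingType) (z : R).

Lemma mulord_gt0 n : (0 < n)%N -> z ^+ n = 1 -> (0 < mulord z)%N.
Proof.
move=> n0 zn; rewrite /mulord; case: pselect => [ex|[]].
  by case: ex_minnP => m /andP[].
by exists n; rewrite n0 zn eqxx.
Qed.

End MultiplicativeOrder.

Lemma prim_rootV (F : fieldType) n (z : F) :
  n.-primitive_root z -> n.-primitive_root z^-1.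
Proof.
rewrite /primitive_root_of_unity => /andP[-> /forallP h] /=.
by apply/forallP => i; rewrite -(eqP (h i)) !unity_rootE exprVn invr_eq1.
Qed.

Lemma morph_mulgX (G : finGroupType) (B : nzRingType) (j : G -> B) :
  j 1%g = 1 -> {morph j : h h' / (h * h')%g >-> h * h'} ->
  forall h n, j (h ^+ n)%g = j h ^+ n.
Proof. by move=> j1 jM h; elim=> [|n IH]; rewrite ?expg0 // expgS jM IH exprS. Qed.

Section DatumArithmetic.
Variables (K : fieldType) (alpha : group_datum K).
Local Notation G := (gd_group alpha).
Local Notation g := (gd_g alpha).
Local Notation chi := (@gd_chi K alpha).
Local Notation mu := (gd_mu alpha).
Local Notation d := (gd_d alpha).

Lemma gd_chi1 : chi 1%g = 1.
Proof.
apply: (mulfI (gd_chi_neq0 (1%g : G))).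
by rewrite -gd_chiM mulg1 mulr1.
Qed.

Lemma gd_chiX h n : chi (h ^+ n)%g = chi h ^+ n.
Proof.
elim: n => [|n IH]; first by rewrite expg0 gd_chi1.
by rewrite expgS gd_chiM IH exprS.
Qed.

Lemma gd_chiV h : chi h^-1%g = (chi h)^-1.
Proof.
apply: (mulfI (gd_chi_neq0 h)); rewrite -gd_chiM mulgV gd_chi1 mulfV //.
exact: gd_chi_neq0.
Qed.

Lemma gd_d_gt0 : (0 < d)%N.
Proof.
apply: (@mulord_gt0 _ _ #[g]%g); first exact: order_gt0.
by rewrite -gd_chiX expg_order gd_chi1.
Qed.

Lemma gd_chi_prim : d.-primitive_root (chi g).
Proof. exact/(mulord_prim _ gd_d_gt0). Qed.

Lemma gd_chiV_prim : d.-primitive_root (chi g)^-1.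
Proof. exact/prim_rootV/gd_chi_prim. Qed.

Lemma gd_chi_gd : chi (g ^+ d)%g = 1.
Proof. by rewrite gd_chiX (prim_expr_order gd_chi_prim). Qed.

Lemma gd_mu_chi h : mu * chi h ^+ d = mu.
Proof.
have [->|mu0] := eqVneq mu 0; first by rewrite mul0r.
by rewrite (gd_mu_neq0 mu0) mulr1.
Qed.

Lemma gd_mu_expg_eq1 : (g ^+ d = 1)%g -> mu = 0.
Proof.
move=> gd1; apply: gd_mu_eq0; apply/eqP; rewrite eqn_dvd; apply/andP; split.
  by rewrite order_dvdn gd1.
by rewrite (prim_order_dvd gd_chi_prim) -gd_chiX expg_order gd_chi1.
Qed.

Lemma nontrivial_d_gt1 : nontrivial_datum alpha -> (1 < d)%N.
Proof.
move=> nt; rewrite ltn_neqAle gd_d_gt0 andbT; apply/eqP => d1; apply: nt.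
by rewrite -[LHS]expr1 d1 (prim_expr_order gd_chi_prim).
Qed.

End DatumArithmetic.

Section DatumAlgebra.
Variables (K : fieldType) (alpha : group_datum K).
Local Notation G := (gd_group alpha).
Local Notation g := (gd_g alpha).
Local Notation chi := (@gd_chi K alpha).
Local Notation mu := (gd_mu alpha).
Local Notation d := (gd_d alpha).

(** The defining relations for operators. The regular representation has to be
    available before the product, which is defined by means of it. *)
Definition datum_action (W : lmodType K) (y : W -> W) (j : G -> W -> W) : Prop :=
  [/\ linear y /\ forall h, linear (j h),
      forall w, j 1%g w = w,
      forall h h' w, j (h * h')%g w = j h (j h' w),
      forall h w, y (j h w) = chi h *: j h (y w)
    & forall w, iter d y w = mu *: (w - j (g ^+ d)%g w)].

(** The predecessor-successor form of the index bound makes ['I_n] inhabited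
    by construction. *)
Definition datum_alg := {ffun 'I_d.-1.+1 * G -> K^o}.

HB.instance Definition _ := GRing.Lmodule.on datum_alg.

Lemma predn_d : d.-1.+1 = d.
Proof. exact: prednK (gd_d_gt0 alpha). Qed.

(** [pbw n h] is the basis vector which will be [x ^+ n * h]. *)
Definition pbw (n : nat) (h : G) : datum_alg :=
  [ffun p => ((val p.1 == n) && (p.2 == h))%:R].

Lemma datum_alg_sum (a : datum_alg) : a = \sum_p a p *: pbw p.1 p.2.
Proof.
apply/ffunP => q; rewrite sum_ffunE (bigD1 q) //= big1 => [|p pq].
  by rewrite !ffunE !eqxx addr0 [_ *: _]mulr1.
rewrite !ffunE; case: andP => [[/eqP e1 /eqP e2]|]; last by rewrite scaler0.
case/eqP: pq; case: p q e1 e2 => [p1 p2] [q1 q2] /= e1 ->; congr (_, _).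
exact/esym/val_inj.
Qed.

Lemma pbw_linP (W : lmodType K) (F F' : datum_alg -> W) :
  linear F -> linear F' ->
  (forall n h, (n < d)%N -> F (pbw n h) = F' (pbw n h)) -> F =1 F'.
Proof.
move=> lF lF' e a; rewrite (datum_alg_sum a) (lin_sum lF) (lin_sum lF').
apply: eq_bigr => p _; rewrite (linZ lF) (linZ lF') e //.
by rewrite -[X in (_ < X)%N]predn_d.
Qed.

Section LinearExtension.
Variables (W : lmodType K) (T : nat -> G -> W).

Definition pbw_ext (a : datum_alg) : W := \sum_p a p *: T p.1 p.2.

Lemma pbw_ext_linear : linear pbw_ext.
Proof.
move=> k a b; rewrite /pbw_ext scaler_sumr -big_split /=.
by apply: eq_bigr => p _; rewrite !ffunE scalerDl scalerA.
Qed.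

Lemma pbw_ext_pbw n h : (n < d)%N -> pbw_ext (pbw n h) = T n h.
Proof.
rewrite -{1}predn_d => nd; rewrite /pbw_ext (bigD1 (Ordinal nd, h)) //=.
rewrite big1 => [|p pn]; first by rewrite ffunE !eqxx scale1r addr0.
rewrite ffunE; case: andP => [[/eqP e1 /eqP e2]|]; last by rewrite scale0r.
case/eqP: pn; case: p e1 e2 => [p1 p2] /= e1 ->; congr (_, _).
exact: val_inj.
Qed.

End LinearExtension.

Lemma iter_linear (W : lmodType K) (y : W -> W) n : linear y -> linear (iter n y).
Proof. by move=> ly; elim: n => //= n IH a u v; rewrite /= IH ly. Qed.

Definition datum_eval (W : lmodType K) (y : W -> W) (j : G -> W -> W) (w : W) :=
  pbw_ext (fun n h => iter n y (j h w)).

(** Left multiplication by [x] moves along the basis, except at its end, where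
    the relation for [x ^+ d] applies. *)
Definition datum_x : datum_alg -> datum_alg :=
  pbw_ext (fun n h => if (n.+1 < d)%N then pbw n.+1 h
                      else mu *: (pbw 0 h - pbw 0 (g ^+ d * h)%g)).

(** Left multiplication by [k], with the scalar that arises when [k] passes
    [x ^+ n]. *)
Definition datum_h (k : G) : datum_alg -> datum_alg :=
  pbw_ext (fun n h => (chi k)^-1 ^+ n *: pbw n (k * h)%g).

Lemma datum_x_linear : linear datum_x. Proof. exact: pbw_ext_linear. Qed.

Lemma datum_h_linear k : linear (datum_h k). Proof. exact: pbw_ext_linear. Qed.

Lemma datum_hE k n h : (n < d)%N ->
  datum_h k (pbw n h) = (chi k)^-1 ^+ n *: pbw n (k * h)%g.
Proof. exact: pbw_ext_pbw. Qed.

Lemma datum_xE n h : (n.+1 < d)%N -> datum_x (pbw n h) = pbw n.+1 h.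
Proof. by move=> nd; rewrite /datum_x pbw_ext_pbw ?nd // ltnW. Qed.

Lemma datum_x_last h :
  datum_x (pbw d.-1 h) = mu *: (pbw 0 h - pbw 0 (g ^+ d * h)%g).
Proof.
by rewrite /datum_x pbw_ext_pbw ?predn_d ?ltnn // ltn_predL gd_d_gt0.
Qed.

Lemma iter_datum_x n h : (n < d)%N -> iter n datum_x (pbw 0 h) = pbw n h.
Proof. by elim: n => //= n IH nd; rewrite IH ?datum_xE // ltnW. Qed.

Lemma comp_linear_minus (W : lmodType K) (y : W -> W) (lj : linear y) :
  linear (fun w => mu *: (w - y w)).
Proof.
move=> a u v; rewrite lj opprD addrACA -scalerBr scalerDr !scalerA.
by rewrite mulrC.
Qed.

(** The relation for [x ^+ d] holds everywhere because [d] steps from [pbw n h]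
    pass the end of the basis exactly once; the scalars acquired on the way
    disappear by [gd_mu_chi] and [gd_chi_gd]. *)
Lemma datum_action_alg : datum_action datum_x datum_h.
Proof.
have lx := datum_x_linear; have lh := datum_h_linear.
have lh2 k k' : linear (fun w => datum_h k (datum_h k' w)).
  exact: (comp_linear (lh k) (lh k')).
split; first by [].
- apply: pbw_linP => // n h nd.
  by rewrite datum_hE // gd_chi1 invr1 expr1n scale1r mul1g.
- move=> k k'; apply: pbw_linP => // n h nd.
  rewrite !datum_hE // (linZ (lh k)) datum_hE // scalerA gd_chiM mulgA.
  by rewrite invfM exprMn mulrC.
- move=> k; apply: pbw_linP => [||n h nd].
  + exact: (comp_linear lx (lh k)).
  + move=> a u v; rewrite lx lh scalerDr !scalerA mulrC //.
  rewrite datum_hE // (linZ lx).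
  have [nd1|dn] := ltnP n.+1 d.
    rewrite !datum_xE // datum_hE // scalerA exprS mulrA mulfV ?mul1r //.
    exact: gd_chi_neq0.
  have -> : n = d.-1 by lia.
  rewrite !datum_x_last (linZ (lh k)) (linB (lh k)).
  rewrite !datum_hE ?gd_d_gt0 // !expr0 !scale1r.
  rewrite !scalerA mulgA -(commuteX _ (commute_sym (gd_gC k))) -mulgA.
  congr (_ *: _); rewrite -{1}(gd_mu_chi k).
  have -> : chi k ^+ d = chi k * chi k ^+ d.-1 by rewrite -exprS predn_d.
  have ne : chi k ^+ d.-1 != 0 by rewrite expf_neq0 ?gd_chi_neq0.
  by rewrite exprVn; field.
apply: pbw_linP => [||n h nd].
- exact: iter_linear.
- exact/comp_linear_minus/lh.
rewrite datum_hE // gd_chi_gd invr1 expr1n scale1r.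
have nd' : (n <= d.-1)%N by rewrite -ltnS predn_d.
have -> : iter d datum_x (pbw n h) =
    iter n datum_x (datum_x (iter (d.-1 - n) datum_x (pbw n h))).
  by rewrite -iterS -iterD addnS subnKC // predn_d.
have -> : iter (d.-1 - n) datum_x (pbw n h) = pbw d.-1 h.
  rewrite -(iter_datum_x h nd) -iterD subnK ?iter_datum_x //.
  by rewrite ltn_predL gd_d_gt0.
have li := iter_linear n lx.
by rewrite datum_x_last (linZ li) (linB li) !iter_datum_x.
Qed.

(** Evaluation turns the generators of the algebra into the given operators;
    both the associativity of the algebra and its universal property are
    instances. *)
Section Eval.
Variables (W : lmodType K) (y : W -> W) (j : G -> W -> W).
Hypothesis yj : datum_action y j.

Let ly : linear y. Proof. by case: yj => [[]]. Qed.
Let lj h : linear (j h). Proof. by case: yj => [[]]. Qed.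

Lemma datum_eval_linear w : linear (datum_eval y j w).
Proof. exact: pbw_ext_linear. Qed.

Lemma datum_eval_linear_at a : linear (fun w => datum_eval y j w a).
Proof.
move=> k u v; rewrite /datum_eval /pbw_ext scaler_sumr -big_split /=.
apply: eq_bigr => p _; rewrite lj (iter_linear _ ly) scalerDr !scalerA.
by rewrite [k * _]mulrC.
Qed.

Lemma datum_eval_pbw w n h : (n < d)%N ->
  datum_eval y j w (pbw n h) = iter n y (j h w).
Proof. exact: pbw_ext_pbw. Qed.

Lemma iter_y_j n h w : iter n y (j h w) = chi h ^+ n *: j h (iter n y w).
Proof.
case: yj => _ _ _ yjc _; elim: n => [|n IH]; first by rewrite expr0 scale1r.
by rewrite /= IH (linZ ly) yjc scalerA exprSr.
Qed.

Lemma datum_eval_x w a : datum_eval y j w (datum_x a) = y (datum_eval y j w a).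
Proof.
have le := datum_eval_linear w; move: a; apply: pbw_linP => [||n h nd].
- exact: (comp_linear le datum_x_linear).
- exact: (comp_linear ly le).
rewrite [in RHS]datum_eval_pbw //.
have [nd1|dn] := ltnP n.+1 d; first by rewrite datum_xE // datum_eval_pbw.
have -> : n = d.-1 by lia.
rewrite datum_x_last (linZ le) (linB le).
rewrite !datum_eval_pbw ?gd_d_gt0 //= -iterS predn_d.
by case: yj => _ _ jM _ ->; rewrite jM.
Qed.

Lemma datum_eval_h w k a : datum_eval y j w (datum_h k a) = j k (datum_eval y j w a).
Proof.
have le := datum_eval_linear w; move: a; apply: pbw_linP => [||n h nd].
- exact: (comp_linear le (datum_h_linear k)).
- exact: (comp_linear (lj k) le).
rewrite datum_hE // (linZ le) !datum_eval_pbw //.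
have [_ _ jM _ _] := yj.
rewrite !iter_y_j (linZ (lj k)) jM scalerA; congr (_ *: _).
by rewrite gd_chiM exprMn mulrA -exprMn mulVf ?gd_chi_neq0 // expr1n mul1r.
Qed.

Lemma datum_eval_eval w a b :
  datum_eval y j (datum_eval y j w b) a =
  datum_eval y j w (datum_eval datum_x datum_h b a).
Proof.
have le := datum_eval_linear; move: a; apply: pbw_linP => [||n h nd].
- exact: le.
- exact: (comp_linear (le w) (@pbw_ext_linear _ _)).
rewrite datum_eval_pbw // /datum_eval [in RHS]pbw_ext_pbw //.
rewrite -!/(datum_eval _ _ _); elim: n {nd} => [|n IH] /=.
  by rewrite datum_eval_h.
by rewrite IH datum_eval_x.
Qed.

End Eval.

Definition datum_mul (a b : datum_alg) : datum_alg := datum_eval datum_x datum_h b a.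

Definition datum_one : datum_alg := pbw 0 1%g.

Lemma datum_mulA : associative datum_mul.
Proof. by move=> a b c; rewrite /datum_mul (datum_eval_eval datum_action_alg). Qed.

Lemma datum_mul1l : left_id datum_one datum_mul.
Proof.
move=> a; rewrite /datum_mul datum_eval_pbw ?gd_d_gt0 //=.
by case: datum_action_alg.
Qed.

Lemma datum_mul1r : right_id datum_one datum_mul.
Proof.
apply: pbw_linP => [||n h nd]; [exact: datum_eval_linear|by []|].
rewrite /datum_mul datum_eval_pbw // datum_hE ?gd_d_gt0 // expr0 scale1r mulg1.
exact: iter_datum_x.
Qed.

Lemma datum_mulDl : left_distributive datum_mul +%R.
Proof. by move=> a b c; rewrite /datum_mul (linD (datum_eval_linear _ _ _)). Qed.

Lemma datum_mulDr : right_distributive datum_mul +%R.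
Proof.
by move=> a b c; rewrite /datum_mul (linD (datum_eval_linear_at datum_action_alg _)).
Qed.

Lemma datum_one_neq0 : datum_one != 0.
Proof.
apply/eqP => /ffunP /(_ (ord0, 1%g)); rewrite !ffunE !eqxx => /eqP.
by rewrite oner_eq0.
Qed.

HB.instance Definition _ := GRing.Zmodule_isNzRing.Build datum_alg
  datum_mulA datum_mul1l datum_mul1r datum_mulDl datum_mulDr datum_one_neq0.

Lemma datum_mulZl (k : K) (a b : datum_alg) : k *: (a * b) = (k *: a) * b.
Proof. exact/esym/(linZ (datum_eval_linear _ _ b)). Qed.

HB.instance Definition _ := GRing.Lmodule_isLalgebra.Build K datum_alg datum_mulZl.

Lemma datum_mulZr (k : K) (a b : datum_alg) : k *: (a * b) = a * (k *: b).
Proof. exact/esym/(linZ (datum_eval_linear_at datum_action_alg a)). Qed.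

HB.instance Definition _ := GRing.Lalgebra_isAlgebra.Build K datum_alg datum_mulZr.

Definition datum_genx : datum_alg := datum_x 1.
Definition datum_genh (h : G) : datum_alg := pbw 0 h.

Lemma genh_mul h a : datum_genh h * a = datum_h h a.
Proof. by rewrite [LHS]/(datum_mul _ _) /datum_mul datum_eval_pbw ?gd_d_gt0. Qed.

Lemma genx_mul a : datum_genx * a = datum_x a.
Proof.
rewrite [LHS]/(datum_mul _ _) /datum_mul (datum_eval_x datum_action_alg).
by congr datum_x; apply: (datum_mul1l a).
Qed.

Lemma genx_exp n a : datum_genx ^+ n * a = iter n datum_x a.
Proof. by elim: n => [|n IH]; rewrite ?expr0 ?mul1r // exprS -mulrA IH genx_mul. Qed.

Lemma pbwE n h : (n < d)%N -> pbw n h = datum_genx ^+ n * datum_genh h.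
Proof. by move=> nd; rewrite genx_exp iter_datum_x. Qed.

(** Left multiplication turns the elements of an algebra into operators, to which
    [datum_eval] applies. *)
Lemma relations_action (B : algType K) (y : B) (j : G -> B) :
  datum_relations y j <-> datum_action (fun w => y * w) (fun h w => j h * w).
Proof.
split=> [[j1 jM yd yj]|[_ j1 jM yj yd]].
  split.
  - by split=> [|h] a u v; rewrite mulrDr scalerAr.
  - by move=> w; rewrite j1 mul1r.
  - by move=> h h' w; rewrite jM mulrA.
  - by move=> h w; rewrite !mulrA yj -scalerAl.
  move=> w; have -> : iter d (fun w => y * w) w = y ^+ d * w.
    by elim: d {yd} => [|n IH]; rewrite ?mul1r // exprS -mulrA -IH.
  by rewrite yd (morph_mulgX j1 jM) -scalerAl mulrBl mul1r.
have j1' : j 1%g = 1 by have := j1 1; rewrite mulr1.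
have jM' : {morph j : h h' / (h * h')%g >-> h * h'}.
  by move=> h h'; have := jM h h' 1; rewrite !mulr1.
split=> //; last by move=> h; have := yj h 1; rewrite !mulr1.
have := yd 1; rewrite mulr1 -(morph_mulgX j1' jM') => <-.
by elim: d {yd} => // n IH; rewrite exprS IH.
Qed.

Lemma datum_alg_relations : datum_relations datum_genx datum_genh.
Proof.
apply/relations_action; have := datum_action_alg.
have -> : (fun w => datum_genx * w) = datum_x by apply: funext => w; apply: genx_mul.
by have -> : (fun h w => datum_genh h * w) = datum_h
  by apply: funext => h; apply: funext => w; apply: genh_mul.
Qed.

Section Universal.
Variables (B : algType K) (y : B) (j : G -> B).
Hypothesis rel : datum_relations y j.

(** The image of the basis vector [x ^+ n * h] is [y ^+ n * j h]. *)
Definition datum_lift : datum_alg -> B :=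
  datum_eval (fun w => y * w) (fun h w => j h * w) 1.

Let act := (relations_action y j).1 rel.

Lemma datum_lift_linear : linear datum_lift.
Proof. exact: pbw_ext_linear. Qed.

Lemma datum_lift_h h : datum_lift (datum_genh h) = j h.
Proof. by rewrite /datum_lift datum_eval_pbw ?gd_d_gt0 //= mulr1. Qed.

Lemma datum_lift1 : datum_lift 1 = 1.
Proof. by rewrite datum_lift_h; case: rel. Qed.

Lemma datum_liftM : {morph datum_lift : a b / a * b}.
Proof.
move=> a b; rewrite /datum_lift -[a * b]/(datum_mul a b) /datum_mul.
rewrite -(datum_eval_eval act) -/datum_lift.
rewrite /datum_eval /pbw_ext [in RHS]mulr_suml; apply: eq_bigr => p _.
rewrite -scalerAl; congr (_ *: _); rewrite mulr1.
by elim: (val p.1) => //= n IH; rewrite IH mulrA.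
Qed.

Lemma datum_lift_x : datum_lift datum_genx = y.
Proof. by rewrite /datum_lift (datum_eval_x act) -/datum_lift datum_lift1 mulr1. Qed.

End Universal.
End DatumAlgebra.

(** * Multiplicative maps on tensor products *)

Section TensorMultiplicative.
Variable K : fieldType.

Lemma tensZZ (U V : lmodType K) (k k' : K) (u : U) (v : V) :
  (k *: u) \ox (k' *: v) = (k * k') *: (u \ox v).
Proof. by rewrite (linZ (tens_linl _)) (linZ (tens_linr _)) scalerA. Qed.

Lemma tmap_tmulg (A A' B B' : algType K) (f : A -> A') (g : B -> B') :
  linear f -> linear g -> {morph f : a b / a * b} -> {morph g : a b / a * b} ->
  {morph tmap f g : s t / tmulg s t}.
Proof.
move=> lf lg fM gM s t; have lm := tmap_linear lf lg.
move: s; apply: tensor_linP => [||a b].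
- exact: (comp_linear lm (@tmulg_linl _ _ _ t)).
- exact: (comp_linear (@tmulg_linl _ _ _ _) lm).
move: t; apply: tensor_linP => [||a' b'].
- exact: (comp_linear lm (@tmulg_linr _ _ _ _)).
- exact: (comp_linear (@tmulg_linr _ _ _ _) lm).
by rewrite !(tmulgE, tmap_tens) // fM gM.
Qed.

Lemma tlift_tmulg (A B C : algType K) (f : A -> B -> C) :
  bilinear_for *:%R *:%R f ->
  (forall a b a' b', f (a * a') (b * b') = f a b * f a' b') ->
  forall s t, tlift f (tmulg s t) = tlift f s * tlift f t.
Proof.
move=> bf fM s t; have lm := tlift_linear bf.
have ll (u : C) : linear (fun v : C => v * u).
  by move=> k x y; rewrite mulrDl scalerAl.
have lr (u : C) : linear (fun v : C => u * v).
  by move=> k x y; rewrite mulrDr scalerAr.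
move: s; apply: tensor_linP => [||a b].
- exact: (comp_linear lm (@tmulg_linl _ _ _ t)).
- exact: (comp_linear (ll _) lm).
move: t; apply: tensor_linP => [||a' b'].
- exact: (comp_linear lm (@tmulg_linr _ _ _ _)).
- exact: (comp_linear (lr _) lm).
by rewrite tmulgE !(tlift_tensE bf).2.
Qed.

Lemma tassoc_tmulg (A B C : augmented K) (s t : tensor (tensor_alg A B) C) :
  tassoc (tmulg s t) =
  @tmulg _ A (tensor_alg B C) (tassoc s) (tassoc t) :> tensor A (tensor B C).
Proof.
have lm : linear (@tassoc _ A B C :
    tensor (tensor_alg A B) C -> tensor A (tensor_alg B C)).
  exact: tassoc_linear.
have lt c : linear ((fun s : tensor A B => tassoc (s \ox c)) :
    tensor A B -> tensor A (tensor_alg B C)).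
  by move=> k x y; rewrite linearPl; apply: lm.
move: s; apply: tensor_linP => [||s c].
- exact: (comp_linear lm (@tmulg_linl _ _ _ t)).
- exact: (comp_linear (@tmulg_linl _ _ _ _) lm).
move: t; apply: tensor_linP => [||t c'].
- exact: (comp_linear lm (@tmulg_linr _ _ _ _)).
- exact: (comp_linear (@tmulg_linr _ _ _ _) lm).
rewrite tmulgE; move: s; apply: tensor_linP => [||a b].
- apply: (comp_linear lm) => k x y.
  by rewrite mulrDl -scalerAl linearPl.
- exact: (comp_linear (@tmulg_linl _ _ _ _) (lt c)).
move: t; apply: tensor_linP => [||a' b'].
- apply: (comp_linear lm) => k x y.
  by rewrite mulrDr -scalerAr linearPl.
- exact: (comp_linear (@tmulg_linr _ _ _ _) (lt c')).
by rewrite tensor_algM !tassocE tmulgE tensor_algM.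
Qed.

Lemma scale_bilinear (A B : lmodType K) (e : A -> K) :
  linear (e : A -> K^o) -> bilinear_for *:%R *:%R (fun (a : A) (b : B) => e a *: b).
Proof.
move=> le; split=> [b|a] k x y /=; first by rewrite le scalerDl scalerA.
by rewrite scalerDr !scalerA mulrC.
Qed.

Lemma scale_bilinear_r (A B : lmodType K) (e : B -> K) :
  linear (e : B -> K^o) -> bilinear_for *:%R *:%R (fun (a : A) (b : B) => e b *: a).
Proof.
move=> le; split=> [b|a] k x y /=; last by rewrite le scalerDl scalerA.
by rewrite scalerDr !scalerA mulrC.
Qed.

Lemma mul_bilinear (A B C : algType K) (f : A -> C) (g : B -> C) :
  linear f -> linear g -> bilinear_for *:%R *:%R (fun a b => f a * g b).
Proof.
move=> lf lg; split=> [b|a] k x y /=.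
  by rewrite lf mulrDl scalerAl.
by rewrite lg mulrDr scalerAr.
Qed.

Section Antimultiplicative.
Variables (A : algType K) (S : A -> A).
Hypotheses (lS : linear S) (SM : forall a b, S (a * b) = S b * S a).

Let m2 (c : A) : linear (fun v : A => c * v).
Proof. by move=> k x y; rewrite mulrDr scalerAr. Qed.
Let m1 (c : A) : linear (fun v : A => v * c).
Proof. by move=> k x y; rewrite mulrDl scalerAl. Qed.

(** Evaluating the convolution on [s] first makes the antipode axiom pass from
    two elements to their product. *)
Lemma tlift_antimulL s t :
  tlift (fun a b => S a * b) (tmulg s t) =
  tlift (fun a' b' => S a' * tlift (fun a b => S a * b) s * b') t.
Proof.
have bl := mul_bilinear lS (@id_linear _ A); have ll := tlift_linear bl.
have bl2 (c : A) : bilinear_for *:%R *:%R (fun a' b' => S a' * c * b').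
  apply: (@mul_bilinear _ _ _ (fun a' => S a' * c) id) => //.
  exact: (comp_linear (m1 c) lS).
move: t; apply: tensor_linP => [||a' b'].
- exact: (comp_linear ll (@tmulg_linr _ _ _ _)).
- exact: tlift_linear.
rewrite (tlift_tensE (bl2 _)).2; move: s; apply: tensor_linP => [||a b].
- exact: (comp_linear ll (@tmulg_linl _ _ _ _)).
- exact: (comp_linear (m1 _) (comp_linear (m2 _) ll)).
by rewrite tmulgE !(tlift_tensE bl).2 SM !mulrA.
Qed.

Lemma tlift_antimulR s t :
  tlift (fun a b => a * S b) (tmulg s t) =
  tlift (fun a b => a * tlift (fun a' b' => a' * S b') t * S b) s.
Proof.
have bl := mul_bilinear (@id_linear _ A) lS; have ll := tlift_linear bl.
have bl2 (c : A) : bilinear_for *:%R *:%R (fun a' b' => a' * c * S b').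
  by apply: (@mul_bilinear _ _ _ (fun a' => a' * c) S).
move: s; apply: tensor_linP => [||a b].
- exact: (comp_linear ll (@tmulg_linl _ _ _ _)).
- exact: tlift_linear.
rewrite (tlift_tensE (bl2 _)).2; move: t; apply: tensor_linP => [||a' b'].
- exact: (comp_linear ll (@tmulg_linr _ _ _ _)).
- exact: (comp_linear (m1 _) (comp_linear (m2 _) ll)).
by rewrite tmulgE !(tlift_tensE bl).2 SM !mulrA.
Qed.

End Antimultiplicative.
End TensorMultiplicative.

Section ConverseAlgebra.
Variables (K : fieldType) (A : algType K).

(** An antipode is an algebra morphism into the opposite algebra, so that the
    universal property provides it. *)
Definition converse_alg := A^c.

HB.instance Definition _ := GRing.NzRing.on converse_alg.
HB.instance Definition _ := GRing.Zmodule_isLmodule.Build K converse_alg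
  (@scalerA K A) (@scale1r K A) (@scalerDr K A) (@scalerDl K A).

Lemma converse_scaleAl (k : K) (a b : converse_alg) : k *: (a * b) = (k *: a) * b.
Proof. exact: (@scalerAr K A). Qed.
HB.instance Definition _ := GRing.Lmodule_isLalgebra.Build K converse_alg converse_scaleAl.

Lemma converse_scaleAr (k : K) (a b : converse_alg) : k *: (a * b) = a * (k *: b).
Proof. exact: (@scalerAl K A). Qed.
HB.instance Definition _ := GRing.Lalgebra_isAlgebra.Build K converse_alg converse_scaleAr.

Lemma converse_mulE (a b : converse_alg) : a * b = (b : A) * (a : A).
Proof. by []. Qed.

Lemma converse_expr (a : A) n : (a : converse_alg) ^+ n = a ^+ n.
Proof. by elim: n => // n IH; rewrite exprSr IH -[LHS]/(a * a ^+ n : A) -exprS. Qed.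

End ConverseAlgebra.

(** * The Hopf algebra of a group datum *)

Section Generators.
Variables (K : fieldType) (alpha : group_datum K).
Local Notation G := (gd_group alpha).
Local Notation g := (gd_g alpha).
Local Notation chi := (@gd_chi K alpha).
Local Notation mu := (gd_mu alpha).
Local Notation d := (gd_d alpha).

Lemma datum_lift_pbw (B : algType K) (y : B) (j : G -> B) n h : (n < d)%N ->
  datum_lift y j (pbw n h) = y ^+ n * j h.
Proof.
move=> nd; rewrite /datum_lift datum_eval_pbw // mulr1.
by elim: n {nd} => [|n IH]; rewrite ?mul1r //= IH exprS mulrA.
Qed.

Lemma datum_lift_id (a : datum_alg alpha) : datum_lift (datum_genx alpha) (@datum_genh _ alpha) a = a.
Proof.
move: a; apply: pbw_linP => [||n h nd]; [exact: datum_lift_linear|by []|].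
by rewrite datum_lift_pbw // pbwE.
Qed.

(** The axioms of a Hopf algebra are equalities of linear maps which are stable
    under products; hence they only need to be checked on generators. *)
Lemma gen_linP (B : algType K) (y : B) (j : G -> B) (W : lmodType K) (F F' : B -> W) :
  (forall c, exists a : datum_alg alpha, c = datum_lift y j a) ->
  linear F -> linear F' -> (forall h, F (j h) = F' (j h)) -> F y = F' y ->
  (forall a b, F a = F' a -> F b = F' b -> F (a * b) = F' (a * b)) -> F =1 F'.
Proof.
move=> surj lF lF' Fj Fy FM c; have [a ->] := surj c.
have ll := datum_lift_linear y j; move: a; apply: pbw_linP => [||n h nd].
- exact: (comp_linear lF ll).
- exact: (comp_linear lF' ll).
rewrite datum_lift_pbw //; elim: n {nd} => [|n IH]; first by rewrite mul1r.
by rewrite exprS -mulrA FM.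
Qed.

End Generators.

Section DatumHopf.
Variables (K : fieldType) (alpha : group_datum K).
Local Notation G := (gd_group alpha).
Local Notation g := (gd_g alpha).
Local Notation chi := (@gd_chi K alpha).
Local Notation mu := (gd_mu alpha).
Local Notation d := (gd_d alpha).
Local Notation A := (datum_alg alpha).
Local Notation x := (datum_genx alpha).
Local Notation gh := (@datum_genh _ alpha).

Let rel : datum_relations x gh := @datum_alg_relations _ alpha.
Let gh1 : gh 1%g = 1. Proof. by []. Qed.
Let ghM : {morph gh : h h' / (h * h')%g >-> h * h'}. Proof. by case: rel. Qed.
Let xd : x ^+ d = mu *: (1 - gh (g ^+ d)%g).
Proof. by case: rel => _ _ -> _; rewrite (morph_mulgX gh1 ghM). Qed.
Let xh h : x * gh h = chi h *: (gh h * x). Proof. by case: rel. Qed.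
Let surj (c : A) : exists a : A, c = datum_lift x gh a.
Proof. by exists c; rewrite datum_lift_id. Qed.

Definition datum_counit : A -> K^o := @datum_lift _ alpha K^o 0 (fun _ => 1).

Lemma datum_counit_rel : @datum_relations _ alpha K^o 0 (fun _ => 1).
Proof.
split=> [||| h]; rewrite ?mul0r ?mulr0 ?scaler0 //; first by move=> *; rewrite mul1r.
by rewrite expr1n subrr scaler0 expr0n gtn_eqF ?gd_d_gt0.
Qed.

Lemma datum_counit_linear : linear datum_counit. Proof. exact: datum_lift_linear. Qed.
Lemma datum_counit1 : datum_counit 1 = 1. Proof. exact: datum_lift1 datum_counit_rel. Qed.
Lemma datum_counitM a b : datum_counit (a * b) = datum_counit a * datum_counit b.
Proof. exact: datum_liftM datum_counit_rel a b. Qed.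
Lemma datum_counit_x : datum_counit x = 0. Proof. exact: datum_lift_x datum_counit_rel. Qed.
Lemma datum_counit_h h : datum_counit (gh h) = 1. Proof. exact: datum_lift_h. Qed.

Definition datum_aug : augmented K := Augmented datum_counit_linear datum_counit1.
Local Notation AA := (tensor_alg datum_aug datum_aug).

Definition datum_comul_x : AA := x \ox 1 + gh g \ox x.
Definition datum_comul_h (h : G) : AA := gh h \ox gh h.
Definition datum_comul : A -> tensor A A := @datum_lift _ alpha AA datum_comul_x datum_comul_h.

(** The summands of [datum_comul_x] span a quantum plane at a primitive [d]-th root of
    unity, where [d]-th powers are additive. *)
Lemma datum_comul_rel : @datum_relations _ alpha AA datum_comul_x datum_comul_h.
Proof.
split.
- by [].
- by move=> h h'; rewrite /datum_comul_h ghM tensor_algM.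
- rewrite /datum_comul_x (exprD_prim (gd_chiV_prim alpha)); last first.
    rewrite !tensor_algM mulr1 mul1r xh linearZl_LR scalerA mulVf ?scale1r //.
    exact: gd_chi_neq0.
  rewrite /datum_comul_h !tensor_algX xd expr1n -(morph_mulgX gh1 ghM).
  rewrite linearZl_LR linearZr_LR linearBl linearBr -scalerDr.
  by congr (_ *: _); rewrite addrA subrK.
move=> h; rewrite /datum_comul_x /datum_comul_h mulrDl mulrDr !tensor_algM scalerDr.
rewrite mul1r mulr1 !xh -!ghM (gd_gC h) linearZl_LR linearZr_LR //.
Qed.

Lemma datum_comul_linear : linear datum_comul.
Proof. exact: (@datum_lift_linear _ alpha AA). Qed.
Lemma datum_comul1 : datum_comul 1 = 1 \ox 1.
Proof. exact: datum_lift1 datum_comul_rel. Qed.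
Lemma datum_comulM a b : datum_comul (a * b) = tmulg (datum_comul a) (datum_comul b).
Proof. exact (datum_liftM datum_comul_rel a b). Qed.
Lemma datum_comul_xE : datum_comul x = x \ox 1 + gh g \ox x.
Proof. exact: (datum_lift_x datum_comul_rel). Qed.
Lemma datum_comul_hE h : datum_comul (gh h) = gh h \ox gh h.
Proof. exact: (@datum_lift_h _ alpha AA). Qed.

Definition datum_antipode_x : converse_alg A := - (gh g^-1%g * x).
Definition datum_antipode_h (h : G) : converse_alg A := gh h^-1%g.
Definition datum_antipode : A -> A :=
  @datum_lift _ alpha (converse_alg A) datum_antipode_x datum_antipode_h.

(** Both sides are the product of the [- t], where [t] ranges over the [n]-th
    roots of unity. *)
Lemma prim_root_prod (z : K) n : n.-primitive_root z ->
  (-1) ^+ n * z ^+ 'C(n, 2) = -1.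
Proof.
move=> zP; have := congr1 (fun p => p.[0]) (factor_Xn_sub_1 zP).
rewrite !hornerE horner_prod expr0n gtn_eqF ?(prim_order_gt0 zP) // sub0r => e; rewrite -[RHS]e {e}.
under eq_bigr => i _ do rewrite hornerXsubC sub0r -mulN1r.
rewrite big_split /= prodr_const_nat subn0 -bin2_sum; congr (_ * _).
elim: n {zP} => [|n IH]; first by rewrite !big_geq.
by rewrite !big_nat_recr //= exprD IH.
Qed.

Lemma genx_exp_genh n h : x ^+ n * gh h = chi h ^+ n *: (gh h * x ^+ n).
Proof. exact/expr_qcommr/xh. Qed.

Lemma genVx_exp n : (gh g^-1%g * x) ^+ n =
  (chi g)^-1 ^+ 'C(n, 2) *: (gh (g^-1 ^+ n)%g * x ^+ n).
Proof.
elim: n => [|n IH]; first by rewrite !expr0 mulr1 expg0 gh1 scale1r.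
rewrite exprSr IH -scalerAl -mulrA [x ^+ n * _]mulrA genx_exp_genh gd_chiV.
rewrite -scalerAl -scalerAr scalerA -exprD -mulrA -exprSr mulrA -ghM -expgSr.
by rewrite binS bin1 addnC.
Qed.

(** The scalar in the [d]-th power of [- (g^-1 * x)] is [-1] by [prim_root_prod],
    which turns [1 - g ^+ d] into [1 - g ^- d]. *)
Lemma datum_antipode_rel : @datum_relations _ alpha (converse_alg A) datum_antipode_x datum_antipode_h.
Proof.
split.
- by rewrite /datum_antipode_h invg1.
- by move=> h h'; rewrite /datum_antipode_h invMg ghM.
- have e : datum_antipode_h g ^+ d = gh (g^-1 ^+ d)%g.
    by rewrite converse_expr (morph_mulgX gh1 ghM).
  rewrite e converse_expr /datum_antipode_x -scaleN1r exprZn genVx_exp scalerA.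
  rewrite (prim_root_prod (gd_chiV_prim alpha)) xd scaleN1r -scalerAr mulrBr mulr1.
  by rewrite -ghM expgVn mulVg gh1 -scalerN opprB.
move=> h; rewrite /datum_antipode_x /datum_antipode_h.
change (gh h^-1%g * - (gh g^-1%g * x) = chi h *: (- (gh g^-1%g * x) * gh h^-1%g)).
rewrite mulrN mulNr scalerN; congr (- _).
rewrite -mulrA xh gd_chiV -scalerAr scalerA mulfV ?gd_chi_neq0 // scale1r.
by rewrite !mulrA -!ghM; congr (gh _ * _); apply/commuteV/commute_sym/commuteV/gd_gC.
Qed.

Lemma datum_antipode_linear : linear datum_antipode.
Proof. exact: (@datum_lift_linear _ alpha (converse_alg A)). Qed.
Lemma datum_antipode1 : datum_antipode 1 = 1.
Proof. exact: datum_lift1 datum_antipode_rel. Qed.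
Lemma datum_antipodeM a b : datum_antipode (a * b) = datum_antipode b * datum_antipode a.
Proof. exact (etrans (datum_liftM datum_antipode_rel a b) (converse_mulE _ _)). Qed.
Lemma datum_antipode_xE : datum_antipode x = - (gh g^-1%g * x).
Proof. exact (datum_lift_x datum_antipode_rel). Qed.
Lemma datum_antipode_hE h : datum_antipode (gh h) = gh h^-1%g.
Proof. exact: (@datum_lift_h _ alpha (converse_alg A)). Qed.

Lemma datum_comulA c : tassoc (tmap datum_comul id (datum_comul c)) = tmap id datum_comul (datum_comul c).
Proof.
have lD := datum_comul_linear.
have li : linear (@id A) by [].
have l1 := tmap_linear lD li; have l2 := tmap_linear li lD.
have la := @tassoc_linear K A A A.
move: c; apply: (gen_linP surj).
- exact: (comp_linear la (comp_linear l1 lD)).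
- exact: (comp_linear l2 lD).
- by move=> h; rewrite datum_comul_hE !tmap_tens // datum_comul_hE tassocE.
- rewrite datum_comul_xE !(linD l1) !(linD l2) !tmap_tens // datum_comul_xE datum_comul_hE datum_comul1.
  rewrite linearDl linearDr !(linD la) !tassocE addrA //.
move=> a b ea eb; rewrite datum_comulM.
have -> : tmap datum_comul id (tmulg (datum_comul a) (datum_comul b)) =
    @tmulg K AA A (tmap datum_comul id (datum_comul a)) (tmap datum_comul id (datum_comul b)).
  by apply: (@tmap_tmulg K A AA A A datum_comul id lD li) => // u v; apply: datum_comulM.
have -> : tmap id datum_comul (tmulg (datum_comul a) (datum_comul b)) =
    @tmulg K A AA (tmap id datum_comul (datum_comul a)) (tmap id datum_comul (datum_comul b)).
  by apply: (@tmap_tmulg K A A A AA id datum_comul li lD) => // u v; apply: datum_comulM.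
have t := @tassoc_tmulg K datum_aug datum_aug datum_aug
  (tmap datum_comul id (datum_comul a)) (tmap datum_comul id (datum_comul b)).
exact (etrans t (f_equal2 (@tmulg K A AA) ea eb)).
Qed.

Lemma datum_counitl c : tlift (fun a b => datum_counit a *: b) (datum_comul c) = c.
Proof.
have bl := scale_bilinear A datum_counit_linear.
have ll := tlift_linear bl.
move: c; apply: (gen_linP surj) => //.
- exact: (comp_linear ll datum_comul_linear).
- by move=> h; rewrite datum_comul_hE (tlift_tensE bl).2 datum_counit_h scale1r.
- rewrite datum_comul_xE (linD ll) !(tlift_tensE bl).2 datum_counit_h datum_counit_x.
  by rewrite scale0r add0r scale1r.
move=> a b ea eb; rewrite datum_comulM tlift_tmulg // ?ea ?eb //.
by move=> *; rewrite datum_counitM -scalerAl -scalerAr scalerA.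
Qed.

Lemma datum_counitr c : tlift (fun a b => datum_counit b *: a) (datum_comul c) = c.
Proof.
have bl := scale_bilinear_r A datum_counit_linear.
have ll := tlift_linear bl.
move: c; apply: (gen_linP surj) => //.
- exact: (comp_linear ll datum_comul_linear).
- by move=> h; rewrite datum_comul_hE (tlift_tensE bl).2 datum_counit_h scale1r.
- rewrite datum_comul_xE (linD ll) !(tlift_tensE bl).2 datum_counit1 datum_counit_x.
  by rewrite scale0r addr0 scale1r.
move=> a b ea eb; rewrite datum_comulM tlift_tmulg // ?ea ?eb //.
by move=> *; rewrite datum_counitM -scalerAl -scalerAr scalerA.
Qed.

Let lunit : linear (fun c => datum_counit c *: (1 : A)).
Proof. by move=> k a b; rewrite datum_counit_linear scalerDl scalerA. Qed.

Lemma datum_antipodel c : tlift (fun a b => datum_antipode a * b) (datum_comul c) = datum_counit c *: (1 : A).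
Proof.
have bl := mul_bilinear datum_antipode_linear (@id_linear _ A).
have ll := tlift_linear bl.
move: c; apply: (gen_linP surj) => //.
- exact: (comp_linear ll datum_comul_linear).
- move=> h; rewrite datum_comul_hE (tlift_tensE bl).2 datum_counit_h scale1r datum_antipode_hE.
  by rewrite -ghM mulVg.
- rewrite datum_comul_xE (linD ll) !(tlift_tensE bl).2 datum_antipode_hE datum_antipode_xE.
  by rewrite mulr1 addNr datum_counit_x scale0r.
move=> a b ea eb; rewrite datum_comulM (tlift_antimulL datum_antipode_linear datum_antipodeM).
rewrite ea; transitivity (datum_counit a *: tlift (fun a b => datum_antipode a * b) (datum_comul b)).
  rewrite /tlift /bieval scaler_sumr; apply: eq_bigr => p _.
  by rewrite -scalerAr mulr1 -scalerAl.
by rewrite eb scalerA datum_counitM.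
Qed.

Lemma datum_antipoder c : tlift (fun a b => a * datum_antipode b) (datum_comul c) = datum_counit c *: (1 : A).
Proof.
have bl := mul_bilinear (@id_linear _ A) datum_antipode_linear.
have ll := tlift_linear bl.
move: c; apply: (gen_linP surj) => //.
- exact: (comp_linear ll datum_comul_linear).
- move=> h; rewrite datum_comul_hE (tlift_tensE bl).2 datum_counit_h scale1r datum_antipode_hE.
  by rewrite -ghM mulgV.
- rewrite datum_comul_xE (linD ll) !(tlift_tensE bl).2 datum_antipode1 datum_antipode_xE.
  by rewrite mulrN mulrA -ghM mulgV mul1r mulr1 addrN datum_counit_x scale0r.
move=> a b ea eb; rewrite datum_comulM (tlift_antimulR datum_antipode_linear datum_antipodeM).
rewrite eb; transitivity (datum_counit b *: tlift (fun a b => a * datum_antipode b) (datum_comul a)).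
  rewrite /tlift /bieval scaler_sumr; apply: eq_bigr => p _.
  by rewrite -scalerAr mulr1 -scalerAl.
by rewrite ea scalerA mulrC datum_counitM.
Qed.

HB.instance Definition _ :=
  GRing.isLinear.Build K A (tensor A A) *:%R datum_comul datum_comul_linear.
HB.instance Definition _ :=
  GRing.isLinear.Build K A K *%R (datum_counit : A -> K) datum_counit_linear.
HB.instance Definition _ :=
  GRing.isLinear.Build K A A *:%R datum_antipode datum_antipode_linear.

Definition datum_hopf : hopfAlgebra K :=
  @HopfAlgebra K A datum_comul (datum_counit : A -> K) datum_antipode
    datum_comulA datum_counitl datum_counitr datum_comul1 datum_comulM datum_counit1 datum_counitM datum_antipodel datum_antipoder.

Lemma lrmorphism_of (B B' : algType K) (f : B -> B') : linear f -> f 1 = 1 ->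
  {morph f : a b / a * b} -> exists F : {lrmorphism B -> B'}, F =1 f.
Proof.
move=> lf f1 fM.
pose m1 := GRing.isLinear.Build K B B' *:%R f lf.
pose m2 := GRing.isMonoidMorphism.Build B B' f (f1, fM).
pose F : {lrmorphism B -> B'} := HB.pack f m1 m2.
by exists F.
Qed.

Lemma datum_alg_universal (B : algType K) (y : B) (j : G -> B) :
  datum_relations y j ->
  exists2 f : {lrmorphism A -> B}, f x = y /\ (forall h, f (gh h) = j h)
  & forall f' : {lrmorphism A -> B}, f' x = y -> (forall h, f' (gh h) = j h) -> f' =1 f.
Proof.
move=> r; have [f fE] := lrmorphism_of (datum_lift_linear y j) (datum_lift1 r) (datum_liftM r).
exists f; first by rewrite fE (datum_lift_x r); split=> // h; rewrite fE datum_lift_h.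
move=> f' f'x f'h; apply: (gen_linP surj).
- exact: linearP.
- exact: linearP.
- by move=> h; rewrite f'h fE datum_lift_h.
- by rewrite f'x fE (datum_lift_x r).
- by move=> a b ea eb; rewrite !rmorphM; congr (_ * _).
Qed.

Lemma is_datum_hopf_alg : is_datum_hopf alpha datum_hopf.
Proof.
exists gh, x; split.
- exact: rel.
- exact: datum_alg_universal.
- split; [by rewrite addrC; apply: datum_comul_xE | exact: datum_counit_x | exact: datum_antipode_xE].
- by move=> h; split; [exact: datum_comul_hE|exact: datum_counit_h|exact: datum_antipode_hE].
Qed.

End DatumHopf.

(** * Presentations and morphisms of Hopf algebras *)

Section PBW.
Variables (K : fieldType) (alpha : group_datum K).
Local Notation G := (gd_group alpha).
Local Notation g := (gd_g alpha).
Local Notation d := (gd_d alpha).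

(** The form of the universal property which is easy to check: the monomials
    [x ^+ n * iota h] with [n < d] form a basis. *)
Definition datum_pbw (B : algType K) (x : B) (iota : G -> B) : Prop :=
  datum_relations x iota /\ bijective (datum_lift x iota).

Definition datum_universal (A : algType K) (x : A) (iota : G -> A) : Prop :=
  forall (B : algType K) (y : B) (j : G -> B), datum_relations y j ->
    exists2 f : {lrmorphism A -> B}, f x = y /\ (forall h, f (iota h) = j h)
    & forall f' : {lrmorphism A -> B},
        f' x = y -> (forall h, f' (iota h) = j h) -> f' =1 f.

Lemma pbw_surj (B : algType K) (x : B) (iota : G -> B) :
  datum_pbw x iota -> forall c, exists a, c = datum_lift x iota a.
Proof. by case=> _ [f _ fK] c; exists (f c); rewrite fK. Qed.

Lemma pbw_universal (A : algType K) (x : A) (iota : G -> A) :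
  datum_pbw x iota -> datum_universal x iota.
Proof.
move=> pb; have surj := pbw_surj pb; case: pb => rel [f' fK f'K] B y j r.
have inj : injective (datum_lift x iota) by apply: can_inj fK.
have lf : linear f'.
  by move=> k a b; apply: inj; rewrite datum_lift_linear !f'K.
have [F FE] : exists F : {lrmorphism A -> B}, F =1 datum_lift y j \o f'.
  apply: lrmorphism_of.
  - by move=> k a b; rewrite /= lf datum_lift_linear.
  - by rewrite /= -[1](datum_lift1 rel) fK (datum_lift1 r).
  move=> a b /=; rewrite -(datum_liftM r); congr datum_lift.
  by apply: inj; rewrite (datum_liftM rel) !f'K.
have Fx : F x = y by rewrite FE /= -{1}(datum_lift_x rel) fK (datum_lift_x r).
have Fh h : F (iota h) = j h.
  by rewrite FE /= -(@datum_lift_h _ _ _ x iota) fK datum_lift_h.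
exists F => // F' F'x F'h; apply: (gen_linP surj).
- exact: linearP.
- exact: linearP.
- by move=> h; rewrite F'h Fh.
- by rewrite F'x Fx.
- by move=> a b ea eb; rewrite !rmorphM; congr (_ * _).
Qed.

Lemma universal_ext (A B : algType K) (x : A) (iota : G -> A)
    (f f' : {lrmorphism A -> B}) :
  datum_relations x iota -> datum_universal x iota ->
  f x = f' x -> (forall h, f (iota h) = f' (iota h)) -> f =1 f'.
Proof.
move=> [i1 iM xd xi] univ ex eh a.
have lf : linear f' by exact: linearP.
have r : datum_relations (f' x) (f' \o iota).
  split=> [|h h'||h] /=.
  - by rewrite i1 rmorph1.
  - by rewrite iM rmorphM.
  - by rewrite -!rmorphXn -(rmorph1 f') -rmorphB /= -(linZ lf) xd.
  - by rewrite -!rmorphM /= xi (linZ lf).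
have [F _ Fu] := univ _ _ _ r.
exact: (etrans (Fu f ex eh a) (esym (Fu f' (erefl _) (fun h => erefl _) a))).
Qed.

(** An algebra with the universal property is isomorphic to the one constructed
    above, whose basis is known. *)
Lemma universal_pbw (A : algType K) (x : A) (iota : G -> A) :
  datum_relations x iota -> datum_universal x iota -> datum_pbw x iota.
Proof.
move=> rel univ; split=> //.
have [f [fx fh] _] := univ _ _ _ (datum_alg_relations alpha).
have [F FE] := lrmorphism_of (datum_lift_linear x iota) (datum_lift1 rel) (datum_liftM rel).
exists f.
  apply: (gen_linP (y := datum_genx alpha) (j := @datum_genh _ alpha)) => //.
  - by move=> c; exists c; rewrite datum_lift_id.
  - by move=> k a b; rewrite datum_lift_linear linearP.
  - by move=> h; rewrite datum_lift_h fh.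
  - by rewrite (datum_lift_x rel) fx.
  - by move=> a b ea eb; rewrite (datum_liftM rel) rmorphM /= ea eb.
move=> c; rewrite -FE.
apply: (@universal_ext _ _ _ _ (F \o f) idfun rel univ) => [|h] /=.
  by rewrite fx FE (datum_lift_x rel).
by rewrite fh FE datum_lift_h.
Qed.

End PBW.

Section HopfMorphisms.
Variable K : fieldType.

Lemma tmulgE_tmul (A : algType K) (s t : tensor A A) : tmul s t = tmulg s t.
Proof. by []. Qed.

(** Both [S' \o f] and [f \o S] are inverse to [f] for the convolution. *)
Lemma bialgebra_map_antipode (H H' : hopfAlgebra K) (f : {lrmorphism H -> H'}) :
  (forall c, comul (f c) = tmap f f (comul c)) ->
  (forall c, counit (f c) = counit c) ->
  forall c, antipode (f c) = f (antipode c).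
Proof.
move=> fD fe c; pose S := @antipode K H; pose S' := @antipode K H'.
have lf : linear f by exact: linearP.
have lS : linear S by exact: linearP.
have lS' : linear S' by exact: linearP.
have lD : linear (@comul K H) by exact: linearP.
have lfS : linear (fun a => f (S a)) by exact: comp_linear lf lS.
have lSf : linear (fun a => S' (f a)) by exact: comp_linear lS' lf.
have b1 := mul_bilinear lfS lf; have b2 := mul_bilinear lf lSf.
have ll1 := tlift_linear b1; have ll2 := tlift_linear b2.
have ml (u : H') : linear (fun v : H' => v * u).
  by move=> k y z; rewrite mulrDl scalerAl.
have mr (u : H') : linear (fun v : H' => u * v).
  by move=> k y z; rewrite mulrDr scalerAr.
pose Phi (t : tensor H (tensor H H)) : H' :=
  tlift (fun a s => f (S a) * tlift (fun b e => f b * S' (f e)) s) t.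
have bPhi : bilinear_for *:%R *:%R
    (fun (a : H) (s : tensor H H) => f (S a) * tlift (fun b e => f b * S' (f e)) s).
  split=> [s|a]; first exact: (comp_linear (ml _) lfS).
  exact: (comp_linear (mr _) ll2).
have bPsi : bilinear_for *:%R *:%R
    (fun (s : tensor H H) (e : H) => tlift (fun a b => f (S a) * f b) s * S' (f e)).
  split=> [e|s]; first exact: (comp_linear (ml _) ll1).
  exact: (comp_linear (mr _) lSf).
have PhiA t : Phi (tassoc t) =
    tlift (fun s e => tlift (fun a b => f (S a) * f b) s * S' (f e)) t.
  move: t; apply: tensor_linP => [||s e].
  - exact: (comp_linear (tlift_linear bPhi) (@tassoc_linear _ _ _ _)).
  - exact: tlift_linear.
  rewrite (tlift_tensE bPsi).2; move: s; apply: tensor_linP => [||a b].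
  - apply: (comp_linear (tlift_linear bPhi)).
    exact: (comp_linear (@tassoc_linear _ _ _ _) (@tens_linl _ _ _ _)).
  - exact: (comp_linear (ml _) ll1).
  by rewrite tassocE /Phi (tlift_tensE bPhi).2 (tlift_tensE b1).2 (tlift_tensE b2).2 mulrA.
have lid : linear (@id H) by [].
have := congr1 Phi (comulA c); rewrite PhiA (tlift_tmap _ _ _ bPsi).
rewrite /Phi (tlift_tmap _ _ _ bPhi).
have e1 a : tlift (fun a b => f (S a) * f b) (comul a) = (counit a *: 1).
  transitivity (f (tlift (fun a b => S a * b) (comul a))).
    by rewrite tlift_comp //; apply: tlift_ext => u v; rewrite rmorphM.
  by rewrite antipodel linearZ rmorph1.
have e2 a : tlift (fun b e => f b * S' (f e)) (comul a) = (counit a *: 1).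
  have bb := mul_bilinear (@id_linear _ H') lS'.
  by rewrite -(tlift_tmap f f _ bb) -fD antipoder fe.
under tlift_ext => a b do rewrite e1 -scalerAl mul1r.
under [X in _ = X]tlift_ext => a b do rewrite e2 -scalerAr mulr1.
have lce : linear (counit : H -> K^o) by exact: linearP.
move=> e; transitivity (S' (f (tlift (fun a b => counit a *: b) (comul c)))).
  by rewrite counitl.
rewrite (tlift_comp _ _ lSf); under tlift_ext => a b do rewrite (linZ lSf).
rewrite e; transitivity (f (S (tlift (fun a b => counit b *: a) (comul c)))).
  rewrite (tlift_comp _ _ lfS); apply: tlift_ext => a b; exact/esym/(linZ lfS).
by rewrite counitr.
Qed.

Lemma tmap_comp (U U' U'' : lmodType K) (f : U' -> U'') (f' : U -> U') t :
  linear f -> linear f' -> tmap f f (tmap f' f' t) = tmap (f \o f') (f \o f') t.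
Proof.
move=> lf lf'; rewrite [LHS]tlift_tmap //.
by split=> [v|u] k a b /=; rewrite lf ?linearPl ?linearPr.
Qed.

Lemma tmap_id (U : lmodType K) (f : U -> U) t : f =1 id -> tmap f f t = t.
Proof.
move=> fi; rewrite -[RHS](tsum_repr t) tsumE /tmap /tlift /bieval.
by apply: eq_bigr => p _; rewrite !fi.
Qed.

Lemma hopf_iso_refl (H : hopfAlgebra K) : hopf_iso H H.
Proof.
exists idfun; split=> //; first by exists id.
by move=> c; rewrite tmap_id.
Qed.

Definition hopf_map (H H' : hopfAlgebra K) (f : {lrmorphism H -> H'}) : Prop :=
  [/\ forall c, comul (f c) = tmap f f (comul c),
      forall c, counit (f c) = counit c
    & forall c, antipode (f c) = f (antipode c)].

Lemma hopf_iso_inv (H H' : hopfAlgebra K) : hopf_iso H H' ->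
  exists (f : {lrmorphism H -> H'}) (f' : {lrmorphism H' -> H}),
  [/\ cancel f f', cancel f' f, hopf_map f & hopf_map f'].
Proof.
case=> f [[f' fK f'K] fD fe fS]; have inj := can_inj fK.
have lf : linear f by exact: linearP.
have lf' : linear f' by move=> k a b; apply: inj; rewrite lf !f'K.
have [F FE] : exists F : {lrmorphism H' -> H}, F =1 f'.
  apply: lrmorphism_of => //; first by apply: inj; rewrite f'K rmorph1.
  by move=> a b; apply: inj; rewrite rmorphM /= !f'K.
have ff' c : f (F c) = c by rewrite FE f'K.
have f'f c : F (f c) = c by rewrite FE fK.
exists f, F; split=> //; split=> c.
- rewrite -{2}[c]ff' fD tmap_comp ?tmap_id //; try exact: linearP.
- by rewrite -{2}[c]ff' fe.
- by rewrite -{2}[c]ff' fS f'f.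
Qed.

Lemma hopf_iso_sym (H H' : hopfAlgebra K) : hopf_iso H H' -> hopf_iso H' H.
Proof.
by case/hopf_iso_inv => f [f' [fK f'K _ [fD fe fS]]]; exists f'; split=> //; exists f.
Qed.

Lemma hopf_iso_trans (H H' H'' : hopfAlgebra K) :
  hopf_iso H H' -> hopf_iso H' H'' -> hopf_iso H H''.
Proof.
case=> f [fb fD fe fS] [f' [fb' fD' fe' fS']].
exists (f' \o f); split=> [|c|c|c] /=.
- exact: bij_comp.
- by rewrite fD' fD tmap_comp //; exact: linearP.
- by rewrite fe' fe.
- by rewrite fS' fS.
Qed.
End HopfMorphisms.

(** * Isomorphisms of group data; non-semisimplicity *)

Section DatumIso.
Variable K : fieldType.

Lemma datum_iso_refl (alpha : group_datum K) : datum_iso alpha alpha.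
Proof.
exists id, 1; split=> //; first by split=> //; exists id.
- by rewrite oner_neq0.
- by rewrite expr1n mul1r.
Qed.

Lemma datum_iso_d (alpha alpha' : group_datum K) (f : gd_group alpha -> gd_group alpha') :
  f (gd_g alpha) = gd_g alpha' -> (forall h, gd_chi h = gd_chi (f h)) ->
  gd_d alpha = gd_d alpha'.
Proof. by move=> fg fchi; rewrite /gd_d fchi fg. Qed.

Lemma datum_iso_sym (alpha alpha' : group_datum K) :
  datum_iso alpha alpha' -> datum_iso alpha' alpha.
Proof.
case=> f [delta [[[f' fK f'K] fM] fg fchi d0 emu]].
exists f', delta^-1; split.
- split; first by exists f.
  by move=> h h'; rewrite -{1}[h]f'K -{1}[h']f'K -fM fK.
- by rewrite -fg fK.
- by move=> h; rewrite fchi f'K.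
- by rewrite invr_eq0.
- rewrite emu mulrA -(datum_iso_d fg fchi) -exprMn mulVf // expr1n mul1r //.
Qed.

Lemma datum_iso_trans (alpha alpha' alpha'' : group_datum K) :
  datum_iso alpha alpha' -> datum_iso alpha' alpha'' -> datum_iso alpha alpha''.
Proof.
case=> f [delta [[fb fM] fg fchi d0 emu]].
case=> f' [delta' [[fb' fM'] fg' fchi' d0' emu']].
exists (f' \o f), (delta * delta'); split=> [|/=|h /=||].
- by split; [exact: bij_comp|move=> h h' /=; rewrite fM fM'].
- by rewrite fg fg'.
- by rewrite fchi fchi'.
- by rewrite mulf_neq0.
- by rewrite emu emu' exprMn (datum_iso_d fg fchi) mulrA.
Qed.

(** Rescaling [x] by [delta] accounts for the factor [delta ^+ d] between the
    parameters [mu]. *)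
Lemma datum_iso_relations (alpha alpha' : group_datum K) (B : algType K) (x : B)
    (iota : gd_group alpha' -> B) (f : gd_group alpha -> gd_group alpha') delta :
  {morph f : h h' / (h * h')%g} -> f (gd_g alpha) = gd_g alpha' ->
  (forall h, gd_chi h = gd_chi (f h)) ->
  gd_mu alpha = delta ^+ gd_d alpha * gd_mu alpha' ->
  datum_relations x iota -> datum_relations (delta *: x) (iota \o f).
Proof.
move=> fM fg fchi emu [i1 iM xd xi]; split=> [|h h'||h] /=.
- have -> : f 1%g = 1%g by apply: (mulgI (f 1%g)); rewrite -fM !mulg1.
  exact: i1.
- by rewrite fM iM.
- by rewrite exprZn emu (datum_iso_d fg fchi) xd scalerA fg.
- by rewrite -scalerAl xi -scalerAr !scalerA fchi mulrC.
Qed.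

Lemma datum_hopf_iso (alpha alpha' : group_datum K) (H H' : hopfAlgebra K) :
  is_datum_hopf alpha H -> is_datum_hopf alpha' H' -> datum_iso alpha alpha' ->
  hopf_iso H H'.
Proof.
case=> iota [x [rel univ [xD xe _] hD]] [iota' [x' [rel' univ' [xD' xe' _] hD']]].
case=> f [delta [[[f' fK f'K] fM] fg fchi d0 emu]].
have f'M : {morph f' : h h' / (h * h')%g}.
  by move=> h h'; rewrite -{1}[h]f'K -{1}[h']f'K -fM fK.
have f'g : f' (gd_g alpha') = gd_g alpha by rewrite -fg fK.
have f'chi h : gd_chi h = gd_chi (f' h) by rewrite fchi f'K.
have emu' : gd_mu alpha' = delta^-1 ^+ gd_d alpha' * gd_mu alpha.
  by rewrite emu mulrA -(datum_iso_d fg fchi) -exprMn mulVf // expr1n mul1r.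
have [F [Fx Fh] _] := univ _ _ _ (datum_iso_relations fM fg fchi emu rel').
have [F' [F'x F'h] _] := univ' _ _ _ (datum_iso_relations f'M f'g f'chi emu' rel).
have lF : linear F by exact: linearP.
have lF' : linear F' by exact: linearP.
have FK c : F' (F c) = c.
  apply: (@universal_ext _ _ _ _ _ _ (F' \o F) idfun rel univ) => [|h] /=.
    by rewrite Fx (linZ lF') F'x scalerA mulfV // scale1r.
  by rewrite Fh /= F'h /= fK.
have F'K c : F (F' c) = c.
  apply: (@universal_ext _ _ _ _ _ _ (F \o F') idfun rel' univ') => [|h] /=.
    by rewrite F'x (linZ lF) Fx scalerA mulVf // scale1r.
  by rewrite F'h /= Fh /= f'K.
have surj := pbw_surj (universal_pbw rel univ).
have lt := tmap_linear lF lF.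
have D h : comul (iota h) = iota h \ox iota h by case: (hD h).
have D' h : comul (iota' h) = iota' h \ox iota' h by case: (hD' h).
have E h : counit (iota h) = 1 by case: (hD h).
have E' h : counit (iota' h) = 1 by case: (hD' h).
have FD c : comul (F c) = tmap F F (comul c).
  move: c; apply: (gen_linP surj).
  - by move=> k a b; rewrite !linearP.
  - by move=> k a b; rewrite linearP lt.
  - by move=> h; rewrite Fh /= D D' tmap_tens // Fh.
  - rewrite Fx linearZ /= xD xD' (linD lt) !tmap_tens // Fx Fh rmorph1 /= fg.
    by rewrite linearZl_LR linearZr_LR scalerDr.
  move=> a b ea eb; rewrite rmorphM !comulM /= ea eb; symmetry.
  by apply: tmap_tmulg => // u v; rewrite rmorphM.
have Fe c : counit (F c) = counit c.
  move: c; apply: (gen_linP (W := K^o) surj).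
  - by move=> k a b; rewrite !linearP.
  - by move=> k a b; rewrite linearP.
  - by move=> h; rewrite Fh /= E E'.
  - by rewrite Fx xe linearZ /= xe' mulr0.
  - by move=> a b ea eb; rewrite rmorphM !counitM /= ea eb.
exists F; split=> //; first by exists F'.
exact: bialgebra_map_antipode.
Qed.

(** A complement of the augmentation ideal would contain an integral [a] with
    [counit a = 1], for which [x * a = 0]. But multiplication by [x] turns the
    components of [a] at the [h] into components at the [x * h], as [d > 1];
    hence the former vanish, and with them their sum, which is [counit a]. *)
Lemma datum_hopf_not_semisimple (alpha : group_datum K) (H : hopfAlgebra K) :
  nontrivial_datum alpha -> is_datum_hopf alpha H -> ~ semisimple H.
Proof.
move=> nt [iota [x [rel univ [_ xe _] hD]]] ss.
have d1 := nontrivial_d_gt1 nt.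
have le : linear (counit : H -> K^o) by exact: linearP.
have [|J [[J0 JD JM] IJ dec]] := ss (fun a => counit a = 0).
  split=> [|a b a0 b0|r a a0]; first exact: (lin0 le).
    by rewrite (linD le) a0 b0 addr0.
  by rewrite counitM a0 mulr0.
have [b [a [b0 Ja ab]]] := dec 1.
have a1 : counit a = 1.
  by have := counit1 H; rewrite ab (linD le) b0 add0r.
have xa : x * a = 0.
  by apply: IJ; [rewrite counitM xe mul0r|apply: JM].
have pb := universal_pbw rel univ; have [v av] := pbw_surj pb a.
have rel' : datum_action (fun w => x * w) (fun h w => iota h * w).
  exact/relations_action.
(* The sum of the coefficients of the [x * h], for which
   [phi (x * v) = counit v]. *)
pose phi : datum_alg alpha -> K^o := pbw_ext (fun n h => (n == 1%N)%:R).
have lphi : linear phi by exact: pbw_ext_linear.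
have e : phi (datum_x v) = counit (datum_lift x iota v).
  move: {av} v; apply: pbw_linP => [||n h nd].
  - exact: (comp_linear lphi (@datum_x_linear _ _)).
  - exact: (comp_linear le (datum_lift_linear _ _)).
  rewrite datum_lift_pbw // counitM.
  have -> : counit (x ^+ n) = (n == 0%N)%:R.
    case: n {nd} => [|n]; first by rewrite expr0 counit1.
    by rewrite exprS counitM xe mul0r.
  case: (hD h) => _ -> _; rewrite mulr1.
  have [nd1|dn] := ltnP n.+1 (gd_d alpha).
    by rewrite datum_xE // /phi pbw_ext_pbw.
  have -> : n = (gd_d alpha).-1 by lia.
  rewrite datum_x_last (linZ lphi) (linB lphi) /phi !pbw_ext_pbw ?gd_d_gt0 //=.
  by rewrite subrr scaler0 -subn1 subn_eq0 leqNgt d1.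
have : datum_lift x iota (datum_x v) = 0.
  by rewrite /datum_lift (datum_eval_x rel') -/(datum_lift x iota v) -av.
case: pb => _ /bij_inj inj; rewrite -(lin0 (datum_lift_linear x iota)) => /inj v0.
by move: e; rewrite v0 (lin0 lphi) -av a1 => /esym/eqP; rewrite oner_eq0.
Qed.
End DatumIso.

(** * Path coalgebras *)

Lemma natb_inj (R : nzRingType) (b b' : bool) : b%:R = b'%:R :> R -> b = b'.
Proof.
by case: b b' => [] [] // /eqP; rewrite ?oner_eq0 // eq_sym oner_eq0.
Qed.

Section PathCoalgebra.
Variables (K : fieldType) (Q : quiver).
Local Notation kq := (path_space Q K).
Implicit Types (p q : qpath Q) (f : kq).

Definition pstart p : vertex Q := (val p).1.
Definition pend p : vertex Q := walk_end (val p).1 (val p).2.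

Lemma pend_alpha p i : pend (path_alpha p i) = pstart (path_beta p i).
Proof. by []. Qed.

Lemma size_alpha p i : (i <= qlength p)%N -> qlength (path_alpha p i) = i.
Proof. by move=> ip; rewrite /qlength /= size_takel. Qed.

Lemma size_beta p i : qlength (path_beta p i) = (qlength p - i)%N.
Proof. by rewrite /qlength /= size_drop. Qed.

Lemma alpha_beta_inj p q i j : path_alpha p i = path_alpha q j ->
  path_beta p i = path_beta q j -> p = q.
Proof.
move=> /(congr1 val) /= [es et] /(congr1 val) /= [_ ed].
apply: val_inj; rewrite [val p]surjective_pairing [val q]surjective_pairing.
by congr (_, _) => //; rewrite -[RHS](cat_take_drop j) -et -ed cat_take_drop.
Qed.

Lemma vertex_path_of p : qlength p = 0%N -> p = vertex_path (pstart p).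
Proof. by case: p => [[v [|a s]] w] // _; apply: val_inj. Qed.

Lemma arrow_path_of p : qlength p = 1%N -> exists a, p = arrow_path a.
Proof.
case: p => [[v [|a [|b s]]] w] // _; exists a; apply: val_inj => /=.
by move: w => /=; rewrite andbT => /eqP ->.
Qed.

Lemma path_eltE p q : (path_elt K p)@_q = (p == q)%:R.
Proof. exact: mcoeffU. Qed.

Definition path_ext (W : lmodType K) (T : qpath Q -> W) (f : kq) : W :=
  \sum_(p <- msupp f) f@_p *: T p.

Lemma path_extw (W : lmodType K) (T : qpath Q -> W) (f : kq) (E : {fset qpath Q}) :
  (msupp f `<=` E)%fset -> path_ext T f = \sum_(p <- E) f@_p *: T p.
Proof.
move=> fE; rewrite /path_ext; apply: big_fset_incl => // p _ pf.
by rewrite mcoeff_outdom // scale0r.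
Qed.

Lemma path_ext_linear (W : lmodType K) (T : qpath Q -> W) : linear (path_ext T).
Proof.
move=> k f f'; set E := (msupp (k *: f + f') `|` (msupp f `|` msupp f'))%fset.
have s1 : (msupp f `<=` E)%fset by rewrite /E fsetUCA fsubsetUl.
have s2 : (msupp f' `<=` E)%fset by rewrite /E fsetUA fsubsetUr.
have s3 : (msupp (k *: f + f') `<=` E)%fset by rewrite /E fsubsetUl.
rewrite (path_extw _ s1) (path_extw _ s2) (path_extw _ s3).
rewrite scaler_sumr -big_split /=; apply: eq_bigr => p _.
by rewrite mcoeffD mcoeffZ scalerDl scalerA.
Qed.

Lemma path_ext_elt (W : lmodType K) (T : qpath Q -> W) p :
  path_ext T (path_elt K p) = T p.
Proof.
by rewrite /path_ext msuppU oner_eq0 big_seq_fset1 mcoeffUU scale1r.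
Qed.

Lemma path_elt_scale (k : K) p : << k *g p >> = k *: (path_elt K p : kq) :> kq.
Proof.
apply/malgP => q.
rewrite [RHS]mcoeffZ [X in _ = _ * X]path_eltE mulr_natr.
exact: mcoeffU.
Qed.

Lemma mcoeff_scale_elt (k : K) p q : (k *: path_elt K p : kq)@_q = k * (p == q)%:R.
Proof. by rewrite mcoeffZ [X in _ * X]path_eltE. Qed.

Lemma path_linP (W : lmodType K) (F F' : kq -> W) : linear F -> linear F' ->
  (forall p, F (path_elt K p) = F' (path_elt K p)) -> F =1 F'.
Proof.
move=> lF lF' e f; rewrite [f]monalgE (lin_sum lF) (lin_sum lF').
apply: eq_bigr => p _.
by rewrite path_elt_scale (linZ lF) (linZ lF') e.
Qed.

Lemma path_comul_linear : linear (@path_comul Q K).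
Proof. exact: path_ext_linear. Qed.

Lemma mcoeff_linear p : linear (fun f : kq => f@_p : K^o).
Proof. by move=> k f f'; rewrite mcoeffD mcoeffZ. Qed.

Lemma mul_functional_bilinear (U V : lmodType K) (f : U -> K^o) (g : V -> K^o) :
  linear f -> linear g -> bilinear_for *:%R *:%R (fun u v => f u * g v : K^o).
Proof.
move=> lf lg; split=> [v|u] k a b /=.
  by rewrite lf mulrDl; congr (_ + _); apply/esym/mulrA.
by rewrite lg mulrDr; congr (_ + _); apply: mulrCA.
Qed.

(** The convolution product of two coordinate functionals. *)
Definition pathcoef (b a : qpath Q) (f : kq) : K^o :=
  tlift (fun u v : kq => u@_b * v@_a : K^o) (path_comul f).

Let bl b a := mul_functional_bilinear (mcoeff_linear b) (mcoeff_linear a).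

Lemma pathcoef_linear b a : linear (pathcoef b a).
Proof. exact: (comp_linear (tlift_linear (bl b a)) path_comul_linear). Qed.

Lemma pathcoef_elt b a q : pathcoef b a (path_elt K q) =
  \sum_(j < (qlength q).+1) ((path_beta q j == b) && (path_alpha q j == a))%:R.
Proof.
rewrite /pathcoef path_comulE /path_comul1 (lin_sum (tlift_linear (bl b a))).
apply: eq_bigr => j _; rewrite (tlift_tensE (bl b a)).2 !path_eltE.
by case: eqP => _; case: eqP => _; rewrite ?mulr0 ?mul0r ?mulr1.
Qed.

(** The dual of the path coalgebra is a completed path algebra: coordinate
    functionals multiply in the same way as paths. *)
Lemma pathcoef_cat p i f : (i <= qlength p)%N ->
  pathcoef (path_beta p i) (path_alpha p i) f = f@_p.
Proof.
move=> ip; move: f; apply: path_linP => [||q].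
- exact: pathcoef_linear.
- exact: mcoeff_linear.
rewrite pathcoef_elt path_eltE; have [->|qp] := eqVneq q p; last first.
  rewrite big1 // => j _; case: andP => // -[/eqP eb /eqP ea].
  by case/eqP: qp; apply: alpha_beta_inj ea eb.
have ip' : (i < (qlength p).+1)%N by [].
rewrite (bigD1 (Ordinal ip')) //= !eqxx big1 ?addr0 // => j ji.
case: andP => // -[_ /eqP /(congr1 (@qlength Q))].
have jp : (j <= qlength p)%N by rewrite -ltnS.
by rewrite (size_alpha jp) (size_alpha ip) => e; case/eqP: ji; apply: val_inj.
Qed.

Lemma pathcoef_uncomposable b a f : pend a <> pstart b -> pathcoef b a f = 0.
Proof.
move=> ab; move: f; apply: path_linP => [||q].
- exact: pathcoef_linear.
- by move=> k u v; rewrite scaler0 addr0.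
rewrite pathcoef_elt big1 // => j _; case: andP => // -[/eqP eb /eqP ea].
by case: ab; rewrite -ea -eb.
Qed.

End PathCoalgebra.

(** The data of a monomial structure on [H], with the subcoalgebra of the path
    coalgebra replaced by the set of paths spanning it. *)
Record path_model (K : fieldType) (H : hopfAlgebra K) := PathModel {
  pm_quiver : quiver;
  pm_phi : {linear H -> path_space pm_quiver K};
  pm_path : qpath pm_quiver -> Prop;
  pm_elt : qpath pm_quiver -> H;
  pm_bound : nat;
  pm_inj : injective pm_phi;
  pm_supp : forall c, path_span pm_path (pm_phi c);
  pm_phi_elt : forall p, pm_path p -> pm_phi (pm_elt p) = path_elt K p;
  pm_comul : forall c, path_comul (pm_phi c) = tmap pm_phi pm_phi (comul c);
  pm_counit : forall c, path_counit (pm_phi c) = counit c;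
  pm_vertex : forall v, pm_path (vertex_path v);
  pm_arrow : forall a, pm_path (arrow_path a);
  pm_sub : forall p i, pm_path p -> (i <= qlength p)%N ->
    pm_path (path_beta p i) /\ pm_path (path_alpha p i);
  pm_boundP : forall p, pm_path p -> (qlength p < pm_bound)%N
}.

(** The paths in the subcoalgebra are closed under subpaths: the coproduct of
    [p] has coordinate [1] along each factorization of [p], so that both
    factors occur in the support of an element of the subcoalgebra. *)
Lemma monomial_model (K : fieldType) (H : hopfAlgebra K) :
  monomial_hopf H -> inhabited (path_model H).
Proof.
case=> Q [D [phi [[Dsub Dv Da [m m2 Dm] [P DP]] inj Dim phiD phie]]].
have spanE p : path_span P (path_elt K p) <-> P p.
  split=> [h|Pp q]; first by apply: h; rewrite msuppU oner_eq0 in_fset1.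
  by rewrite msuppU oner_eq0 in_fset1 => /eqP ->.
have /choice[elt eltP] : forall p, exists c, P p -> phi c = path_elt K p.
  move=> p.
  have [Pp|nPp] := pselect (P p); last by exists 0.
  by have /spanE/DP/Dim [c ->] := Pp; exists c.
constructor; apply: (@PathModel _ H Q phi P elt m) => //.
- by move=> c; apply/DP/Dim; exists c.
- by move=> v; apply/spanE/DP/Dv.
- by move=> a; apply/spanE/DP/Da.
- move=> p i Pp ip; have /spanE/DP Dp := Pp.
  case: Dsub => _ _ /(_ _ Dp) [s [sD e]].
  have := pathcoef_cat (path_elt K p) ip; rewrite /pathcoef e path_eltE eqxx.
  have bl := mul_functional_bilinear (@mcoeff_linear K Q (path_beta p i))
    (@mcoeff_linear K Q (path_alpha p i)).
  rewrite (lin_sum (tlift_linear bl)) => e1.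
  have : ~~ all (fun t => t.1@_(path_beta p i) * t.2@_(path_alpha p i) == 0) s.
    apply/negP => /allP h; have /eqP := oner_neq0 K; apply.
    transitivity (true%:R : K); first by [].
    rewrite -e1 big_seq big1 // => t ts.
    by rewrite (tlift_tensE bl).2; apply/eqP/h.
  case/allPn => t ts; rewrite mulf_eq0 negb_or => /andP[n1 n2].
  have [/DP t1 /DP t2] := sD _ ts.
  by split; [apply: t1|apply: t2]; rewrite -mcoeff_neq0.
move=> p /spanE/DP /Dm /(_ p).
rewrite -mcoeff_neq0 path_eltE eqxx oner_neq0 => /(_ isT).
by case: m m2 {Dm}.
Qed.

Arguments pm_inj {K H} _.
Arguments pm_supp {K H} _ c.
Arguments pm_phi_elt {K H} _.
Arguments pm_elt {K H} _ p.
Arguments pm_counit {K H} _ c.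
Arguments pm_comul {K H} _ c.
Arguments pm_path {K H} _ _.

(** * Group-like and skew-primitive elements *)

Section PathModel.
Variables (K : fieldType) (H : hopfAlgebra K) (M : path_model H).
Local Notation Q := (pm_quiver M).
Local Notation phi := (pm_phi M).
Local Notation P := (pm_path M).
Local Notation pel := (pm_elt M).
Implicit Types (p q a b : qpath Q) (c : H).

Definition pcoef q c : K^o := (phi c)@_q.

Lemma pcoef_linear q : linear (pcoef q).
Proof. by move=> k c c'; rewrite /pcoef linearP mcoeffD mcoeffZ. Qed.

Lemma pcoef_inj c c' : (forall q, pcoef q c = pcoef q c') -> c = c'.
Proof. by move=> e; apply: (pm_inj M); apply/malgP. Qed.

Lemma pcoef_supp q c : pcoef q c != 0 -> P q.
Proof.
rewrite /pcoef mcoeff_neq0; exact: pm_supp.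
Qed.

Lemma pcoef_long q c : (pm_bound M <= qlength q)%N -> pcoef q c = 0.
Proof.
move=> bq; apply/eqP/negPn/negP => /pcoef_supp /pm_boundP.
by rewrite ltnNge bq.
Qed.

Definition pcoef2 b a (t : tensor H H) : K^o :=
  tlift (fun u v => pcoef b u * pcoef a v : K^o) t.

Let bl b a := mul_functional_bilinear (pcoef_linear b) (pcoef_linear a).

Lemma pcoef2_linear b a : linear (pcoef2 b a).
Proof. exact: tlift_linear. Qed.

Lemma pcoef2_tens b a u v : pcoef2 b a (u \ox v) = pcoef b u * pcoef a v.
Proof. by rewrite /pcoef2 (tlift_tensE (bl b a)).2. Qed.

Lemma pcoef2_comul b a c : pcoef2 b a (comul c) = pathcoef b a (phi c).
Proof.
rewrite /pathcoef pm_comul tlift_tmap //.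
exact: (mul_functional_bilinear (mcoeff_linear b) (mcoeff_linear a)).
Qed.

Lemma pcoef_cat p i c : (i <= qlength p)%N ->
  pcoef2 (path_beta p i) (path_alpha p i) (comul c) = pcoef p c.
Proof. by move=> ip; rewrite pcoef2_comul pathcoef_cat. Qed.

Lemma pcoef2_uncomposable b a c : pend a <> pstart b -> pcoef2 b a (comul c) = 0.
Proof. by move=> ab; rewrite pcoef2_comul pathcoef_uncomposable. Qed.

Lemma qcat_exists a b : pend a = pstart b ->
  exists p, [/\ qlength p = (qlength a + qlength b)%N,
    path_alpha p (qlength a) = a & path_beta p (qlength a) = b].
Proof.
case: a b => [[v s] /= ws] [[w s'] /= ws'] /= e.
rewrite /pend /pstart /= in e.
have wc : walk v (s ++ s') by rewrite walk_cat ws e.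
exists (exist _ (v, s ++ s') wc); split.
- by rewrite /qlength /= size_cat.
- by apply: val_inj; rewrite /qlength /= take_size_cat.
- by apply: val_inj; rewrite /qlength /= take_size_cat // drop_size_cat // e.
Qed.

Lemma pcoef_pel p q : P p -> pcoef q (pel p) = (p == q)%:R.
Proof. by move=> Pp; rewrite /pcoef (pm_phi_elt M) // path_eltE. Qed.

Lemma path_ext_phi c : path_ext pel (phi c) = c.
Proof.
apply: (pm_inj M); rewrite {2}[phi c]monalgE /path_ext linear_sum.
rewrite [LHS]big_seq [RHS]big_seq; apply: eq_bigr => p; rewrite -mcoeff_neq0 => /pcoef_supp Pp.
by rewrite linearZ /= (pm_phi_elt M) // -path_elt_scale.
Qed.

Lemma pel_sum c : c = \sum_(p <- msupp (phi c)) pcoef p c *: pel p.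
Proof. by rewrite -{1}(path_ext_phi c). Qed.

Lemma pel_lin (W : lmodType K) (F F' : H -> W) c : linear F -> linear F' ->
  (forall p, P p -> pcoef p c != 0 -> F (pel p) = F' (pel p)) -> F c = F' c.
Proof.
move=> lF lF' e; rewrite (pel_sum c) (lin_sum lF) (lin_sum lF') [LHS]big_seq [RHS]big_seq.
apply: eq_bigr => p; rewrite -mcoeff_neq0 => pc.
by rewrite (linZ lF) (linZ lF') e //; apply: pcoef_supp pc.
Qed.

Lemma comul_pel p : P p -> comul (pel p) =
  \sum_(i < (qlength p).+1) pel (path_beta p i) \ox pel (path_alpha p i).
Proof.
move=> Pp; have le := path_ext_linear pel; have lphi : linear phi by exact: linearP.
have : tmap (path_ext pel) (path_ext pel) (path_comul (phi (pel p))) = comul (pel p).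
  rewrite pm_comul [LHS]tlift_tmap; last first.
    by split=> [v|u] k x y /=; rewrite le ?linearPl ?linearPr.
  rewrite -[RHS](@tmap_id _ _ id) // /tmap; apply: tlift_ext => u v.
  by rewrite !path_ext_phi.
move=> <-; rewrite (pm_phi_elt M) // path_comulE /path_comul1 (lin_sum (tmap_linear le le)).
apply: eq_bigr => i _; rewrite (tmap_tens le le).
by congr (_ \ox _); apply: path_ext_elt.
Qed.

Definition glv (v : vertex Q) : H := pel (vertex_path v).

Lemma pcoef_glv v q : pcoef q (glv v) = (vertex_path v == q)%:R.
Proof. by rewrite pcoef_pel //; apply: pm_vertex. Qed.

Lemma vertex_path_inj : injective (@vertex_path Q).
Proof. by move=> v w /(congr1 val) []. Qed.

Lemma vertex_path_eq v w : (vertex_path v == vertex_path w :> qpath Q) = (v == w).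
Proof. exact: (inj_eq vertex_path_inj). Qed.

Lemma glv_inj : injective glv.
Proof.
move=> v w e; have := pcoef_glv w (vertex_path v); rewrite -e pcoef_glv eqxx.
by rewrite vertex_path_eq => /natb_inj /esym /eqP.
Qed.

Lemma alpha0 p : path_alpha p 0 = vertex_path (pstart p).
Proof. by apply: val_inj; rewrite /= take0. Qed.

Lemma beta0 p : path_beta p 0 = p.
Proof. by apply: val_inj; rewrite /= take0 drop0 /=; case: (val p). Qed.

Lemma alpha_size p i : (qlength p <= i)%N -> path_alpha p i = p.
Proof. by move=> ip; apply: val_inj; rewrite /= take_oversize //; case: (val p). Qed.

Lemma beta_size p : path_beta p (qlength p) = vertex_path (pend p).
Proof. by apply: val_inj; rewrite /= take_size drop_size. Qed.

Lemma comul_glv v : comul (glv v) = glv v \ox glv v.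
Proof.
rewrite comul_pel; last exact: pm_vertex.
by rewrite big_ord1 beta0 alpha_size.
Qed.

Lemma counit_eq0 c : (forall v, pcoef (vertex_path v) c = 0) -> counit c = 0.
Proof.
move=> c0; rewrite -(pm_counit M) /path_counit big1 // => p _.
case: eqP => [p0|]; last by rewrite mulr0.
by rewrite mulr1 (vertex_path_of p0); apply: c0.
Qed.

Lemma counit_glv v : counit (glv v) = 1.
Proof.
rewrite -(pm_counit M) /glv (pm_phi_elt M); last exact: pm_vertex.
rewrite /path_counit /path_elt msuppU oner_eq0 big_seq_fset1 mcoeffUU.
by rewrite mul1r.
Qed.

Lemma glv_grouplike v : grouplike (glv v).
Proof. by split; [exact: comul_glv|exact: counit_glv]. Qed.

(** The coordinates of a group-like element are multiplicative along
    factorizations of paths, and products of coordinates of paths that cannot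
    be composed vanish. Hence its support consists of one vertex and of loops
    at this vertex. *)
Lemma grouplike_glv c : grouplike c -> exists v, c = glv v.
Proof.
case=> cD ce.
have cut p i : (i <= qlength p)%N ->
    pcoef p c = pcoef (path_beta p i) c * pcoef (path_alpha p i) c.
  by move=> ip; rewrite -(pcoef_cat c ip) cD pcoef2_tens.
have [v cv] : exists v, pcoef (vertex_path v) c != 0.
  apply: contrapT => nv; have /eqP := oner_neq0 K; apply.
  rewrite -ce; apply: counit_eq0 => v; apply/eqP/negPn/negP => h.
  by apply: nv; exists v.
have cw w : pcoef (vertex_path w) c != 0 -> w = v.
  move=> cw; apply/eqP/negPn/negP => /eqP wv.
  have : pcoef2 (vertex_path w) (vertex_path v) (comul c) = 0.
    by apply: pcoef2_uncomposable => e; apply: wv.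
  by move/eqP; rewrite cD pcoef2_tens mulf_eq0 (negPf cw) (negPf cv).
have cv1 : pcoef (vertex_path v) c = 1.
  apply: (mulfI cv); rewrite mulr1.
  by have := cut (vertex_path v) 0 isT; rewrite beta0 alpha0 => <-.
have loop p : pcoef p c != 0 -> pstart p = v /\ pend p = v.
  move=> pc; split; apply: cw; move: pc.
    by rewrite (cut p 0%N) // alpha0 mulf_eq0 negb_or => /andP[].
  by rewrite (cut p (qlength p)) // beta_size mulf_eq0 negb_or => /andP[].
(* A loop could be iterated beyond the length bound. *)
have noloop n : forall p, (pm_bound M <= qlength p + n)%N -> (0 < qlength p)%N ->
    pcoef p c = 0.
  elim: n => [|n IH] p bp p0; first by apply: pcoef_long; rewrite addn0 in bp.
  apply/eqP/negPn/negP => pc; have [ps pe] := loop p pc.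
  have [q [ql qa qb]] := @qcat_exists p p (etrans pe (esym ps)).
  have := cut q (qlength p); rewrite ql leq_addr qa qb => /(_ isT) e.
  have /eqP : pcoef q c = 0 by apply: IH; rewrite ql; lia.
  by rewrite e mulf_eq0 (negPf pc).
exists v; apply: pcoef_inj => q; rewrite pcoef_glv.
have [q0|q0] := posnP (qlength q).
  rewrite (vertex_path_of q0) vertex_path_eq; case: eqP => [<-//|vq].
  by apply/eqP/negPn/negP => /cw e; apply: vq.
rewrite (@noloop (pm_bound M)) ?leq_addl //; case: eqP => // e.
by rewrite -e in q0.
Qed.

Lemma pcoef2_skew v w c b a : skew_primitive (glv v) (glv w) c ->
  pcoef2 b a (comul c) = pcoef b c * (vertex_path v == a)%:R +
    (vertex_path w == b)%:R * pcoef a c.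
Proof.
move=> ->; rewrite (linD (pcoef2_linear b a)) !pcoef2_tens.
by rewrite (pcoef_glv v a) (pcoef_glv w b).
Qed.

(** The coordinates of [c] at [v] and [w] are opposite because these vertices, if
    distinct, cannot be composed; if [v = w] then the coordinate at [v] is twice
    itself. *)
Lemma skew_vertices v w c : skew_primitive (glv v) (glv w) c ->
  (forall q, (0 < qlength q)%N -> pcoef q c = 0) ->
  exists k : K, c = k *: (glv v - glv w).
Proof.
move=> cD c0; have vE u : pcoef (vertex_path u) c =
    pcoef (vertex_path u) c * (v == u)%:R + (w == u)%:R * pcoef (vertex_path u) c.
  have := @pcoef_cat (vertex_path u) 0 c isT; rewrite beta0 alpha0.
  by rewrite (pcoef2_skew _ _ cD) !vertex_path_eq; apply: esym.
exists (pcoef (vertex_path v) c); apply: pcoef_inj => q.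
rewrite (linZ (pcoef_linear q)) (linB (pcoef_linear q)).
rewrite (pcoef_glv v q) (pcoef_glv w q).
have [q0|q0] := posnP (qlength q); last first.
  rewrite c0 //; do 2 (case: eqP => [e|_]; first by rewrite -e in q0).
  by rewrite subrr scaler0.
rewrite (vertex_path_of q0) !vertex_path_eq; set u := pstart q.
have [vw|vw] := eqVneq v w.
  subst w; rewrite subrr scaler0.
  move: (vE u); case: eqP => [<-|_]; last by rewrite mulr0 mul0r addr0.
  rewrite mulr1 mul1r => e; apply: (addrI (pcoef (vertex_path v) c)).
  by rewrite addr0 -e.
case: (v =P u) => [<-|/eqP vu].
  by rewrite eq_sym (negPf vw) subr0 [RHS]mulr1.
case: (w =P u) => [<-|/eqP wu]; last first.
  rewrite subrr scaler0.
  by have := vE u; rewrite (negPf vu) (negPf wu) mulr0 mul0r addr0.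
have /eqP : pcoef2 (vertex_path w) (vertex_path v) (comul c) = 0.
  by apply: pcoef2_uncomposable => e; case/eqP: vw.
rewrite (pcoef2_skew _ _ cD) !eqxx mulr1 mul1r.
by rewrite addr_eq0 sub0r => /eqP ->; rewrite [RHS]mulrN1.
Qed.

(** A path of length at least 2 has a factorization without vertices, which no
    term of the coproduct of [c] matches. *)
Lemma skew_coef v w c q : skew_primitive (glv v) (glv w) c ->
  pcoef q c != 0 -> (0 < qlength q)%N ->
  exists ar : arrow Q, [/\ q = arrow_path ar, src ar = v & tgt ar = w].
Proof.
move=> cD qc q0.
have cut i : (i <= qlength q)%N -> pcoef q c =
    pcoef (path_beta q i) c * (vertex_path v == path_alpha q i)%:R +
    (vertex_path w == path_beta q i)%:R * pcoef (path_alpha q i) c.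
  move=> iq; rewrite -{1}(pcoef_cat c iq).
  exact: pcoef2_skew.
have q1 : qlength q = 1%N.
  apply/eqP; rewrite eqn_leq q0 andbT leqNgt; apply/negP => q1.
  case/eqP: qc; rewrite (cut 1%N) //.
  case: eqP => [/(congr1 (@qlength Q))|_]; first by rewrite size_alpha.
  case: eqP => [/(congr1 (@qlength Q))|_]; last by rewrite mulr0 mul0r addr0.
  by rewrite size_beta => /eqP; rewrite eq_sym subn_eq0 leqNgt q1.
have nv u : (vertex_path u == q) = false.
  by apply/eqP => e; rewrite -e in q0.
have [ar qa] := arrow_path_of q1; exists ar; split=> //.
  move: qc; rewrite (cut 0%N) // beta0 alpha0 nv mul0r addr0 vertex_path_eq.
  by case: (v =P _) => [->|_]; rewrite ?mulr0 ?eqxx // qa.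
move: qc; rewrite (cut 1%N) ?q1 // alpha_size ?q1 // nv mulr0 add0r.
have -> : path_beta q 1 = vertex_path (pend q) by rewrite -beta_size q1.
by rewrite vertex_path_eq; case: (w =P _) => [->|_]; rewrite ?mul0r ?eqxx // qa.
Qed.

(** The length filtration, which is the coradical filtration of [H]. *)
Definition filt n c : Prop := forall q, (n < qlength q)%N -> pcoef q c = 0.

Lemma filt_lin n k c c' : filt n c -> filt n c' -> filt n (k *: c + c').
Proof.
by move=> h h' q nq; rewrite pcoef_linear h // h' // scaler0 addr0.
Qed.

Lemma filt0 n : filt n 0.
Proof. by move=> q _; rewrite (lin0 (pcoef_linear q)). Qed.

Lemma filtZ n k c : filt n c -> filt n (k *: c).
Proof. by move=> h; rewrite -[k *: c]addr0; apply: filt_lin => //; apply: filt0. Qed.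

Lemma filtD n c c' : filt n c -> filt n c' -> filt n (c + c').
Proof. by move=> h h'; rewrite -[c]scale1r; apply: filt_lin. Qed.

Lemma filt_leq m n c : (m <= n)%N -> filt m c -> filt n c.
Proof. by move=> mn h q nq; apply/h/leq_ltn_trans/nq. Qed.

Lemma filt_pel p : pm_path M p -> filt (qlength p) (pel p).
Proof.
move=> Pp q pq; rewrite pcoef_pel //; case: eqP => // e.
by rewrite e ltnn in pq.
Qed.

Lemma filt_glv v : filt 0 (glv v).
Proof. exact/(filt_pel (p := vertex_path v))/pm_vertex. Qed.

Lemma pcoef2_comulM b a c c' (s s' : nat) (u v : nat -> H) (u' v' : nat -> H) :
  comul c = \sum_(i < s) u i \ox v i -> comul c' = \sum_(j < s') u' j \ox v' j ->
  pcoef2 b a (comul (c * c')) =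
  \sum_(i < s) \sum_(j < s') pcoef b (u i * u' j) * pcoef a (v i * v' j).
Proof.
move=> cD cD'; rewrite comulM cD cD' tmulgE_tmul.
rewrite (lin_sum (tmulg_linl _)) (lin_sum (pcoef2_linear b a)); apply: eq_bigr => i _.
rewrite (lin_sum (tmulg_linr _)) (lin_sum (pcoef2_linear b a)); apply: eq_bigr => j _.
by rewrite tmulgE pcoef2_tens.
Qed.

Lemma pcoef2_pelM p p' b a : P p -> P p' ->
  pcoef2 b a (comul (pel p * pel p')) =
  \sum_(i < (qlength p).+1) \sum_(j < (qlength p').+1)
    pcoef b (pel (path_beta p i) * pel (path_beta p' j)) *
    pcoef a (pel (path_alpha p i) * pel (path_alpha p' j)).
Proof.
move=> Pp Pp'.
exact: (pcoef2_comulM _ _ (u := fun i => pel (path_beta p i))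
  (v := fun i => pel (path_alpha p i)) (u' := fun i => pel (path_beta p' i))
  (v' := fun i => pel (path_alpha p' i)) (comul_pel Pp) (comul_pel Pp')).
Qed.

Lemma grouplikeM c c' : grouplike c -> grouplike c' -> grouplike (c * c').
Proof.
case=> cD ce [cD' ce']; split; last by rewrite counitM ce ce' mulr1.
by rewrite comulM cD cD' tmulE.
Qed.

Lemma filt_grouplike c : grouplike c -> filt 0 c.
Proof. by case/grouplike_glv => v ->; apply: filt_glv. Qed.

(** A path [q] of length greater than [qlength p + qlength p'] is factored into
    its first arrow [a] and the rest [b]. Terms of the coproduct in which both
    right factors are vertices do not contribute to [a]; in all others the left
    factors are shorter than [p] and [p'] together, and do not contribute to
    [b]. *)
Lemma filt_pelM p p' : P p -> P p' -> filt (qlength p + qlength p') (pel p * pel p').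
Proof.
have [n] := ubnP (qlength p + qlength p'); elim: n p p' => // n IH p p' le Pp Pp' q pq.
have q0 : (0 < qlength q)%N by apply: leq_ltn_trans pq.
rewrite -(@pcoef_cat q 1) // pcoef2_pelM // big1 // => i _; rewrite big1 // => j _.
have ip : (i <= qlength p)%N by rewrite -ltnS.
have jp : (j <= qlength p')%N by rewrite -ltnS.
have [Pb Pa] := pm_sub Pp ip; have [Pb' Pa'] := pm_sub Pp' jp.
have [ij|ij] := posnP (i + j)%N.
  have [-> ->] : nat_of_ord i = 0%N /\ nat_of_ord j = 0%N by lia.
  have fg := filt_grouplike (grouplikeM (glv_grouplike (pstart p))
    (glv_grouplike (pstart p'))).
  by rewrite !alpha0 fg ?mulr0 ?size_alpha.
rewrite (IH _ _ _ Pb Pb') ?mul0r // !size_beta; lia.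
Qed.

Lemma filtM m n c c' : filt m c -> filt n c' -> filt (m + n) (c * c').
Proof.
have short k x p : filt k x -> pcoef p x != 0 -> (qlength p <= k)%N.
  by move=> fx; rewrite leqNgt; apply: contraNN => /fx ->.
move=> fc fc' q mnq; pose F x := pcoef q (x * c').
have lF : linear F by move=> k x y; rewrite /F mulrDl -scalerAl pcoef_linear.
rewrite -/(F c); transitivity ((fun=> 0 : K^o) c) => //.
apply: pel_lin => // [k x y|p Pp /(short _ _ _ fc) pm]; first by rewrite scaler0 addr0.
rewrite /F; pose F' x := pcoef q (pel p * x).
have lF' : linear F' by move=> k x y; rewrite /F' mulrDr -scalerAr pcoef_linear.
rewrite -/(F' c'); transitivity ((fun=> 0 : K^o) c') => //.
apply: pel_lin => // [k x y|p' Pp' /(short _ _ _ fc') pm']; first by rewrite scaler0 addr0.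
apply: (filt_pelM Pp Pp'); apply: leq_ltn_trans mnq; exact: leq_add.
Qed.

Lemma antipode_grouplikeV c : grouplike c -> antipode c * c = 1 /\ c * antipode c = 1.
Proof.
case=> cD ce; have lS : linear (@antipode K H) by exact: linearP.
have b1 := mul_bilinear lS (@id_linear _ H).
have b2 := mul_bilinear (@id_linear _ H) lS.
have := antipodel c; have := antipoder c.
by rewrite cD ce scale1r (tlift_tensE b1).2 (tlift_tensE b2).2.
Qed.

Lemma antipode_grouplike c : grouplike c -> grouplike (antipode c).
Proof.
move=> gc; have [Vc cV] := antipode_grouplikeV gc; case: gc => cD ce; split.
  transitivity (tmulg (comul (antipode c * c)) (antipode c \ox antipode c)).
    by rewrite comulM cD tmulgE_tmul -tmulgA tmulgE cV tmulg1.
  by rewrite Vc comul1 tmul1g.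
by have := counit1 H; rewrite -Vc counitM ce mulr1.
Qed.

Lemma grouplike1 : grouplike (1 : H).
Proof. by split; [exact: comul1|exact: counit1]. Qed.

(** Let [p] be a path of maximal length [N] which starts at [v], and let [b] be
    an arrow from [v] to [t]. The coproduct of [p * (v^-1 * b)] has no
    coordinates along pairs [(q, b)] with [q] of length [N], as there is no path
    of length [N + 1]. If [b] is not the first arrow of [p] then these
    coordinates are those of [p * (v^-1 * t)], which is thus of smaller degree
    than [p]. This is absurd, because translations by group-like elements are
    invertible and respect the filtration. *)
Lemma maximal_path_arrow p (ar : arrow Q) : P p -> (0 < qlength p)%N ->
  (forall p', P p' -> (qlength p' <= qlength p)%N) ->
  src ar = pstart p -> path_alpha p 1 = arrow_path ar.
Proof.
move=> Pp p0 pmax sa; apply: contrapT => ne.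
set N := qlength p in p0 pmax; set v := pstart p in sa.
pose t := glv (tgt ar); pose y := antipode (glv v) * pel (arrow_path ar).
have [Vv vV] := antipode_grouplikeV (glv_grouplike v).
have [Vt tV] := antipode_grouplikeV (glv_grouplike (tgt ar)).
have gV := antipode_grouplike (glv_grouplike v).
have Par : P (arrow_path ar) by exact: pm_arrow.
have lD := @comul_pel _ Par.
have yD : comul y = \sum_(j < 2) (antipode (glv v) * pel (path_beta (arrow_path ar) j))
    \ox (antipode (glv v) * pel (path_alpha (arrow_path ar) j)).
  rewrite /y comulM gV.1 lD tmulgE_tmul (lin_sum (tmulg_linr _)).
  by apply: eq_bigr => j _; rewrite tmulgE.
have z (b : qpath Q) : qlength b = N -> pcoef b (pel p * (antipode (glv v) * t)) = 0.
  move=> bN.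
  have e0 : pcoef2 b (arrow_path ar) (comul (pel p * y)) = 0.
    have [e|e] := pselect (pend (arrow_path ar) = pstart b); last first.
      exact: pcoef2_uncomposable.
    have [q [ql qa qb]] := qcat_exists e.
    rewrite -qb -{2}qa pcoef_cat ?ql ?leq_addr //.
    apply/eqP/negPn/negP => /pcoef_supp /pmax.
    by rewrite ql bN ltnn.
  rewrite -e0 (pcoef2_comulM _ _ (u := fun i => pel (path_beta p i))
    (v := fun i => pel (path_alpha p i))
    (u' := fun j => antipode (glv v) * pel (path_beta (arrow_path ar) j))
    (v' := fun j => antipode (glv v) * pel (path_alpha (arrow_path ar) j))
    (comul_pel Pp) yD).
  have ab0 : path_beta (arrow_path ar) 0 = arrow_path ar by apply: beta0.
  have ab1 : path_beta (arrow_path ar) 1 = vertex_path (tgt ar) by apply: val_inj.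
  have aa0 : path_alpha (arrow_path ar) 0 = vertex_path v by rewrite -sa; apply: val_inj.
  have aa1 : path_alpha (arrow_path ar) 1 = arrow_path ar by apply: val_inj.
  have noar i : (i <= N)%N ->
      pcoef (arrow_path ar) (pel (path_alpha p i) * (antipode (glv v) * glv v)) = 0.
    move=> iN; have [_ Pa] := pm_sub Pp iN.
    rewrite Vv mulr1 pcoef_pel //; case: eqP => // e; case: ne; rewrite -e.
    by move: e => /(congr1 (@qlength Q)); rewrite size_alpha // => ->.
  rewrite (bigD1 ord0) //= [X in _ = _ + X]big1 => [|i i0]; last first.
    have iN : (i <= N)%N by rewrite -ltnS.
    rewrite !big_ord_recl big_ord0 /= /bump /= addr0 ab0 ab1 aa0 aa1.
    rewrite (noar _ iN) mulr0 add0r.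
    have [Pb _] := pm_sub Pp iN.
    have fb := filtM (filt_pel Pb) (filt_grouplike
      (grouplikeM gV (glv_grouplike (tgt ar)))).
    rewrite fb ?mul0r // addn0 size_beta bN -subn_gt0 subKn // lt0n.
    by apply: contraNN i0 => /eqP e; apply/eqP/val_inj.
  rewrite !big_ord_recl big_ord0 /= /bump /= addr0 ab0 ab1 aa0 aa1.
  rewrite (noar _ (leq0n N)) mulr0 add0r addr0 beta0 alpha0 -/v -/(glv v) -/t.
  by rewrite [X in _ = _ * pcoef _ X]mulrA vV mul1r pcoef_pel // eqxx mulr1.
have fz : filt N.-1 (pel p * (antipode (glv v) * t)).
  move=> q; rewrite prednK // leq_eqVlt => /orP[/eqP e|Nq]; first exact/z/esym.
  have fp := filtM (filt_pel Pp) (filt_grouplike (grouplikeM gV (glv_grouplike (tgt ar)))).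
  by apply: fp; rewrite addn0.
have gt := antipode_grouplike (glv_grouplike (tgt ar)).
have := filtM fz (filt_grouplike (grouplikeM gt (glv_grouplike v))).
rewrite addn0 -!mulrA [t * _]mulrA tV mul1r Vv mulr1 => /(_ p).
by rewrite prednK // leqnn pcoef_pel // eqxx => /(_ isT) /(@natb_inj K true false).
Qed.

Lemma maximal_path : (exists ar : arrow Q, True) ->
  exists p, [/\ P p, (0 < qlength p)%N & forall p', P p' -> (qlength p' <= qlength p)%N].
Proof.
case=> ar _; pose has n := `[< exists p, P p /\ qlength p = n >].
have ex : exists n, has n.
  by exists 1%N; apply/asboolP; exists (arrow_path ar); split=> //; exact: pm_arrow.
have bd n : has n -> (n <= pm_bound M)%N.
  by move=> /asboolP[p [/pm_boundP pb <-]]; apply: ltnW.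
case: (ex_maxnP ex bd) => n /asboolP[p [Pp <-]] nmax.
exists p; split=> //.
  by apply: (nmax 1%N); apply/asboolP; exists (arrow_path ar); split=> //; exact: pm_arrow.
by move=> p' Pp'; apply: nmax; apply/asboolP; exists p'.
Qed.

Lemma unique_arrow_somewhere : (exists ar : arrow Q, True) ->
  exists ar : arrow Q, forall ar', src ar' = src ar -> ar' = ar.
Proof.
move=> /maximal_path[p [Pp p0 pmax]].
have p1 : qlength (path_alpha p 1) = 1%N by rewrite size_alpha.
have [ar arE] := arrow_path_of p1; exists ar => ar' e.
have : path_alpha p 1 = arrow_path ar'.
  apply: maximal_path_arrow => //; rewrite e.
  by move: arE => /(congr1 val) /= [e1 _]; rewrite -e1.
by rewrite arE => /(congr1 val) /= [_ ->].
Qed.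

Lemma skew_translate g c v : grouplike g -> skew_primitive 1 g c ->
  exists w, g * glv v = glv w /\ skew_primitive (glv v) (glv w) (c * glv v).
Proof.
move=> gg cD; have [w gw] := grouplike_glv (grouplikeM gg (glv_grouplike v)).
exists w; split=> //; rewrite /skew_primitive comulM cD comul_glv tmulgE_tmul.
by rewrite (linD (tmulg_linl _)) !tmulgE mul1r gw.
Qed.

Lemma mulr_glvI v : injective (fun c => c * glv v).
Proof.
move=> c c' e; have [_ vV] := antipode_grouplikeV (glv_grouplike v).
by rewrite -[c]mulr1 -[c']mulr1 -vV !mulrA e.
Qed.

(** Right translation turns nontrivial skew-primitive elements into arrows which
    start at a given vertex, and there is a vertex with only one such arrow. *)
Lemma skew_primitive_unique g g' c c' : grouplike g -> grouplike g' ->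
  nontrivial_skew_primitive 1 g c -> nontrivial_skew_primitive 1 g' c' ->
  g = g' /\ exists delta k : K, delta != 0 /\ c' = delta *: c + k *: (1 - g).
Proof.
move=> gg gg' [cD cn] [cD' cn'].
have some_arrow : exists ar : arrow Q, True.
  apply: contrapT => na; apply: cn.
  have [v _] := grouplike_glv grouplike1.
  have [w [gw sw]] := skew_translate v gg cD.
  have [q q0|k e] := skew_vertices sw.
    apply/eqP/negPn/negP => /(skew_coef sw) /(_ q0) [ar _]; apply: na.
    by exists ar.
  exists k; apply: (@mulr_glvI v).
  by rewrite e -gw -scalerAl mulrBl mul1r.
have [ar aru] := unique_arrow_somewhere some_arrow; set v := src ar in aru.
have key g0 c0 : grouplike g0 -> skew_primitive 1 g0 c0 ->
    ~ (exists k : K, c0 = k *: (1 - g0)) ->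
    g0 * glv v = glv (tgt ar) /\ pcoef (arrow_path ar) (c0 * glv v) != 0.
  move=> gg0 cD0 cn0; have [w [gw sw]] := skew_translate v gg0 cD0.
  have ac : pcoef (arrow_path ar) (c0 * glv v) != 0.
    apply/negP => /eqP ac; apply: cn0.
    have [q q0|k e] := skew_vertices sw.
      apply/eqP/negPn/negP => qc; have [ar' [qE s _]] := skew_coef sw qc q0.
      by case/eqP: qc; rewrite qE (aru _ s).
    by exists k; apply: (@mulr_glvI v); rewrite e -gw -scalerAl mulrBl mul1r.
  have [ar' [arE _ tE]] := skew_coef sw ac isT.
  have -> : ar = ar' by move: arE => /(congr1 val) /= [_ ->].
  by rewrite tE; split=> //; rewrite -arE.
have [gt ac] := key _ _ gg cD cn; have [gt' ac'] := key _ _ gg' cD' cn'.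
have eg : g = g' by apply: (@mulr_glvI v); rewrite gt gt'.
split=> //; subst g'.
set u := pcoef _ _ in ac; set u' := pcoef _ _ in ac'.
pose delta : K := u' / u.
have sk : skew_primitive 1 g (c' - delta *: c).
  rewrite /skew_primitive linearB linearZ /= cD cD' linearBl linearBr scalerDr.
  by rewrite opprD addrACA linearZl_LR linearZr_LR.
have [w [gw sw]] := skew_translate v gg sk.
have [q q0|k e] := skew_vertices sw.
  apply/eqP/negPn/negP => qc; have [ar' [qE s _]] := skew_coef sw qc q0.
  case/eqP: qc; rewrite qE (aru _ s) mulrBl (linB (pcoef_linear _)) -scalerAl.
  rewrite (linZ (pcoef_linear _)) -/u -/u' /delta [_ *: _]mulfVK //.
  exact: subrr.
exists delta, k; split; first by rewrite mulf_neq0 ?invr_eq0.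
apply: (@mulr_glvI v); rewrite mulrDl -[k *: _ * _]scalerAl mulrBl mul1r gw -e.
by rewrite mulrBl addrC subrK.
Qed.

End PathModel.

(** * The product of paths in top degree *)

Section ProductFormula.
Variables (K : fieldType) (H : hopfAlgebra K) (M : path_model H).
Variables (G : finGroupType) (iota : G -> H) (g : G) (chi : G -> K) (x : H).
Hypotheses (iota_inj : injective iota)
  (iotaP : forall c, grouplike c <-> exists h, c = iota h)
  (iota1 : iota 1%g = 1) (iotaM : {morph iota : h h' / (h * h')%g >-> h * h'})
  (gC : forall h, commute g h)
  (chi_neq0 : forall h, chi h != 0)
  (chiM : forall h h', chi (h * h')%g = chi h * chi h')
  (xP : nontrivial_skew_primitive 1 (iota g) x)
  (xh : forall h, x * iota h = chi h *: (iota h * x)).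
Local Notation Q := (pm_quiver M).
Local Notation P := (pm_path M).
Local Notation pel := (pm_elt M).
Local Notation glv := (@glv _ _ M).
Local Notation pcoef := (@pcoef _ _ M).
Local Notation r := (chi g)^-1.
Implicit Types (p q : qpath Q) (ar : arrow Q) (v : vertex Q) (h : G).

Lemma iota_grouplike h : grouplike (iota h).
Proof. by apply/iotaP; exists h. Qed.

Lemma vertex_group : exists (vg : vertex Q -> G) (gv : G -> vertex Q),
  [/\ cancel vg gv, cancel gv vg & forall v, glv v = iota (vg v)].
Proof.
have /choice[vg vgE] : forall v, exists h, glv v = iota h.
  by move=> v; apply/iotaP/glv_grouplike.
have /choice[gv gvE] : forall h, exists v, iota h = glv v.
  by move=> h; apply/grouplike_glv/iota_grouplike.
exists vg, gv; split=> // [v|h]; last by apply: iota_inj; rewrite -vgE gvE.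
by apply: (@glv_inj _ _ M); rewrite -gvE vgE.
Qed.

Lemma big_pair_deg1 (T : nat -> nat -> K) m n :
  (forall i j, (i <= m)%N -> (j <= n)%N -> (i + j)%N <> 1%N -> T i j = 0) ->
  \sum_(i < m.+1) \sum_(j < n.+1) T i j =
    (if (0 < m)%N then T 1%N 0%N else 0) + (if (0 < n)%N then T 0%N 1%N else 0).
Proof.
move=> T0; rewrite big_ord_recl addrC; congr (_ + _).
  case: m T0 => [|m] T0; first by rewrite big_ord0.
  rewrite big_ord_recl [X in _ + X]big1 => [|i _].
    rewrite addr0 big_ord_recl [X in _ + X]big1 ?addr0 // => j _.
    by apply: T0; rewrite //= /bump; have := ltn_ord j; lia.
  by rewrite big1 // => j _; apply: T0; rewrite //= /bump; have := ltn_ord i;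
    have := ltn_ord j; lia.
case: n T0 => [|n] T0; first by rewrite big_ord1 T0.
rewrite big_ord_recl T0 // add0r big_ord_recl [X in _ + X]big1 ?addr0 // => j _.
by apply: T0; rewrite //= /bump; have := ltn_ord j; lia.
Qed.

Variables (vg : vertex Q -> G) (gv : G -> vertex Q).
Hypotheses (vgK : cancel vg gv) (gvK : cancel gv vg) (glvE : forall v, glv v = iota (vg v)).

Lemma iotaVl h : iota h^-1%g * iota h = 1.
Proof. by rewrite -iotaM mulVg iota1. Qed.

Lemma iotaVr h : iota h * iota h^-1%g = 1.
Proof. by rewrite -iotaM mulgV iota1. Qed.

Lemma iota_glv h : iota h = glv (gv h).
Proof. by rewrite glvE gvK. Qed.

Lemma arrow_skew ar :
  skew_primitive (glv (src ar)) (glv (tgt ar)) (pel (arrow_path ar)).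
Proof.
rewrite /skew_primitive comul_pel; last exact: pm_arrow.
rewrite !big_ord_recl big_ord0 addr0 /= /bump /= beta0 alpha0.
have -> : path_beta (arrow_path ar) 1 = vertex_path (tgt ar) by apply: val_inj.
by have -> : path_alpha (arrow_path ar) 1 = arrow_path ar by apply: val_inj.
Qed.

Lemma pcoef_arrow ar ar' :
  pcoef (arrow_path ar) (pel (arrow_path ar')) = (ar' == ar)%:R.
Proof.
rewrite pcoef_pel; last exact: pm_arrow.
congr (_%:R); apply: congr1; apply/eqP/eqP => [/(congr1 val) /= [_ ->] //|->//].
Qed.

Lemma pcoef_arrow_glv ar v : pcoef (arrow_path ar) (glv v) = 0.
Proof. by rewrite pcoef_glv; case: eqP. Qed.

(** All arrows are translates of [x], up to scalars and trivial elements. *)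
Lemma arrow_elt ar : vg (tgt ar) = (g * vg (src ar))%g /\
  exists u k : K, u != 0 /\ pel (arrow_path ar) =
    u *: (x * glv (src ar)) + k *: (glv (src ar) - glv (tgt ar)).
Proof.
set v := src ar; set t := tgt ar.
have Par : P (arrow_path ar) by exact: pm_arrow.
pose c := pel (arrow_path ar) * iota (vg v)^-1%g.
have cK : c * glv v = pel (arrow_path ar).
  by rewrite /c glvE -mulrA iotaVl mulr1.
have tE : iota (vg t * (vg v)^-1)%g * glv v = glv t.
  by rewrite !glvE -iotaM mulgKV.
have cD : skew_primitive 1 (iota (vg t * (vg v)^-1)%g) c.
  rewrite /skew_primitive /c comulM (arrow_skew ar) tmulgE_tmul.
  rewrite (iota_grouplike _).1 (linD (tmulg_linl _)) !tmulgE.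
  by rewrite -/v -/t !glvE iotaVr iotaM.
have cn : ~ exists k : K, c = k *: (1 - iota (vg t * (vg v)^-1)%g).
  case=> k ck; have := pcoef_arrow ar ar.
  rewrite -cK ck -scalerAl (linZ (pcoef_linear _)) mulrBl mul1r tE eqxx.
  rewrite (linB (pcoef_linear _)) !pcoef_arrow_glv subrr scaler0.
  by move=> /(@natb_inj K false true).
have [eg [u [k [u0 ce]]]] := skew_primitive_unique M (iota_grouplike g)
  (iota_grouplike _) xP (conj cD cn).
split; first by rewrite (iota_inj eg) mulgKV.
exists u, k; split=> //; rewrite -cK ce mulrDl -!scalerAl mulrBl mul1r.
by rewrite eg tE.
Qed.

Lemma arrow_weight : exists w : arrow Q -> K, forall ar, w ar != 0 /\
  exists k : K, pel (arrow_path ar) =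
    w ar *: (x * glv (src ar)) + k *: (glv (src ar) - glv (tgt ar)).
Proof.
have /choice[w wE] : forall ar, exists u : K, u != 0 /\ exists k : K,
    pel (arrow_path ar) =
    u *: (x * glv (src ar)) + k *: (glv (src ar) - glv (tgt ar)).
  by move=> ar; have [_ [u [k [u0 e]]]] := arrow_elt ar; exists u; split=> //; exists k.
by exists w.
Qed.

Lemma arrow_tgt ar : tgt ar = gv (g * vg (src ar))%g.
Proof. by have [<- _] := arrow_elt ar; rewrite vgK. Qed.

Lemma arrow_src_inj ar ar' : src ar = src ar' -> ar = ar'.
Proof.
move=> e; have [w wE] := arrow_weight.
have [w0 [k eq]] := wE ar; have [w0' [k' eq']] := wE ar'.
have xE : x * glv (src ar') = (w ar)^-1 *: pel (arrow_path ar)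
    - ((w ar)^-1 * k) *: (glv (src ar) - glv (tgt ar)).
  by rewrite eq scalerDr !scalerA mulVf // scale1r addrK e.
have := pcoef_arrow ar' ar'; rewrite eqxx eq' xE.
rewrite (linD (pcoef_linear _)) !(linZ (pcoef_linear _)) !(linB (pcoef_linear _)).
rewrite !(linZ (pcoef_linear _)) (linB (pcoef_linear _)) !pcoef_arrow_glv pcoef_arrow.
rewrite !subrr !scaler0 subr0 addr0; case: eqP => // _.
by rewrite !scaler0 => /(@natb_inj K false true).
Qed.

Lemma arrow_exists v : exists ar, src ar = v.
Proof.
apply: contrapT => na; have [xD xn] := xP; apply: xn.
have [w [gw sw]] := skew_translate v (iota_grouplike g) xD.
have [q q0|k e] := skew_vertices sw.
  apply/eqP/negPn/negP => qc; have [ar [_ s _]] := skew_coef sw qc q0.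
  by apply: na; exists ar.
exists k; apply: (@mulr_glvI _ _ M v).
by rewrite e -gw -scalerAl mulrBl mul1r.
Qed.

Section Weights.
Variable w : arrow Q -> K.
Hypotheses (w_neq0 : forall ar, w ar != 0)
  (wE : forall ar, exists k : K, pel (arrow_path ar) =
    w ar *: (x * glv (src ar)) + k *: (glv (src ar) - glv (tgt ar))).

Lemma pcoef_x ar h :
  w ar * pcoef (arrow_path ar) (x * iota h) = (vg (src ar) == h)%:R.
Proof.
have [ar0 s0] := arrow_exists (gv h); have [k e] := wE ar0.
have -> : x * iota h = (w ar0)^-1 *: pel (arrow_path ar0)
    - ((w ar0)^-1 * k) *: (glv (src ar0) - glv (tgt ar0)).
  by rewrite e scalerDr !scalerA mulVf // scale1r addrK s0 -iota_glv.
rewrite (linB (pcoef_linear _)) !(linZ (pcoef_linear _)) (linB (pcoef_linear _)).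
rewrite !pcoef_arrow_glv subrr scaler0 subr0 pcoef_arrow.
have [<-|ne] := eqVneq ar0 ar; first by rewrite s0 gvK eqxx [_ *: _]mulr1 mulfV.
rewrite scaler0 mulr0; case: eqP => // e'; case/eqP: ne.
by apply: arrow_src_inj; rewrite s0 -e' vgK.
Qed.

Lemma pcoef_arrowM ar ar' h : w ar * pcoef (arrow_path ar) (pel (arrow_path ar') * iota h) =
  (vg (src ar) == vg (src ar') * h)%g%:R * w ar'.
Proof.
have [k ->] := wE ar'; rewrite mulrDl -!scalerAl mulrBl -mulrA !glvE -!iotaM !iota_glv.
rewrite (linD (pcoef_linear _)) !(linZ (pcoef_linear _)) (linB (pcoef_linear _)).
rewrite !pcoef_arrow_glv subrr scaler0 addr0 -iota_glv.
by rewrite [_ *: _]mulrC mulrA pcoef_x.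
Qed.

Lemma pcoef_Marrow ar ar' h : w ar * pcoef (arrow_path ar) (iota h * pel (arrow_path ar')) =
  (vg (src ar) == h * vg (src ar'))%g%:R * (chi h)^-1 * w ar'.
Proof.
have [k ->] := wE ar'; rewrite mulrDr -!scalerAr mulrBr mulrA.
have -> : iota h * x = (chi h)^-1 *: (x * iota h).
  by rewrite xh scalerA mulVf // scale1r.
rewrite -scalerAl -[x * _ * _]mulrA !glvE -!iotaM !iota_glv.
rewrite (linD (pcoef_linear _)) !(linZ (pcoef_linear _)) (linB (pcoef_linear _)).
rewrite !pcoef_arrow_glv subrr scaler0 addr0 -iota_glv.
rewrite -[in RHS]mulrA -pcoef_x; set X := pcoef _ _.
change (w ar * (w ar' * ((chi h)^-1 * X)) = w ar * X * ((chi h)^-1 * w ar')).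
by ring.
Qed.

Definition wt q : K := \prod_(ar <- (val q).2) w ar.

Lemma wt_neq0 q : wt q != 0.
Proof. by rewrite /wt; elim/big_ind: _ => [|a b|ar _]; [exact: oner_neq0|exact: mulf_neq0|]. Qed.

Lemma wt_split q i : wt q = wt (path_beta q i) * wt (path_alpha q i).
Proof. by rewrite mulrC /wt /= -big_cat cat_take_drop. Qed.

Lemma wt_arrow ar : wt (arrow_path ar) = w ar.
Proof. by rewrite /wt big_seq1. Qed.

Lemma wt_vertex q : qlength q = 0%N -> wt q = 1.
Proof. by move/vertex_path_of => ->; rewrite /wt big_nil. Qed.

Local Notation vs q := (vg (pstart q)).

Lemma first_arrow q : (0 < qlength q)%N ->
  exists ar, path_alpha q 1 = arrow_path ar /\ src ar = pstart q.
Proof.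
move=> q0; have q1 : qlength (path_alpha q 1) = 1%N by rewrite size_alpha.
have [ar arE] := arrow_path_of q1; exists ar; split=> //.
by move: arE => /(congr1 val) /= [<- _].
Qed.

Lemma vs_beta q : (0 < qlength q)%N -> vs (path_beta q 1) = (g * vs q)%g.
Proof.
move=> q0; have [ar [arE sq]] := first_arrow q0.
by rewrite -pend_alpha arE -[pend _]/(tgt ar) arrow_tgt gvK sq.
Qed.

(** The product of two paths in top degree. The first arrow of [q] comes either
    from [p] or from [p']; the two cases yield the two terms of the Pascal rule
    for [qbinom]. *)
Lemma pcoef_top_mul n p p' q : P p -> P p' ->
  (qlength p + qlength p')%N = n -> qlength q = n ->
  wt q * pcoef q (pel p * pel p') =
  (vs q == vs p * vs p')%g%:R * (chi (vs p))^-1 ^+ qlength p' *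
    qbinom r n (qlength p') * wt p * wt p'.
Proof.
elim: n p p' q => [|n IH] p p' q Pp Pp' pn qn.
  have [p0 p'0] : qlength p = 0%N /\ qlength p' = 0%N by lia.
  rewrite !wt_vertex // p'0 expr0 qbinom0 !mulr1 mul1r.
  rewrite {1}(vertex_path_of p0) {1}(vertex_path_of p'0) {1}(vertex_path_of qn).
  rewrite -!/(glv _) !glvE -iotaM iota_glv pcoef_glv vertex_path_eq.
  by rewrite -(inj_eq (can_inj vgK)) gvK eq_sym.
have q0 : (0 < qlength q)%N by rewrite qn.
have [ar [arE sq]] := first_arrow q0.
rewrite -(@pcoef_cat _ _ _ q 1) // (wt_split q 1) arE wt_arrow pcoef2_pelM //.
have bn : qlength (path_beta q 1) = n by rewrite size_beta qn subn1.
set b := path_beta q 1 in bn *.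
pose T i j : K := pcoef b (pel (path_beta p i) * pel (path_beta p' j)) *
    pcoef (arrow_path ar) (pel (path_alpha p i) * pel (path_alpha p' j)).
rewrite -[X in _ * X]/(\sum_(i < _) \sum_(j < _) T i j).
rewrite (@big_pair_deg1 T) => [|i j ip jp ij]; last first.
  rewrite /T; have [Pb Pa] := pm_sub Pp ip; have [Pb' Pa'] := pm_sub Pp' jp.
  have [ij0|ij0] := posnP (i + j)%N.
    have [-> ->] : i = 0%N /\ j = 0%N by lia.
    by rewrite !alpha0 -!/(glv _) !glvE -iotaM iota_glv pcoef_arrow_glv mulr0.
  by rewrite (filt_pelM Pb Pb') ?mul0r // bn !size_beta; lia.
rewrite mulrDr.
have bq : vs b = (g * vs q)%g by rewrite /b vs_beta.
have X1 : wt b * w ar * (if (0 < qlength p)%N then T 1%N 0%N else 0) =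
    (vs q == vs p * vs p')%g%:R * (chi (vs p))^-1 ^+ qlength p' *
    (r ^+ qlength p' * qbinom r n (qlength p')) * wt p * wt p'.
  case: posnP => [p0|p0].
    by rewrite qbinom_small ?mulr0 ?mul0r //; lia.
  have [Pb Pa] := pm_sub Pp p0.
  have [ar1 [ar1E sp]] := first_arrow p0.
  have e1 : qlength (path_beta p 1) = (qlength p - 1)%N by rewrite size_beta.
  have := IH (path_beta p 1) p' b Pb Pp' _ bn; rewrite e1 => IHb.
  rewrite /T beta0 alpha0 ar1E -/(glv _) glvE.
  rewrite mulrACA IHb; last by lia.
  rewrite pcoef_arrowM sq sp bq vs_beta // -mulgA (inj_eq (mulgI g)).
  rewrite (wt_split p 1) ar1E wt_arrow chiM invfM exprMn.
  by case: eqP => _; rewrite ?mulr1n ?mulr0n ?mul0r //; ring.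
have X2 : wt b * w ar * (if (0 < qlength p')%N then T 0%N 1%N else 0) =
    (vs q == vs p * vs p')%g%:R * (chi (vs p))^-1 ^+ qlength p' *
    (if (0 < qlength p')%N then qbinom r n (qlength p').-1 else 0) * wt p * wt p'.
  case: posnP => [p0|p0]; first by rewrite !mulr0 !mul0r.
  have [Pb Pa] := pm_sub Pp' p0.
  have [ar1 [ar1E sp]] := first_arrow p0.
  have e1 : qlength (path_beta p' 1) = (qlength p').-1 by rewrite size_beta subn1.
  have := IH p (path_beta p' 1) b Pp Pb _ bn; rewrite e1 => IHb.
  rewrite /T beta0 alpha0 ar1E -/(glv _) glvE.
  rewrite mulrACA IHb; last by lia.
  rewrite pcoef_Marrow sq sp bq vs_beta // mulgA -(gC (vs p)) -mulgA (inj_eq (mulgI g)).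
  rewrite (wt_split p' 1) ar1E wt_arrow -[in RHS](prednK p0) exprS.
  by case: eqP => _; rewrite ?mulr1n ?mulr0n ?mul0r //; ring.
have -> : qbinom r n.+1 (qlength p') = r ^+ qlength p' * qbinom r n (qlength p') +
    (if (0 < qlength p')%N then qbinom r n (qlength p').-1 else 0).
  case: (qlength p') => [|m]; first by rewrite !qbinom0 expr0 mul1r addr0.
  by rewrite qbinomS addrC.
by rewrite X1 X2 mulrDr !mulrDl.
Qed.

Lemma path_exists v n : exists q, pstart q = v /\ qlength q = n.
Proof.
elim: n v => [|n IH] v; first by exists (vertex_path v).
have [ar sv] := arrow_exists v; have [q [qs qn]] := IH (tgt ar).
have e : pend (arrow_path ar) = pstart q by rewrite qs.
have [q' [ql qa qb]] := qcat_exists e; exists q'; split.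
  rewrite -sv; have := congr1 (@pstart _) qa; exact.
by rewrite ql qn.
Qed.

Lemma path_unique q q' : pstart q = pstart q' -> qlength q = qlength q' -> q = q'.
Proof.
elim: (qlength q) {-2}q (erefl (qlength q)) q' => [|n IH] {}q qn q' s; rewrite qn => /esym q'n.
  by rewrite (vertex_path_of qn) (vertex_path_of q'n) s.
have [ar [arE sq]] := @first_arrow q ltac:(by rewrite qn).
have [ar' [arE' sq']] := @first_arrow q' ltac:(by rewrite q'n).
have ea : ar = ar' by apply: arrow_src_inj; rewrite sq sq'.
have e1 : path_alpha q 1 = path_alpha q' 1 by rewrite arE arE' ea.
apply: (alpha_beta_inj e1); apply: IH.
- by rewrite size_beta qn subn1.
- by rewrite -!pend_alpha e1.
- by rewrite !size_beta qn q'n.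
Qed.

(** If there were a path of length [d], then its product with a longest path, of
    length [N], would have the top coefficient [qbinom r (N + d) d], which is
    not zero in characteristic 0. But no path has length [N + d]. *)
Lemma path_length_lt d p : [pchar K] =i pred0 -> d.-primitive_root r -> P p ->
  (qlength p < d)%N.
Proof.
move=> /pcharf0P c0 rd Pp; rewrite ltnNge; apply/negP => dp.
have [ar _] := arrow_exists (gv 1%g).
have [pm [Pm pm0 pmax]] : exists pm, [/\ P pm, (0 < qlength pm)%N &
    forall p', P p' -> (qlength p' <= qlength pm)%N].
  by apply: maximal_path; exists ar.
have [_ Pd] := pm_sub Pp dp.
have dl : qlength (path_alpha p d) = d by rewrite size_alpha.
have [q [qs qn]] := path_exists (gv (vg (pstart pm) * vg (pstart (path_alpha p d))))%g
  (qlength pm + d)%N.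
have nq : pcoef q (pel pm * pel (path_alpha p d)) = 0.
  apply/eqP/negPn/negP => /pcoef_supp /pmax; rewrite qn -[X in (_ <= X)%N]addn0.
  by rewrite leq_add2l leqn0 gtn_eqF // (prim_order_gt0 rd).
have := @pcoef_top_mul (qlength pm + d)%N pm (path_alpha p d) q Pm Pd _ qn.
rewrite dl nq qs gvK eqxx mulr0 => /(_ erefl) /esym/eqP.
rewrite mul1r !mulf_eq0 !(negPf (wt_neq0 _)) !orbF expf_eq0 invr_eq0.
rewrite (negPf (chi_neq0 _)) andbF /= (qbinom_divn rd) c0 -leqn0 leqNgt.
by rewrite divn_gt0 ?(prim_order_gt0 rd) // leq_addl.
Qed.

Lemma chi1 : chi 1%g = 1.
Proof. by apply: (mulfI (chi_neq0 1%g)); rewrite -chiM mulg1 mulr1. Qed.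

Lemma x_arrow : exists (ar : arrow Q) (u : K), src ar = gv 1%g /\
  x = (w ar)^-1 *: pel (arrow_path ar) - u *: (glv (src ar) - glv (tgt ar)).
Proof.
have [ar sr] := arrow_exists (gv 1%g); have [k e] := wE ar.
exists ar, ((w ar)^-1 * k); split=> //; rewrite e scalerDr !scalerA mulVf //.
by rewrite scale1r addrK sr -iota_glv iota1 mulr1.
Qed.

Lemma filt_x : filt M 1 x.
Proof.
have [ar [u [_ ->]]] := x_arrow; apply: filtD.
  apply/filtZ/(filt_pel (p := arrow_path ar)); exact: pm_arrow.
rewrite -scaleNr; apply/filtZ/filtD; first exact/(filt_leq (leq0n 1))/filt_glv.
by rewrite -scaleN1r; apply/filtZ/(filt_leq (leq0n 1))/filt_glv.
Qed.

Lemma pcoef_x_mul n p q : P p -> qlength p = n -> qlength q = n.+1 ->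
  wt q * pcoef q (x * pel p) = (vs q == vs p)%:R * qint r n.+1 * wt p.
Proof.
move=> Pp pn qn; have [ar [u [sr ->]]] := x_arrow.
rewrite mulrBl -!scalerAl (linB (pcoef_linear _)) !(linZ (pcoef_linear _)).
have -> : pcoef q ((glv (src ar) - glv (tgt ar)) * pel p) = 0.
  rewrite mulrBl (linB (pcoef_linear _)) (filtM (filt_glv _) (filt_pel Pp)).
    by rewrite (filtM (filt_glv _) (filt_pel Pp)) ?subrr // pn qn.
  by rewrite pn qn.
rewrite scaler0 subr0; have Par : P (arrow_path ar) by exact: pm_arrow.
have := @pcoef_top_mul n.+1 _ _ q Par Pp _ qn; rewrite pn add1n => /(_ erefl) e.
rewrite [_ *: _]mulrC mulrA e -[pstart (arrow_path ar)]/(src ar) sr gvK mul1g chi1.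
rewrite invr1 expr1n qbinomS1 wt_arrow mulr1.
by field; apply: w_neq0.
Qed.

Lemma x_mul_low n z : (forall q, (n <= qlength q)%N -> pcoef q z = 0) ->
  forall q, (n < qlength q)%N -> pcoef q (x * z) = 0.
Proof.
case: n => [|n] z0 q nq; last by apply: (filtM filt_x (n := n) _ nq) => q'; apply: z0.
have -> : z = 0.
  by apply: (@pcoef_inj _ _ M) => q'; rewrite z0 // (lin0 (pcoef_linear _)).
by rewrite mulr0 (lin0 (pcoef_linear _)).
Qed.

(** Each multiplication by [x] lengthens a path by one arrow, with a nonzero
    multiple of [qint r n.+1] as coefficient; this is not zero as long as
    [n.+1 < d]. *)
Lemma pow_top d n h : d.-primitive_root r -> (n < d)%N ->
  exists q (u : K), [/\ P q, pstart q = gv h, qlength q = n, u != 0 &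
    forall q', (n <= qlength q')%N -> pcoef q' (x ^+ n * iota h) = u * (q == q')%:R].
Proof.
move=> rd; elim: n => [|n IH] nd.
  exists (vertex_path (gv h)), 1; split=> //; first exact: pm_vertex.
    exact: oner_neq0.
  by move=> q' _; rewrite mul1r expr0 mul1r iota_glv pcoef_glv.
have [q [u [Pq qs qn u0 qE]]] := IH (ltnW nd).
have [q2 [q2s q2n]] := path_exists (gv h) n.+1.
pose z := x ^+ n * iota h - u *: pel q.
have z0 q' : (n <= qlength q')%N -> pcoef q' z = 0.
  move=> nq; rewrite /z (linB (pcoef_linear _)) (linZ (pcoef_linear _)) qE //.
  by rewrite pcoef_pel // subrr.
have xz := x_mul_low z0.
have xE : x ^+ n.+1 * iota h = u *: (x * pel q) + x * z.
  by rewrite exprS -mulrA scalerAr -mulrDr /z addrC subrK.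
pose u2 := pcoef q2 (x * pel q).
have u20 : u2 != 0.
  have := pcoef_x_mul Pq qn q2n; rewrite q2s qs eqxx mulr1n mul1r => e.
  apply/eqP => u20; move/eqP: e; rewrite -/u2 u20 mulr0 eq_sym mulf_eq0.
  by rewrite (negPf (wt_neq0 _)) orbF (negPf (qint_prim_neq0 rd _)).
exists q2, (u * u2); split=> //.
- exact: pcoef_supp u20.
- by rewrite mulf_neq0.
move=> q' nq; rewrite xE (linD (pcoef_linear _)) (linZ (pcoef_linear _)) xz // addr0.
case: (q2 =P q') => [<-|ne]; first by rewrite mulr1.
rewrite mulr0; move: nq; rewrite leq_eqVlt => /orP[/eqP nq|nq]; last first.
  have -> : pcoef q' (x * pel q) = 0.
    by apply: (filtM filt_x (filt_pel Pq)); rewrite qn add1n.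
  by rewrite scaler0.
have := pcoef_x_mul Pq qn (esym nq); case: eqP => [e|_].
  case: ne; apply: path_unique; last by rewrite q2n.
  by apply: (can_inj vgK); rewrite e q2s qs.
move/eqP; rewrite mulr0n !mul0r mulf_eq0 (negPf (wt_neq0 _)) /= => /eqP ->.
by rewrite scaler0.
Qed.

End Weights.

Lemma path_length_bound d p : [pchar K] =i pred0 -> d.-primitive_root r -> P p ->
  (qlength p < d)%N.
Proof.
move=> c0 rd Pp; have [w ww] := arrow_weight.
by apply: (@path_length_lt w _ _ d p) => // ar; case: (ww ar).
Qed.

Lemma power_triangular d n h : d.-primitive_root r -> (n < d)%N ->
  exists q (u : K), [/\ P q, pstart q = gv h, qlength q = n, u != 0 &
    forall q', (n <= qlength q')%N -> pcoef q' (x ^+ n * iota h) = u * (q == q')%:R].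
Proof.
move=> rd nd; have [w ww] := arrow_weight.
by apply: (@pow_top w _ _ d n h) => // ar; case: (ww ar).
Qed.

End ProductFormula.

(** * Presentation by the induced datum *)

Section InducedDatum.
Variables (K : fieldType) (C : hopfAlgebra K) (alpha : group_datum K).
Local Notation G := (gd_group alpha).
Local Notation g := (gd_g alpha).
Local Notation chi := (@gd_chi K alpha).
Local Notation mu := (gd_mu alpha).
Local Notation d := (gd_d alpha).
Variables (iota : G -> C) (x : C).
Hypotheses (iota_inj : injective iota)
  (iotaP : forall c, grouplike c <-> exists h, c = iota h)
  (xP : nontrivial_skew_primitive 1 (iota g) x)
  (rel : datum_relations x iota).

Let iota1 : iota 1%g = 1. Proof. by case: rel. Qed.
Let iotaM : {morph iota : h h' / (h * h')%g >-> h * h'}. Proof. by case: rel. Qed.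
Let xh h : x * iota h = chi h *: (iota h * x). Proof. by case: rel. Qed.

(** For [d = 1] the relation for [x ^+ d] says that [x] is trivial. *)
Lemma induced_nontrivial : nontrivial_datum alpha.
Proof.
move=> chig; have d1 : d = 1%N.
  apply/eqP; rewrite -dvdn1; have := prim_order_dvd (gd_chi_prim alpha) 1.
  by rewrite chig expr1n eqxx.
case: rel => _ _ xd _; case: xP => _; apply; exists mu.
by move: xd; rewrite d1 !expr1.
Qed.

(** The monomials [x ^+ n * iota h] are triangular with respect to the basis of
    paths: all paths are shorter than [d], and a path is determined by its
    source [h] and its length [n]. *)
Lemma induced_pbw (M : path_model C) : [pchar K] =i pred0 -> datum_pbw x iota.
Proof.
move=> c0; split=> //; have rd := gd_chiV_prim alpha.
have [vg [gv [vgK gvK glvE]]] := vertex_group M iota_inj iotaP.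
have bound p : pm_path M p -> (qlength p < d)%N.
  apply: (path_length_bound iota_inj iotaP iota1 iotaM (@gd_gC _ alpha)
    (@gd_chi_neq0 _ alpha) (@gd_chiM _ alpha) xP xh vgK gvK glvE c0 rd).
have tri n h : (n < d)%N -> exists q (u : K),
    [/\ pm_path M q, pstart q = gv h, qlength q = n, u != 0 &
    forall q', (n <= qlength q')%N -> pcoef q' (x ^+ n * iota h) = u * (q == q')%:R].
  move=> nd; apply: (power_triangular iota_inj iotaP iota1 iotaM (@gd_gC _ alpha)
    (@gd_chi_neq0 _ alpha) (@gd_chiM _ alpha) xP xh vgK gvK glvE h rd nd).
have uniq (q q' : qpath (pm_quiver M)) : pstart q = pstart q' -> qlength q = qlength q' -> q = q'.
  exact: (path_unique iota_inj iotaP iota1 iotaM xP glvE).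
set f := datum_lift x iota; have lf : linear f by exact: datum_lift_linear.
have ld (p : 'I_d.-1.+1 * G) : (p.1 < d)%N.
  by have := ltn_ord p.1; have := gd_d_gt0 alpha; lia.
have finj : injective f.
  suff ker a : f a = 0 -> a = 0.
    by move=> a b e; apply/eqP; rewrite -subr_eq0; apply/eqP/ker;
      rewrite (linB lf) e subrr.
  move=> fa; suff top m : forall p : 'I_d.-1.+1 * G, (d <= p.1 + m)%N -> a p = 0.
    by apply/ffunP => p; rewrite (top d) ?leq_addl // ffunE.
  elim: m => [|m IH] p pd.
    by have := ld p; move: pd; rewrite addn0 leqNgt => /negP.
  have pd1 := ld p.
  have [q [u [Pq qs qn u0 qE]]] := tri p.1 p.2 pd1.
  have : pcoef q (f a) = 0 by rewrite fa (lin0 (pcoef_linear _)).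
  rewrite {1}[a]datum_alg_sum (lin_sum lf) (lin_sum (pcoef_linear _)) (bigD1 p) //=.
  rewrite big1 => [|p' p'p].
    rewrite (linZ lf) (linZ (pcoef_linear _)) /f datum_lift_pbw // qE ?qn // eqxx addr0.
    by rewrite mulr1 => /eqP; rewrite scaler_eq0 (negPf u0) orbF => /eqP.
  rewrite (linZ lf) (linZ (pcoef_linear _)).
  have pd' := ld p'.
  have [pp|pp] := ltnP p.1 p'.1; first by rewrite (IH p') ?scale0r //; lia.
  have [q' [u' [Pq' qs' qn' u0' qE']]] := tri p'.1 p'.2 pd'.
  rewrite /f datum_lift_pbw // qE' ?qn //; case: eqP => [e|_]; last first.
    by rewrite mulr0 scaler0.
  case/eqP: p'p; case: p p' pd pd1 qs qn pd' qs' qn' {qE qE' IH pp} => [i h] [i' h'] /=.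
  move=> _ _ qs qn _ qs' qn'.
  have -> : i' = i by apply: val_inj; rewrite /= -qn -qn' e.
  by congr (_, _); apply: (can_inj gvK); rewrite -qs -qs' e.
have fsurj c : exists a, f a = c.
  suff top n : forall c, (forall q, (n <= qlength q)%N -> pcoef (M := M) q c = 0) ->
      exists a, f a = c.
    by apply: (top d) => q dq; apply/eqP/negPn/negP => /pcoef_supp /bound; lia.
  elim: n => {c} [|n IH] c cn.
    exists 0; rewrite (lin0 lf); apply: (@pcoef_inj _ _ M) => q.
    by rewrite cn // (lin0 (pcoef_linear _)).
  have im p : pm_path M p -> pcoef p c != 0 -> exists a, f a = pm_elt M p.
    move=> Pp pc; have pn : (qlength p <= n)%N.
      by rewrite leqNgt; apply: contraNN pc => /cn ->.
    move: pn; rewrite leq_eqVlt => /orP[/eqP pn|pn]; last first.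
      apply: IH => q nq; rewrite pcoef_pel //; case: eqP => // e; rewrite e in pn; lia.
    have [q [u [Pq qs qn u0 qE]]] := tri n (vg (pstart p)) ltac:(by rewrite -pn bound).
    have qp : q = p by apply: uniq; rewrite ?qs ?vgK // qn pn.
    have [b fb] : exists b, f b = x ^+ n * iota (vg (pstart p)) - u *: pm_elt M p.
      apply: IH => q' nq'; rewrite (linB (pcoef_linear _)) (linZ (pcoef_linear _)).
      by rewrite qE // pcoef_pel // qp subrr.
    exists (u^-1 *: (pbw n (vg (pstart p)) - b)).
    rewrite (linZ lf) (linB lf) fb /f datum_lift_pbw; last by rewrite -pn bound.
    by rewrite subKr scalerA mulVf // scale1r.
  have /choice[ip ipE] : forall p, exists a,
      pm_path M p -> pcoef p c != 0 -> f a = pm_elt M p.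
    move=> p; have [[Pp pc]|np] := pselect (pm_path M p /\ pcoef p c != 0).
      by have [a fa] := im p Pp pc; exists a.
    by exists 0 => Pp pc; case: np.
  exists (\sum_(p <- msupp (pm_phi M c)) pcoef p c *: ip p).
  rewrite (lin_sum lf) [RHS](pel_sum M) [LHS]big_seq [RHS]big_seq.
  apply: eq_bigr => p; rewrite -mcoeff_neq0 => pc; rewrite (linZ lf); congr (_ *: _).
  by apply: ipE => //; apply: pcoef_supp pc.
have [f' f'K] := choice fsurj.
by exists f' => // a; apply: finj.
Qed.

Lemma induced_is_datum_hopf (M : path_model C) : [pchar K] =i pred0 ->
  is_datum_hopf alpha C.
Proof.
move=> c0; have pb := induced_pbw M c0; exists iota, x.
have gl h : grouplike (iota h) by apply/iotaP; exists h.
have lS : linear (@antipode K C) by exact: linearP.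
have Sh h : antipode (iota h) = iota h^-1%g.
  have [Sl _] := antipode_grouplikeV (gl h).
  by rewrite -[LHS]mulr1 -iota1 -(mulgV h) iotaM mulrA Sl mul1r.
have lce : linear (counit : C -> K^o) by exact: linearP.
have bl := scale_bilinear C lce.
have ex : counit x = 0.
  have := counitl x; rewrite xP.1 (linD (tlift_linear bl)) !(tlift_tensE bl).2.
  rewrite (gl g).2 scale1r => /eqP; rewrite -subr_eq0 addrK => /eqP e.
  apply/eqP; have /eqP := e; rewrite scaler_eq0 => /orP[//|].
  by rewrite oner_eq0.
split=> //.
- exact: pbw_universal.
- split=> //; first by rewrite xP.1 addrC.
  have b1 := mul_bilinear lS (@id_linear _ C).
  have := antipodel x; rewrite xP.1 (linD (tlift_linear b1)) !(tlift_tensE b1).2.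
  by rewrite ex scale0r mulr1 Sh => /eqP; rewrite addr_eq0 => /eqP.
- by move=> h; have [] := gl h.
Qed.

End InducedDatum.

(** * Path models of the Hopf algebra of a datum *)

Section ModelMonomial.
Variables (K : fieldType) (H : hopfAlgebra K) (M : path_model H).
Local Notation Q := (pm_quiver M).
Local Notation D := (path_span (K := K) (pm_path M)).

Lemma path_span_elt p : pm_path M p -> D (path_elt K p).
Proof.
move=> Pp q; rewrite -mcoeff_neq0 path_eltE.
by case: (p =P q) => [<-|] //; rewrite eqxx.
Qed.

Definition tensor_span (t : tensor (path_space Q K) (path_space Q K)) : Prop :=
  exists s : seq (path_space Q K * path_space Q K),
    (forall p, p \in s -> D p.1 /\ D p.2) /\ t = \sum_(p <- s) p.1 \ox p.2.

Lemma path_spanZ k f : D f -> D (k *: f).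
Proof.
move=> Df p; rewrite -mcoeff_neq0 mcoeffZ mulf_eq0 negb_or mcoeff_neq0.
by case/andP => _; apply: Df.
Qed.

Lemma path_span_lin k f f' : D f -> D f' -> D (k *: f + f').
Proof.
move=> Df Df' p; rewrite -mcoeff_neq0 mcoeffD mcoeffZ.
have [/Df //|/mcoeff_outdom ->] := boolP (p \in msupp f).
by rewrite mulr0 add0r mcoeff_neq0; apply: Df'.
Qed.

Lemma tensor_span_lin k t t' : tensor_span t -> tensor_span t' -> tensor_span (k *: t + t').
Proof.
case=> s [sD ->] [s' [sD' ->]]; exists ([seq (k *: p.1, p.2) | p <- s] ++ s'); split.
  move=> p; rewrite mem_cat => /orP[/mapP[q qs ->]|]; last exact: sD'.
  by have [D1 D2] := sD _ qs; split=> //; apply: path_spanZ.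
rewrite big_cat big_map scaler_sumr; congr (_ + _); apply: eq_bigr => p _.
by rewrite linearZl_LR.
Qed.

(** The converse of [monomial_model]. *)
Lemma model_monomial : monomial_hopf H.
Proof.
have le := path_ext_linear (pm_elt M).
exists Q, D, (pm_phi M); split.
- split.
  + split=> [p|k f f'|f Df].
    * by rewrite -mcoeff_neq0 mcoeff0 eqxx.
    * exact: path_span_lin.
    have t0 : tensor_span 0 by exists [::]; rewrite big_nil.
    suff: tensor_span (path_comul f) by [].
    rewrite /path_comul big_seq; apply: (big_ind tensor_span) => //.
      by move=> t t' ht ht'; rewrite -[t]scale1r; apply: tensor_span_lin.
    move=> p /Df Pp; rewrite -[_ *: _]addr0; apply: tensor_span_lin => //.
    rewrite /path_comul1; apply: (big_ind tensor_span) => //.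
      by move=> t t' ht ht'; rewrite -[t]scale1r; apply: tensor_span_lin.
    move=> i _; have ip : (i <= qlength p)%N by rewrite -ltnS.
    have [Pb Pa] := pm_sub Pp ip.
    exists [:: (path_elt K (path_beta p i), path_elt K (path_alpha p i))].
    rewrite big_seq1; split=> // q; rewrite inE => /eqP ->.
    by split; apply: path_span_elt.
  + by move=> v; apply/path_span_elt/pm_vertex.
  + by move=> a; apply/path_span_elt/pm_arrow.
  + exists (maxn 2 (pm_bound M)); first exact: leq_maxl.
    move=> f Df p /Df /pm_boundP; have := leq_maxr 2 (pm_bound M).
    by set m := maxn _ _; lia.
  + by exists (pm_path M).
- exact: pm_inj.
- move=> f; split=> [Df|[c ->]]; last exact: pm_supp.
  exists (path_ext (pm_elt M) f); rewrite {1}[f]monalgE /path_ext linear_sum.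
  rewrite [LHS]big_seq [RHS]big_seq; apply: eq_bigr => p /Df Pp.
  by rewrite linearZ /= (pm_phi_elt M) // -path_elt_scale.
- exact: pm_comul.
- exact: pm_counit.
Qed.

End ModelMonomial.

Lemma scale_tens_eq (K : fieldType) (U V : lmodType K) (a b k k' : K) (u : U) (v : V) :
  a = b * (k * k') -> a *: (u \ox v) = b *: ((k *: u) \ox (k' *: v)).
Proof. by move=> ->; rewrite tensZZ scalerA. Qed.

Section DatumModel.
Variables (K : fieldType) (alpha : group_datum K) (H : hopfAlgebra K).
Local Notation G := (gd_group alpha).
Local Notation g := (gd_g alpha).
Local Notation chi := (@gd_chi K alpha).
Local Notation d := (gd_d alpha).
Local Notation r := (chi g)^-1.

Definition datum_quiver : quiver := @Quiver G G id (mulg g).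
Local Notation Q := datum_quiver.

Lemma walk_traject (h : vertex Q) n : walk h (traject (mulg g) h n : seq (arrow Q)).
Proof. by elim: n h => //= n IH h; rewrite eqxx IH. Qed.

(** The quiver is a disjoint union of cycles, so that a path is determined by
    its source and its length. *)
Definition cycle_path n (h : G) : qpath Q := exist _ (h : vertex Q, _) (walk_traject h n).

Lemma qlength_cycle_path n h : qlength (cycle_path n h) = n.
Proof. by rewrite /qlength /= size_traject. Qed.

Lemma cycle_pathE (p : qpath Q) : p = cycle_path (qlength p) (pstart p).
Proof.
apply: val_inj; case: p => [[v s] /= w]; rewrite /qlength /pstart /=; congr (_, _).
by elim: s v w => //= a s IH v /andP[/eqP <- /IH {1}->].
Qed.

Lemma cycle_path_inj n h n' h' : cycle_path n h = cycle_path n' h' -> n = n' /\ h = h'.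
Proof.
by move=> e; split; [have := congr1 (@qlength _) e; rewrite !qlength_cycle_path
  |have := congr1 (@pstart _) e].
Qed.

Lemma alpha_cycle_path n h i : (i <= n)%N -> path_alpha (cycle_path n h) i = cycle_path i h.
Proof.
by move=> ni; rewrite [LHS]cycle_pathE size_alpha ?qlength_cycle_path.
Qed.

Lemma pend_cycle_path n h : pend (cycle_path n h) = (g ^+ n * h)%g :> G.
Proof.
rewrite /pend /=; elim: n h => [|n IH] h /=; first by rewrite mul1g.
by rewrite IH mulgA -expgSr.
Qed.

Lemma beta_cycle_path n h i : (i <= n)%N ->
  path_beta (cycle_path n h) i = cycle_path (n - i) (g ^+ i * h)%g.
Proof.
move=> ni; rewrite [LHS]cycle_pathE size_beta qlength_cycle_path; congr cycle_path.
by rewrite -pend_alpha alpha_cycle_path // pend_cycle_path.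
Qed.

Variables (iota : G -> H) (x : H).
Hypotheses (nt : nontrivial_datum alpha) (rel : datum_relations x iota)
  (univ : datum_universal x iota)
  (xD : comul x = iota g \ox x + x \ox 1) (xe : counit x = 0)
  (hD : forall h, comul (iota h) = iota h \ox iota h)
  (he : forall h, counit (iota h) = 1).

Let iota1 : iota 1%g = 1. Proof. by case: rel. Qed.
Let iotaM : {morph iota : h h' / (h * h')%g >-> h * h'}. Proof. by case: rel. Qed.
Let xh h : x * iota h = chi h *: (iota h * x). Proof. by case: rel. Qed.
Let pb : datum_pbw x iota. Proof. exact: universal_pbw. Qed.
Let f : datum_alg alpha -> H := datum_lift x iota.
Let lf : linear f. Proof. exact: datum_lift_linear. Qed.
Let rd : d.-primitive_root r. Proof. exact: gd_chiV_prim. Qed.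

Lemma comul_pow n h : comul (x ^+ n * iota h) =
  \sum_(k < n.+1) qbinom r n k *:
    ((x ^+ k * iota (g ^+ (n - k) * h)%g) \ox (x ^+ (n - k) * iota h)).
Proof.
have lce : linear (counit : H -> K^o) by exact: linearP.
pose A := Augmented lce (counit1 H).
pose a : tensor_alg A A := x \ox 1; pose b : tensor_alg A A := iota g \ox x.
have ba : b * a = r *: (a * b).
  rewrite /a /b !tensor_algM mul1r mulr1 xh linearZl_LR scalerA mulVf ?scale1r //.
  exact: gd_chi_neq0.
have Dn : comul (x ^+ n) = (a + b) ^+ n :> tensor_alg A A.
  elim: n => [|n IH]; first by rewrite !expr0 comul1.
  by rewrite !exprS comulM IH xD addrC.
rewrite comulM Dn (exprD_qcomm _ ba) hD tmulgE_tmul.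
rewrite (lin_sum (@tmulg_linl _ H H _)); apply: eq_bigr => k _.
rewrite (linZ (@tmulg_linl _ H H _)) /a /b !tensor_algX tensor_algM expr1n mul1r.
by rewrite [tmulg _ _]tmulgE -(morph_mulgX iota1 iotaM) -mulrA -iotaM.
Qed.

Lemma counit_pow n h : counit (x ^+ n * iota h) = (n == 0%N)%:R.
Proof.
rewrite counitM he mulr1; case: n => [|n]; first by rewrite expr0 counit1.
by rewrite exprS counitM xe mul0r.
Qed.

(** Up to the factor [qfact r n], the element [x ^+ n * h] is the path of length
    [n] starting at [h]: in its coproduct [comul_pow] the coefficient
    [qbinom r n k] is [qfact r n / (qfact r k * qfact r (n - k))]. *)
Definition cycle_path_sum : datum_alg alpha -> path_space Q K :=
  pbw_ext (fun n h => qfact r n *: path_elt K (cycle_path n h)).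

Lemma cycle_path_sum_coef a n h (nd : (n < d.-1.+1)%N) :
  (cycle_path_sum a)@_(cycle_path n h) = a (Ordinal nd, h) * qfact r n.
Proof.
pose F (u : path_space Q K) : K^o := u@_(cycle_path n h).
have lF : linear F by exact: mcoeff_linear.
have FE k p : F (k *: path_elt K p) = k * (p == cycle_path n h)%:R.
  exact: mcoeff_scale_elt.
rewrite -[LHS]/(F (cycle_path_sum a)) /cycle_path_sum /pbw_ext (lin_sum lF).
rewrite (bigD1 (Ordinal nd, h)) //= big1 => [|p pn].
  by rewrite addr0 scalerA FE eqxx mulr1.
rewrite scalerA FE; case: eqP => [/cycle_path_inj[e1 e2]|_]; last by rewrite mulr0.
case/eqP: pn; case: p e1 e2 => [i h'] /= e1 ->; congr (_, _); exact: val_inj.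
Qed.

Lemma datum_model : exists M : path_model H,
  forall v : vertex (pm_quiver M), exists h, glv v = iota h.
Proof.
have [f' fK f'K] : bijective f by case: pb.
have finj : injective f := can_inj fK.
have lf' : linear f' by move=> k a b; apply: finj; rewrite lf !f'K.
have ls : linear cycle_path_sum by exact: pbw_ext_linear.
have [phi phiE] : exists phi : {linear H -> path_space Q K}, phi =1 cycle_path_sum \o f'.
  have l : linear (cycle_path_sum \o f') by move=> k a b /=; rewrite lf' ls.
  pose m := GRing.isLinear.Build K H (path_space Q K) *:%R (cycle_path_sum \o f') l.
  pose F : {linear H -> path_space Q K} := HB.pack (cycle_path_sum \o f') m.
  by exists F.
have phi_pow n h : (n < d)%N ->
    phi (x ^+ n * iota h) = qfact r n *: path_elt K (cycle_path n h).
  move=> nd; rewrite phiE /= -(datum_lift_pbw x iota) // fK.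
  by rewrite /cycle_path_sum pbw_ext_pbw.
have qf n : (n < d)%N -> qfact r n != 0 by apply: (qfact_prim_neq0 rd).
have pow_linP (W : lmodType K) (F F' : H -> W) : linear F -> linear F' ->
    (forall n h, (n < d)%N -> F (x ^+ n * iota h) = F' (x ^+ n * iota h)) -> F =1 F'.
  move=> lF lF' e c; rewrite -[c]f'K; move: (f' c); apply: pbw_linP => [||n h nd].
  - exact: comp_linear lF lf.
  - exact: comp_linear lF' lf.
  by rewrite /f datum_lift_pbw // e.
pose elt (p : qpath Q) : H := (qfact r (qlength p))^-1 *: (x ^+ qlength p * iota (pstart p)).
have d1 := nontrivial_d_gt1 nt.
have lphi : linear phi by exact: linearP.
have inj : injective phi.
  move=> c c' e; have e' : cycle_path_sum (f' c) = cycle_path_sum (f' c').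
    by move: e; rewrite !phiE.
  apply: (can_inj f'K); apply/ffunP => -[[n nd] h].
  have nd' : (n < d)%N by rewrite -predn_d.
  have := cycle_path_sum_coef (f' c) h nd; rewrite e' cycle_path_sum_coef => /esym.
  by apply: mulIf; apply: qf.
have supp c : path_span (fun p => (qlength p < d)%N) (phi c).
  move=> p; rewrite -mcoeff_neq0; apply: contraNT; rewrite -leqNgt => dp.
  pose F (u : path_space Q K) : K^o := u@_p.
  have lF : linear F by exact: mcoeff_linear.
  have FE k q : F (k *: path_elt K q) = k * (q == p)%:R by exact: mcoeff_scale_elt.
  have -> : (phi c)@_p = F (cycle_path_sum (f' c)) by rewrite phiE.
  apply/eqP; rewrite /cycle_path_sum /pbw_ext (lin_sum lF) big1 // => q _.
  rewrite scalerA FE; case: eqP => [e|_]; last by rewrite mulr0.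
  have : (q.1 < d)%N by have := ltn_ord q.1; have := gd_d_gt0 alpha; lia.
  by move: dp; rewrite -e qlength_cycle_path leqNgt => /negPf ->.
have phi_elt p : (qlength p < d)%N -> phi (elt p) = path_elt K p.
  move=> pd; rewrite /elt (linZ lphi) phi_pow // scalerA mulVf ?qf // scale1r.
  by rewrite -cycle_pathE.
have phiD c : path_comul (phi c) = tmap phi phi (comul c).
  have lt := tmap_linear lphi lphi.
  have lD : linear (@comul K H) by exact: linearP.
  move: c; apply: pow_linP => [||n h nd].
  - exact: comp_linear (@path_comul_linear _ _) lphi.
  - exact: comp_linear lt lD.
  rewrite phi_pow // (linZ (@path_comul_linear _ _)) path_comulE /path_comul1.
  rewrite qlength_cycle_path comul_pow (lin_sum lt) scaler_sumr.
  rewrite [RHS](reindex_inj rev_ord_inj); apply: eq_bigr => i _.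
  have iN : (i <= n)%N by rewrite -ltnS.
  have ri : rev_ord i = (n - i)%N :> nat by rewrite /= subSS.
  rewrite ri subKn // (linZ lt) (tmap_tens lphi lphi).
  rewrite phi_pow; last by apply: leq_ltn_trans nd; apply: leq_subr.
  rewrite phi_pow; last exact: leq_ltn_trans nd.
  rewrite (beta_cycle_path h iN) (alpha_cycle_path h iN).
  apply: scale_tens_eq.
  have := @qbinom_qfact _ r n (n - i) (leq_subr _ _).
  by rewrite subKn // => <-; ring.
have phie c : path_counit (phi c) = counit c.
  pose T (p : qpath Q) : K^o := (qlength p == 0%N)%:R.
  have lT : linear (path_ext T) by exact: path_ext_linear.
  have lce : linear (counit : H -> K^o) by exact: linearP.
  rewrite -[LHS]/(path_ext T (phi c)); move: c.
  apply: (pow_linP K^o (fun c => path_ext T (phi c)) counit) => [||n h nd].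
  - exact: comp_linear lT lphi.
  - exact: lce.
  rewrite phi_pow // (linZ lT) path_ext_elt /T qlength_cycle_path counit_pow.
  by case: eqP => [->|_]; rewrite ?scaler0 // /qfact big_ord0 scale1r.
have Pv (v : vertex Q) : (qlength (vertex_path v) < d)%N by exact: gd_d_gt0.
have Pa (a : arrow Q) : (qlength (arrow_path a) < d)%N by exact: d1.
have Psub (p : qpath Q) i : (qlength p < d)%N -> (i <= qlength p)%N ->
    (qlength (path_beta p i) < d)%N /\ (qlength (path_alpha p i) < d)%N.
  by move=> pd ip; rewrite size_beta size_alpha //; lia.
exists (@PathModel K H Q phi _ elt d inj supp phi_elt phiD phie Pv Pa Psub (fun p pd => pd)).
move=> v; exists v; rewrite /glv /= /elt /= expr0 mul1r /qfact big_ord0 invr1.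
by rewrite scale1r.
Qed.

End DatumModel.

(** * The datum induced by the Hopf algebra of a datum *)

Section DatumHopfMonomial.
Variables (K : fieldType) (alpha : group_datum K) (H : hopfAlgebra K).
Hypotheses (nt : nontrivial_datum alpha) (dH : is_datum_hopf alpha H).
Local Notation G := (gd_group alpha).

Lemma datum_hopf_model : exists (iota : G -> H) (x : H) (M : path_model H),
  [/\ datum_pbw x iota, comul x = iota (gd_g alpha) \ox x + x \ox 1,
      forall h, grouplike (iota h)
    & forall v : vertex (pm_quiver M), exists h, glv v = iota h].
Proof.
have [iota [x [rel univ [xD xe _] hD]]] := dH.
have D h : comul (iota h) = iota h \ox iota h by case: (hD h).
have E h : counit (iota h) = 1 by case: (hD h).
have [M MP] := datum_model nt rel univ xD xe D E.
exists iota, x, M; split=> //; exact: universal_pbw.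
Qed.

Lemma datum_hopf_monomial : monomial_hopf H.
Proof. by have [_ [_ [M _]]] := datum_hopf_model; apply: model_monomial. Qed.

Lemma datum_hopf_induced : induced_group_datum H alpha.
Proof.
have [iota [x [M [[rel fb] xD gl MP]]]] := datum_hopf_model.
have d1 := nontrivial_d_gt1 nt; have d0 := gd_d_gt0 alpha.
have finj := bij_inj fb; have lf := datum_lift_linear x iota.
have iE h : iota h = datum_lift x iota (pbw 0 h) by rewrite datum_lift_pbw // mul1r.
exists iota, x; split.
- move=> h h'; rewrite !iE => /finj /ffunP /(_ (ord0, h)); rewrite !ffunE !eqxx /=.
  by case: (h =P h') => // _ /eqP; rewrite oner_eq0.
- move=> c; split=> [/(grouplike_glv M) [v ->]|[h ->]]; last exact: gl.
  exact: MP.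
- split; first by rewrite /skew_primitive xD addrC.
  case=> k; have -> : x = datum_lift x iota (pbw 1 1%g).
    by rewrite datum_lift_pbw // expr1; case: rel => -> _ _ _; rewrite mulr1.
  have i1 : 1 = iota 1%g by case: rel.
  rewrite i1 !iE -(linB lf) -(linZ lf) => /finj /ffunP.
  have o1 : (1 < (gd_d alpha).-1.+1)%N by rewrite predn_d.
  move=> /(_ (Ordinal o1, 1%g)); rewrite !ffunE !eqxx /= subrr scaler0.
  by move/(@natb_inj K true false).
- exact: rel.
Qed.

End DatumHopfMonomial.

(** * Semisimplicity of group algebras *)

Section Maschke.
Variable K : fieldType.

(** A matrix of maximal rank among those with row space in [P] has row space
    [P]. *)
Lemma subspace_projection n (P : 'rV[K]_n -> Prop) :
  P 0 -> (forall k u v, P u -> P v -> P (k *: u + v)) ->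
  exists M : 'M[K]_n, (forall v, P (v *m M)) /\ forall v, P v -> v *m M = v.
Proof.
move=> P0 Plin; have PD u v : P u -> P v -> P (u + v).
  by move=> Pu Pv; rewrite -[u]scale1r; apply: Plin.
have PZ k u : P u -> P (k *: u) by move=> Pu; rewrite -[_ *: _]addr0; apply: Plin.
pose good r := `[< exists A : 'M[K]_n, (forall v, P (v *m A)) /\ \rank A = r >].
have ex : exists r, good r.
  exists 0%N; apply/asboolP; exists 0; rewrite mxrank0; split=> // v.
  by rewrite mulmx0.
have bd r : good r -> (r <= n)%N by move=> /asboolP[A [_ <-]]; apply: rank_leq_row.
case: (ex_maxnP ex bd) => r /asboolP[A [PA rA]] rmax.
exists (pinvmx A *m A); split=> [v|v Pv]; first by rewrite mulmxA.
rewrite mulmxA mulmxKpV //; apply: contraT => vA.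
have : (\rank (A + v)%MS <= r)%N.
  apply: rmax; apply/asboolP; exists (A + v)%MS; split=> // u.
  have /sub_addsmxP[[u1 u2] /= ->] : (u *m (A + v)%MS <= A + v)%MS by apply: submxMl.
  apply: PD => //; rewrite [u2]mx11_scalar mul_scalar_mx; exact: PZ.
rewrite -rA leqNgt => /negP; case; apply: rank_ltmx.
by rewrite /ltmx addsmxSl addsmx_sub submx_refl (negPf vA).
Qed.

(** Maschke's argument: averaging a linear projection onto a left ideal over the
    group makes it linear over the algebra. *)
Lemma group_span_semisimple (A : algType K) (G : finGroupType) (iota : G -> A) n
    (e : A -> 'rV[K]_n) (e' : 'rV[K]_n -> A) :
  [pchar K] =i pred0 -> iota 1%g = 1 ->
  {morph iota : h h' / (h * h')%g >-> h * h'} ->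
  (forall c, exists a : G -> K, c = \sum_h a h *: iota h) ->
  linear e -> linear e' -> cancel e e' -> semisimple A.
Proof.
move=> /pcharf0P c0 i1 iM span le le' ee' I [I0 ID IM].
have IZ k a : I a -> I (k *: a) by move=> Ia; rewrite -[a]mul1r scalerAl; apply: IM.
have Isum (J : finType) (F : J -> A) : (forall j, I (F j)) -> I (\sum_j F j).
  by move=> IF; apply: (big_ind I).
have [||M [MI Mid]] := @subspace_projection n (fun v => I (e' v)).
- by rewrite (lin0 le').
- by move=> k u v Iu Iv; rewrite le'; apply: ID => //; apply: IZ.
pose pi c := e' (e c *m M).
have lpi : linear pi by move=> k a b; rewrite /pi le mulmxDl -scalemxAl le'.
have piI c : I (pi c) by apply: MI.
have piid c : I c -> pi c = c by move=> Ic; rewrite /pi Mid ?ee'.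
have G0 : (#|G|%:R : K) != 0 by rewrite c0 -lt0n; apply/card_gt0P; exists 1%g.
pose av c := #|G|%:R^-1 *: \sum_h iota h^-1%g * pi (iota h * c).
have lav : linear av.
  move=> k a b; rewrite /av scalerA mulrC -scalerA -scalerDr; congr (_ *: _).
  rewrite scaler_sumr -big_split; apply: eq_bigr => h _ /=.
  by rewrite mulrDr -scalerAr lpi mulrDr scalerAr.
have avI c : I (av c) by apply: IZ; apply: Isum => h; apply: IM.
have avid c : I c -> av c = c.
  move=> Ic; rewrite /av (eq_bigr (fun=> c)) => [|h _].
    by rewrite sumr_const -scaler_nat scalerA mulVf // scale1r.
  by rewrite piid; [rewrite mulrA -iM mulVg i1 mul1r|apply: IM].
have avM r c : av (r * c) = r * av c.
  have [a ->] := span r; rewrite !mulr_suml (lin_sum lav); apply: eq_bigr => k _.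
  rewrite -!scalerAl (linZ lav); congr (_ *: _).
  rewrite /av -scalerAr mulr_sumr; congr (_ *: _).
  rewrite (reindex_inj (mulIg k^-1%g)) /=; apply: eq_bigr => h _.
  by rewrite invMg invgK iM -mulrA; congr (_ * (_ * pi _)); rewrite mulrA -iM mulgKV.
exists (fun c => av c = 0); split.
- split; first exact: (lin0 lav).
  + by move=> a b a0 b0; rewrite (linD lav) a0 b0 addr0.
  + by move=> r a a0; rewrite avM a0 mulr0.
- by move=> a Ia; rewrite avid.
- move=> c; exists (av c), (c - av c); split=> //; last by rewrite addrC subrK.
  by rewrite (linB lav) (avid (av c)) ?subrr.
Qed.

End Maschke.

(** * Skew-primitive eigenvectors *)

Lemma scale2_eq (K : fieldType) (V : lmodType K) (a b a' b' : K) (u v : V) :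
  a *: u + b *: v = a' *: u + b' *: v -> (a - a') *: u = (b' - b) *: v.
Proof.
by move=> e; rewrite !scalerBl; apply/eqP; rewrite subr_eq addrAC eq_sym subr_eq e addrC.
Qed.

Section SkewAlgebra.
Variables (K : fieldType) (H : hopfAlgebra K).
Implicit Types (g c : H).

Lemma skew_lin g k c c' : skew_primitive 1 g c -> skew_primitive 1 g c' ->
  skew_primitive 1 g (k *: c + c').
Proof.
rewrite /skew_primitive linearP => -> ->.
by rewrite scalerDr addrACA -(linZ (tens_linl _)) -(linD (tens_linl _))
  -(linZ (tens_linr _)) -(linD (tens_linr _)).
Qed.

Lemma skew_trivial g : grouplike g -> skew_primitive 1 g (1 - g).
Proof.
move=> gg; rewrite /skew_primitive linearB /= comul1 gg.1.
by rewrite (linB (tens_linl _)) (linB (tens_linr _)) addrA subrK.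
Qed.

Lemma skew_lr g a b c : grouplike a -> grouplike b -> a * b = 1 ->
  skew_primitive 1 g c -> skew_primitive 1 (a * g * b) (a * c * b).
Proof.
move=> ga gb ab cD; rewrite /skew_primitive !comulM cD ga.1 gb.1 !tmulgE_tmul.
by rewrite (linD (tmulg_linr _)) (linD (tmulg_linl _)) !tmulgE mulr1 ab.
Qed.

(** In the quantum plane spanned by [x (x) 1] and [g (x) x] the [d]-th power
    is additive. *)
Lemma skew_power g x r d : grouplike g -> skew_primitive 1 g x ->
  d.-primitive_root r -> g * x = r *: (x * g) -> skew_primitive 1 (g ^+ d) (x ^+ d).
Proof.
move=> gg xD rd gx; have lce : linear (counit : H -> K^o) by exact: linearP.
pose A := Augmented lce (counit1 H).
pose a : tensor_alg A A := x \ox 1; pose b : tensor_alg A A := g \ox x.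
have ba : b * a = r *: (a * b).
  by rewrite /a /b !tensor_algM mul1r mulr1 gx linearZl_LR.
have Dn n : comul (x ^+ n) = (a + b) ^+ n :> tensor_alg A A.
  elim: n => [|n IH]; first by rewrite !expr0 comul1.
  by rewrite !exprS comulM IH xD.
by rewrite /skew_primitive Dn (exprD_prim rd ba) /a /b !tensor_algX expr1n.
Qed.

End SkewAlgebra.

Section GrouplikeGroup.
Variables (K : fieldType) (H : hopfAlgebra K) (M : path_model H).

(** The vertices, with the product of the corresponding group-like elements. *)
Definition vgroup : Type := vertex (pm_quiver M).
HB.instance Definition _ := Finite.on vgroup.

Definition vmul (v w : vgroup) : vgroup :=
  sval (cid (grouplike_glv M (grouplikeM (glv_grouplike v) (glv_grouplike w)))).
Definition vone : vgroup := sval (cid (grouplike_glv M (grouplike1 H))).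
Definition vinv (v : vgroup) : vgroup :=
  sval (cid (grouplike_glv M (antipode_grouplike (glv_grouplike v)))).

Lemma glvM v w : glv (vmul v w) = glv v * glv w.
Proof. by rewrite /vmul; case: cid. Qed.

Lemma glv1 : glv vone = 1.
Proof. by rewrite /vone; case: cid. Qed.

Lemma glvV v : glv (vinv v) = antipode (glv v).
Proof. by rewrite /vinv; case: cid. Qed.

Lemma vmulA : associative vmul.
Proof. by move=> u v w; apply: (@glv_inj _ _ M); rewrite !glvM mulrA. Qed.

Lemma vmul1 : left_id vone vmul.
Proof. by move=> v; apply: (@glv_inj _ _ M); rewrite glvM glv1 mul1r. Qed.

Lemma vmulV : left_inverse vone vinv vmul.
Proof.
move=> v; apply: (@glv_inj _ _ M); rewrite glvM glvV glv1.
by case: (antipode_grouplikeV (glv_grouplike v)).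
Qed.

HB.instance Definition _ := Finite_isGroup.Build vgroup vmulA vmul1 vmulV.

End GrouplikeGroup.

Section InducedExists.
Variables (K : fieldType) (H : hopfAlgebra K) (M : path_model H).
Hypothesis c0 : [pchar K] =i pred0.
Local Notation G := (vgroup M).
Local Notation iota := (@glv _ _ M : G -> H).

Let iota1 : iota 1%g = 1. Proof. exact: glv1. Qed.
Let iotaM : {morph iota : h h' / (h * h')%g >-> h * h'}. Proof. exact: glvM. Qed.
Let iota_inj : injective iota. Proof. exact: glv_inj. Qed.
Let gl h : grouplike (iota h). Proof. exact: glv_grouplike. Qed.
Let iotaP c : grouplike c <-> exists h, c = iota h.
Proof. by split=> [/(grouplike_glv M)|[h ->]]. Qed.
Let Vl h : iota h^-1%g * iota h = 1. Proof. by rewrite -iotaM mulVg. Qed.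
Let Vr h : iota h * iota h^-1%g = 1. Proof. by rewrite -iotaM mulgV. Qed.

(** Without arrows, the Hopf algebra is the group algebra of its group-like
    elements. *)
Lemma no_arrow_semisimple : ~ (exists ar : arrow (pm_quiver M), True) -> semisimple H.
Proof.
move=> na; set V := vertex (pm_quiver M).
have pE c : c = \sum_(v : V) pcoef (vertex_path v) c *: glv v.
  apply: (@pcoef_inj _ _ M) => q; rewrite (lin_sum (pcoef_linear _)).
  have q0 : qlength q = 0%N.
    apply/eqP; rewrite -leqn0 leqNgt; apply/negP => q0.
    have q1 : qlength (path_alpha q 1) = 1%N by rewrite size_alpha.
    by have [ar _] := arrow_path_of q1; apply: na; exists ar.
  rewrite (vertex_path_of q0) (bigD1 (pstart q)) //= big1 => [|v vq].
    by rewrite (linZ (pcoef_linear _)) pcoef_glv eqxx addr0 [_ *: _]mulr1.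
  by rewrite (linZ (pcoef_linear _)) pcoef_glv vertex_path_eq (negPf vq) scaler0.
pose e c : 'rV[K]_(#|V|) := \row_i pcoef (vertex_path (enum_val i)) c.
pose e' (v : 'rV[K]_(#|V|)) : H := \sum_i v 0 i *: glv (enum_val i).
apply: (@group_span_semisimple _ _ G iota _ e e' c0 iota1 iotaM).
- move=> c; exists (fun h => pcoef (vertex_path (h : V)) c).
  rewrite [LHS]pE (reindex (fun h : G => h : V)) //.
  by apply: onW_bij; exists (fun v : V => v : G).
- by move=> k a b; apply/rowP => i; rewrite !mxE pcoef_linear.
- move=> k a b; rewrite /e' scaler_sumr -big_split; apply: eq_bigr => i _.
  by rewrite !mxE scalerDl scalerA.
- move=> c; rewrite [RHS]pE /e' (reindex (@enum_val _ (mem V))) /=; last first.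
    by apply: onW_bij; exact: enum_val_bij.
  by apply: eq_bigr => i _; rewrite mxE.
Qed.

Lemma arrow_nontrivial : (exists ar : arrow (pm_quiver M), True) ->
  exists (g : G) (c : H), nontrivial_skew_primitive 1 (iota g) c.
Proof.
case=> ar _; pose s : G := src ar; pose t : G := tgt ar.
have cK : pm_elt M (arrow_path ar) * iota s^-1%g * iota s = pm_elt M (arrow_path ar).
  by rewrite -mulrA Vl mulr1.
exists (t * s^-1)%g, (pm_elt M (arrow_path ar) * iota s^-1%g); split.
  rewrite /skew_primitive comulM (arrow_skew ar) tmulgE_tmul (gl _).1.
  rewrite (linD (tmulg_linl _)) !tmulgE -/s -/t -[glv s]/(iota s) Vr.
  by rewrite iotaM.
case=> k ck; have := pcoef_arrow ar ar; rewrite -cK ck -scalerAl mulrBl mul1r.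
rewrite -iotaM mulgKV (linZ (pcoef_linear _)) (linB (pcoef_linear _)).
rewrite !pcoef_arrow_glv subrr scaler0 eqxx.
by move=> /(@natb_inj K false true).
Qed.

(** Averaging over the group-like elements makes a skew-primitive element an
    eigenvector for conjugation. *)
Lemma eigen_skew_primitive (g : G) (c : H) : nontrivial_skew_primitive 1 (iota g) c ->
  exists (x : H) (chi : G -> K),
  [/\ nontrivial_skew_primitive 1 (iota g) x, forall h, commute g h,
      forall h, chi h != 0, forall h h', chi (h * h')%g = chi h * chi h'
    & forall h, x * iota h = chi h *: (iota h * x)].
Proof.
move=> cP; have [cD cn] := cP.
pose cj h := iota h^-1%g * c * iota h.
have cjP h : (h^-1 * g * h = g)%g /\ exists u k : K, u != 0 /\
    cj h = u *: c + k *: (1 - iota g).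
  have sk : skew_primitive 1 (iota (h^-1 * g * h)%g) (cj h).
    by rewrite !iotaM; apply: skew_lr.
  have nt : ~ exists k : K, cj h = k *: (1 - iota (h^-1 * g * h)%g).
    case=> k e; apply: cn; exists k.
    have -> : c = iota h * cj h * iota h^-1%g.
      by rewrite /cj !mulrA Vr mul1r -mulrA Vr mulr1.
    rewrite e -scalerAr -scalerAl mulrBr mulrBl mulr1 Vr -!iotaM.
    by rewrite !mulgA mulgV mul1g mulgK.
  have [eg [u [k [u0 e]]]] := skew_primitive_unique M (gl g) (gl _) cP (conj sk nt).
  by split; [rewrite -(iota_inj eg)|exists u, k].
have gC h : commute g h.
  by have [e _] := cjP h; rewrite /commute -{2}e !mulgA mulgV mul1g.
have /choice[chi chiP] : forall h, exists u : K, u != 0 /\ exists k : K,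
    cj h = u *: c + k *: (1 - iota g).
  by move=> h; have [_ [u [k [u0 e]]]] := cjP h; exists u; split=> //; exists k.
have chi0 h : chi h != 0 by case: (chiP h).
have indep a b a' b' : a *: c + b *: (1 - iota g) = a' *: c + b' *: (1 - iota g) ->
    a = a'.
  move=> e; apply/eqP; rewrite -subr_eq0; apply/negPn/negP => aa; apply: cn.
  exists ((a - a')^-1 * (b' - b)); rewrite -scalerA -(scale2_eq e).
  by rewrite scalerA mulVf // scale1r.
have cjM h h' : cj (h * h')%g = iota h'^-1%g * cj h * iota h'.
  by rewrite /cj invMg !iotaM !mulrA.
have gfix h : iota h^-1%g * (1 - iota g) * iota h = 1 - iota g.
  by rewrite mulrBr mulrBl mulr1 Vl -!iotaM -mulgA gC mulKg.
have chiM h h' : chi (h * h')%g = chi h * chi h'.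
  have [_ [k e]] := chiP h; have [_ [k' e']] := chiP h'.
  have [_ [k'' e'']] := chiP (h * h')%g.
  apply: (indep _ k'' _ (chi h * k' + k)); rewrite -e'' cjM e.
  rewrite mulrDr mulrDl -!scalerAr -!scalerAl gfix -/(cj h') e'.
  by rewrite scalerDr !scalerA -addrA -scalerDl.
pose x := \sum_h (chi h)^-1 *: cj h.
have [k xE] : exists k : K, x = #|{: G}|%:R *: c + k *: (1 - iota g).
  have /choice[k kE] : forall h, exists k : K, (chi h)^-1 *: cj h = c + k *: (1 - iota g).
    move=> h; have [_ [k e]] := chiP h; exists ((chi h)^-1 * k).
    by rewrite e scalerDr !scalerA mulVf // scale1r.
  exists (\sum_h k h); rewrite /x (eq_bigr _ (fun h _ => kE h)) big_split /=.
  by rewrite sumr_const scaler_nat scaler_suml.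
have G0 : (#|{: G}|%:R : K) != 0.
  by have /pcharf0P -> := c0; rewrite -lt0n; apply/card_gt0P; exists 1%g.
exists x, chi; split=> //.
- split.
    rewrite xE; apply: skew_lin => //; rewrite -[_ *: _]addr0.
    apply: skew_lin; first exact: skew_trivial.
    rewrite /skew_primitive linear0.
    by rewrite (lin0 (tens_linl _)) (lin0 (tens_linr _)) addr0.
  case=> k' e; case/eqP: G0; apply: (indep _ k _ k'); by rewrite -xE e scale0r add0r.
move=> h; rewrite /x mulr_suml mulr_sumr scaler_sumr [RHS](reindex_inj (mulIg h)) /=.
apply: eq_bigr => h' _; rewrite -scalerAl -scalerAr scalerA chiM.
by rewrite cjM !mulrA Vr mul1r invfM mulrCA mulfV ?mulr1.
Qed.

End InducedExists.

(** * Existence of an induced datum *)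

Section Existence.
Variables (K : fieldType) (H : hopfAlgebra K) (M : path_model H).
Hypothesis c0 : [pchar K] =i pred0.

(** The power [x ^+ d] is skew-primitive for [g ^+ d]. Were it nontrivial, then
    [g ^+ d = g] by uniqueness, which contradicts that [chi g] has order
    [d > 1]. And [chi g] is not [1], since otherwise all paths would have length
    less than [1], by [path_length_bound]. *)
Lemma induced_exists : ~ semisimple H -> exists alpha, induced_group_datum H alpha.
Proof.
move=> ns; have ex : exists ar : arrow (pm_quiver M), True.
  by apply: contrapT => /(no_arrow_semisimple c0).
pose G := vgroup M; pose iota : G -> H := @glv _ _ M.
have i1 : iota 1%g = 1 by exact: glv1.
have iM : {morph iota : h h' / (h * h')%g >-> h * h'} by exact: glvM.
have iinj : injective iota by exact: glv_inj.
have gl h : grouplike (iota h) by exact: glv_grouplike.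
have iP c : grouplike c <-> exists h, c = iota h.
  by split=> [/(grouplike_glv M)|[h ->]].
have [g [c cP]] := arrow_nontrivial ex.
have [x [chi [xP gC chi0 chiM xh]]] := eigen_skew_primitive c0 cP.
have chi1 : chi 1%g = 1.
  by apply: (mulfI (chi0 1%g)); rewrite -chiM mulg1 mulr1.
have chiX n : chi (g ^+ n)%g = chi g ^+ n.
  by elim: n => [|n IH]; rewrite ?expg0 // expgS chiM IH exprS.
pose d := mulord (chi g).
have d0 : (0 < d)%N.
  by apply: (@mulord_gt0 _ _ #[g]%g); rewrite ?order_gt0 // -chiX expg_order.
have dP : d.-primitive_root (chi g) by apply/mulord_prim.
have rP := prim_rootV dP.
have bound p : pm_path M p -> (qlength p < d)%N.
  apply: (path_length_bound iinj iP i1 iM gC chi0 chiM xP xh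
    (vg := fun v => v : G) (gv := fun h : G => h) _ _ _ c0 rP) => //.
have d1 : (1 < d)%N.
  by case: ex => ar _; have := bound _ (pm_arrow ar).
have gx : iota g * x = (chi g)^-1 *: (x * iota g).
  by rewrite xh scalerA mulVf // scale1r.
have xdD := skew_power (gl g) xP.1 rP gx.
have iX n : iota g ^+ n = iota (g ^+ n)%g by rewrite (morph_mulgX i1 iM).
have [k xd] : exists k : K, x ^+ d = k *: (1 - iota g ^+ d).
  apply: contrapT => nt; have gd : grouplike (iota g ^+ d) by rewrite iX.
  have [e _] := skew_primitive_unique M (gl g) gd xP (conj xdD nt).
  have eg : (g ^+ d.-1 = 1)%g.
    apply: (mulgI g); rewrite -expgS prednK // mulg1; apply: iinj.
    by rewrite -iX.
  have := prim_order_dvd dP d.-1; rewrite -chiX eg chi1 eqxx => /dvdn_leq.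
  by rewrite -[d.-1]subn1; lia.
(* If [g ^+ d = 1] then any scalar satisfies the relation, but a group datum
   requires [0]. *)
pose mu := if (g ^+ d == 1)%g then 0 else k.
have mu0 : #[g]%g = mulord (chi g) -> mu = 0.
  by rewrite /mu -/d => <-; rewrite expg_order eqxx.
have xdmu : x ^+ d = mu *: (1 - iota g ^+ d).
  by rewrite xd /mu iX; case: eqP => // ->; rewrite i1 subrr !scaler0.
have mun0 : mu != 0 -> forall h, chi h ^+ mulord (chi g) = 1.
  rewrite /mu -/d; case: (g ^+ d =P 1)%g => [_|gd1 k0 h]; first by rewrite eqxx.
  have e := expr_qcommr d (xh h).
  have gdC : iota (g ^+ d)%g * iota h = iota h * iota (g ^+ d)%g.
    by rewrite -!iM; congr iota; apply/commute_sym/commuteX/commute_sym/gC.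
  have V : iota h^-1%g * iota h = 1 by rewrite -iM mulVg.
  move: e; rewrite xd iX -scalerAl -scalerAr scalerA mulrBl mul1r gdC.
  rewrite mulrBr mulr1 => /(congr1 (fun c => iota h^-1%g * c)).
  rewrite -!scalerAr !mulrBr !mulrA V !mul1r => /eqP.
  rewrite -subr_eq0 -scalerBl scaler_eq0 => /orP[|]; last first.
    by rewrite subr_eq0 -i1 => /eqP /iinj /esym.
  rewrite -{1}[k]mul1r -mulrBl mulf_eq0 (negPf k0) orbF subr_eq0 => /eqP <- //.
exists (@GroupDatum K G g chi mu gC chi0 chiM mu0 mun0), iota, x.
by split.
Qed.

End Existence.

(** * Uniqueness of the induced datum *)

Section Uniqueness.
Variable K : fieldType.

Lemma hopf_map_grouplike (H H' : hopfAlgebra K) (f : {lrmorphism H -> H'}) c :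
  hopf_map f -> grouplike c -> grouplike (f c).
Proof.
have lf : linear f by exact: linearP.
by case=> fD fe _ [cD ce]; split; rewrite ?fD ?fe // cD tmap_tens.
Qed.

(** Uniqueness of skew-primitive elements gives [x' = delta *: F x + k *: (1 - g')],
    and comparison of the commutation rules with [g'] gives [k = 0] because
    [chi' g'] is not [1]. *)
Lemma induced_unique (H H' : hopfAlgebra K) (alpha alpha' : group_datum K) :
  path_model H' -> hopf_iso H H' -> induced_group_datum H alpha ->
  induced_group_datum H' alpha' -> datum_iso alpha alpha'.
Proof.
move=> M /hopf_iso_inv[F [F' [FK F'K FH F'H]]]; have [FD _ _] := FH.
have Fg c : grouplike c -> grouplike (F c) := hopf_map_grouplike FH.
have F'g c : grouplike c -> grouplike (F' c) := hopf_map_grouplike F'H.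
case=> iota [x [iinj iP xP rel]] [iota' [x' [iinj' iP' xP' rel']]].
have nt' := induced_nontrivial xP' rel'.
have lF : linear F by exact: linearP.
have gl h : grouplike (iota h) by apply/iP; exists h.
have gl' h : grouplike (iota' h) by apply/iP'; exists h.
have /choice[f fE] : forall h, exists h', F (iota h) = iota' h'.
  by move=> h; apply/iP'/Fg/gl.
have /choice[f' f'E] : forall h, exists h', F' (iota' h) = iota h'.
  by move=> h; apply/iP/F'g/gl'.
have fK : cancel f f' by move=> h; apply: iinj; rewrite -f'E -fE FK.
have f'K : cancel f' f by move=> h; apply: iinj'; rewrite -fE -f'E F'K.
have [i1 iM xd xh] := rel; have [i1' iM' xd' xh'] := rel'.
have fM : {morph f : h h' / (h * h')%g}.
  by move=> h h'; apply: iinj'; rewrite iM' -!fE iM rmorphM.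
have FxP : nontrivial_skew_primitive 1 (F (iota (gd_g alpha))) (F x).
  case: xP => xD xn; split.
    rewrite /skew_primitive FD xD (linD (tmap_linear lF lF)) !tmap_tens //.
    by rewrite rmorph1.
  case=> k e; apply: xn; exists k; apply: (can_inj FK).
  by rewrite e linearZ rmorphB rmorph1.
have [eg [delta [k [d0 ex]]]] := skew_primitive_unique M (Fg _ (gl _)) (gl' _) FxP xP'.
have fg : f (gd_g alpha) = gd_g alpha' by apply: iinj'; rewrite -fE.
set g' := gd_g alpha' in fg xP' xd' *.
rewrite eg in ex FxP.
have Fxh h : F x * iota' h = gd_chi (f' h) *: (iota' h * F x).
  have -> : iota' h = F (iota (f' h)) by rewrite fE f'K.
  by rewrite -!rmorphM /= xh (linZ lF).
have gh h : (1 - iota' g') * iota' h = iota' h * (1 - iota' g').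
  by rewrite mulrBl mulrBr mul1r mulr1 -!iM' gd_gC.
have indep a b : a *: F x = b *: (1 - iota' g') -> a = 0.
  move=> e; apply/eqP/negPn/negP => a0; case: FxP => _; apply.
  by exists (a^-1 * b); rewrite -scalerA -e scalerA mulVf // scale1r.
have key h : (delta * (gd_chi (f' h) - gd_chi h)) *: F x =
    (k * (gd_chi h - 1)) *: (1 - iota' g').
  have Vl : iota' h^-1%g * iota' h = 1 by rewrite -iM' mulVg.
  move: ex gh; move: (1 - iota' g') => y ex gh.
  have e : iota' h * ((delta * gd_chi (f' h)) *: F x + k *: y) =
      iota' h * ((gd_chi h * delta) *: F x + (gd_chi h * k) *: y).
    have := xh' h; rewrite ex mulrDl -!scalerAl Fxh gh.
    by rewrite !mulrDr -!scalerAr scalerDr !scalerA.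
  have := congr1 (fun c => iota' h^-1%g * c) e; rewrite !mulrA Vl !mul1r.
  by move/scale2_eq; rewrite !mulrBr mulr1 ![_ * gd_chi h]mulrC.
have echi h : gd_chi (f' h) = gd_chi h.
  have /indep /eqP := key h; rewrite mulf_eq0 (negPf d0) /= subr_eq0.
  by move/eqP.
have g1 : 1 - iota' g' != 0.
  rewrite subr_eq0 -i1'; apply/eqP => /iinj' e; apply: nt'.
  by rewrite -/g' -e gd_chi1.
have k0 : k = 0.
  have /esym/eqP := key g'; rewrite echi subrr mulr0 scale0r scaler_eq0 (negPf g1) orbF.
  by rewrite mulf_eq0 subr_eq0 => /orP[/eqP//|/eqP].
have fchi h : gd_chi h = gd_chi (f h) by rewrite -echi fK.
have ed := datum_iso_d fg fchi.
exists f, delta^-1; split=> //; first by split=> //; exists f'.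
  by rewrite invr_eq0.
have [gd1|gd1] := eqVneq (g' ^+ gd_d alpha')%g 1%g.
  rewrite (gd_mu_expg_eq1 gd1) mulr0; apply: gd_mu_expg_eq1.
  apply: (can_inj fK); apply: iinj'; rewrite -!fE.
  rewrite (morph_mulgX i1 iM) rmorphXn /= eg ed -(morph_mulgX i1' iM') gd1.
  by rewrite i1 rmorph1 i1'.
have y0 : 1 - iota' g' ^+ gd_d alpha' != 0.
  rewrite subr_eq0 -i1' -(morph_mulgX i1' iM'); apply/eqP => /iinj' e.
  by rewrite -e eqxx in gd1.
have : gd_mu alpha' *: (1 - iota' g' ^+ gd_d alpha') =
    (delta ^+ gd_d alpha' * gd_mu alpha) *: (1 - iota' g' ^+ gd_d alpha').
  rewrite -xd' ex k0 scale0r addr0 exprZn -scalerA; congr (_ *: _).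
  rewrite -rmorphXn /= -ed xd linearZ rmorphB rmorph1 rmorphXn /= eg.
  by [].
move/eqP; rewrite -subr_eq0 -scalerBl scaler_eq0 (negPf y0) orbF subr_eq0 => /eqP ->.
by rewrite ed mulrA -exprMn mulVf // expr1n mul1r.
Qed.

End Uniqueness.

(** * Correspondences of isomorphism classes *)

Section Isoclass.
Variables (T : Type) (P : T -> Prop) (iso : T -> T -> Prop).
Hypotheses (refl : forall a, iso a a) (sym : forall a b, iso a b -> iso b a)
  (trans : forall a b c, iso a b -> iso b c -> iso a c).

Definition class_of (a : T) (Pa : P a) : isoclass P iso :=
  exist _ (fun b => P b /\ iso a b) (ex_intro2 _ _ a Pa erefl).

Lemma isoclassP (c : isoclass P iso) a : sval c a -> P a /\ sval c = (fun b => P b /\ iso a b).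
Proof.
case: c => c [a0 Pa0 cE] /=; rewrite {1}cE => -[Pa ia]; split=> //.
rewrite cE; apply: funext => b; apply: propext; split=> -[Pb ib]; split=> //.
  exact: trans (sym ia) ib.
exact: trans ia ib.
Qed.

Lemma isoclass_inhabited (c : isoclass P iso) : exists a, sval c a.
Proof. by case: c => c [a0 Pa0 cE] /=; exists a0; rewrite cE. Qed.

Lemma isoclass_eq (c c' : isoclass P iso) a : sval c a -> sval c' a -> c = c'.
Proof.
move=> /isoclassP[_ e] /isoclassP[_ e']; have {e e'} : sval c = sval c' by rewrite e e'.
case: c c' => [c p] [c' p'] /= e; case: _ / e p' => p'.
by congr exist; apply: Prop_irrelevance.
Qed.

End Isoclass.

Lemma class_map (T T' : Type) (P : T -> Prop) (iso : T -> T -> Prop)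
    (P' : T' -> Prop) (iso' : T' -> T' -> Prop) (F : T -> T' -> Prop) :
  (forall a, iso a a) -> (forall a b, iso a b -> iso b a) ->
  (forall a b c, iso a b -> iso b c -> iso a c) ->
  (forall a, P a -> exists b, F a b) -> (forall a b, P a -> F a b -> P' b) ->
  (forall a a' b b', P a -> P a' -> iso a a' -> F a b -> F a' b' -> iso' b b') ->
  exists f : isoclass P iso -> isoclass P' iso', induced_by F f.
Proof.
move=> refl sym trans Fex FP Fiso.
have /choice[f fP] : forall c : isoclass P iso, exists c' : isoclass P' iso',
    forall a b, sval c a -> F a b -> sval c' b.
  move=> c; have [a ca] := isoclass_inhabited refl c.
  have [Pa cE] := isoclassP sym trans ca; have [b Fab] := Fex a Pa.
  exists (class_of iso' (FP a b Pa Fab)) => a' b' ca' Fab' /=.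
  have [Pa' _] := isoclassP sym trans ca'; split; first exact: FP Fab'.
  by move: ca'; rewrite cE => -[_ iaa']; apply: Fiso Fab Fab'.
exists f => c a ca; split; last by move=> b; apply: fP.
by apply: Fex; case: (isoclassP sym trans ca).
Qed.

(** Two constructions inverse to each other up to isomorphism induce inverse
    bijections of isomorphism classes. *)
Lemma correspondence_of (T T' : Type) (P : T -> Prop) (iso : T -> T -> Prop)
    (P' : T' -> Prop) (iso' : T' -> T' -> Prop) (F : T -> T' -> Prop) (G : T' -> T -> Prop) :
  (forall a, iso a a) -> (forall a b, iso a b -> iso b a) ->
  (forall a b c, iso a b -> iso b c -> iso a c) ->
  (forall a, iso' a a) -> (forall a b, iso' a b -> iso' b a) ->
  (forall a b c, iso' a b -> iso' b c -> iso' a c) ->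
  (forall a, P a -> exists b, F a b) -> (forall a b, P a -> F a b -> P' b) ->
  (forall a a' b b', P a -> P a' -> iso a a' -> F a b -> F a' b' -> iso' b b') ->
  (forall b, P' b -> exists a, G b a) -> (forall b a, P' b -> G b a -> P a) ->
  (forall b b' a a', P' b -> P' b' -> iso' b b' -> G b a -> G b' a' -> iso a a') ->
  (forall a b, P a -> F a b -> G b a) -> (forall a b, P' b -> G b a -> F a b) ->
  one_to_one_correspondence P iso P' iso' F G.
Proof.
move=> refl sym trans refl' sym' trans' Fex FP Fiso Gex GP Giso FG GF.
have [f fF] := class_map refl sym trans Fex FP Fiso.
have [g gG] := class_map refl' sym' trans' Gex GP Giso.
exists f, g; split=> // c.
- have [a ca] := isoclass_inhabited refl c; have [Pa _] := isoclassP sym trans ca.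
  have [[b Fab] fc] := fF c a ca; apply: (isoclass_eq sym trans _ ca).
  by have [_] := gG (f c) b (fc b Fab); apply; apply: FG.
- have [b cb] := isoclass_inhabited refl' c; have [Pb _] := isoclassP sym' trans' cb.
  have [[a Gba] gc] := gG c b cb; apply: (isoclass_eq sym' trans' _ cb).
  by have [_] := fF (g c) a (gc a Gba); apply; apply: GF.
Qed.

Theorem theorem5p9 (K : fieldType) (charK0 : [pchar K] =i pred0)
    (rootsK : forall n : nat, (0 < n)%N -> exists z : K, n.-primitive_root z) :
  one_to_one_correspondence
    (@nonsemisimple_monomial_hopf K) (@hopf_iso K)
    (@nontrivial_datum K) (@datum_iso K)
    (@induced_group_datum K) (@is_datum_hopf K).
Proof.
have model (C : hopfAlgebra K) : nonsemisimple_monomial_hopf C -> inhabited (path_model C).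
  by case=> /monomial_model.
apply: correspondence_of.
- exact: hopf_iso_refl.
- exact: hopf_iso_sym.
- exact: hopf_iso_trans.
- exact: datum_iso_refl.
- exact: datum_iso_sym.
- exact: datum_iso_trans.
- by move=> C CP; have [M] := model _ CP; case: CP => _; apply: induced_exists.
- by move=> C alpha _ [iota [x [_ _ xP rel]]]; apply: induced_nontrivial xP rel.
- move=> C C' alpha alpha' _ C'P; have [M] := model _ C'P.
  exact: induced_unique.
- by move=> alpha _; exists (datum_hopf alpha); apply: is_datum_hopf_alg.
- move=> alpha C nt dC; split; first exact: datum_hopf_monomial dC.
  exact: datum_hopf_not_semisimple dC.
- by move=> alpha alpha' C C' _ _ i dC dC'; apply: datum_hopf_iso dC dC' i.
- move=> C alpha CP [iota [x [iinj iP xP rel]]]; have [M] := model _ CP.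
  exact: (induced_is_datum_hopf iinj iP xP rel M charK0).
- by move=> C alpha nt dC; apply: datum_hopf_induced.
Qed.
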